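(* Let $f_1,\dots,f_n:\mathbb{R}^d\to\mathbb{R}$ be separable functions satisfying assumptions (A1)--(A5) listed in the context, let $F=\frac1n\sum_{i=1}^n f_i$, let $K>0$ be the Lipschitz constant in (A4), and let $\eta$ be any value with $0<\eta<1/K$. Let $\varphi_i(x)=x-\eta\nabla f_i(x)$ and let $\mathcal{P}$ be the Markov operator $(\mathcal{P}\mu)(A)=\frac1n\sum_{i=1}^n\mu(\varphi_i^{-1}(A))$. With the state space $I$, the index set $\mathcal{M}$, the rectangles $T_{\mathbf m}$ ($\mathbf m\in\mathcal{M}$), $T=\bigcup_{\mathbf m\in\mathcal M}T_{\mathbf m}$ and the metrics $d_\alpha$, $d_F$, $d_{\rm TV}$ as defined in the context, the following hold. (a) $I$ is positive invariant and decomposes into the disjoint union $I=B\cup\big(\bigcup_{\mathbf m\in\mathcal M}T_{\mathbf m}\big)$, $B:=I\setminus T$, where: (i) each $T_{\mathbf m}$ ($\mathbf m\in\mathcal M$) is positive invariant (equivalently, absorbing) and contains at least one local minimizer of $F$; the number of sets $T_{\mathbf m}$ is at most the number of local minima of $F$. (ii) $T$ is non-empty and there exists $\ell_0=\ell_0(\eta)\in\mathbb{N}$ such that for every $x\in I$ there is a path $\vec p$ of length $\ell_0$ satisfying $\varphi_{\vec p}(x)\in T$. (iii) $B$ is uniformly transient, with $$(\mathcal{P}^{\ell_0}\mu)(B)\le\Big(1-\frac1{n^{\ell_0}}\Big)\mu(B)$$ for any probability measure $\mu\in\mathscr{P}(I)$. (b) For each $\mathbf m\in\mathcal M$ there exists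 a unique invariant probability measure $\mu^\star_{\mathbf m}$ of $\mathcal{P}$ with support contained in $T_{\mathbf m}$. Moreover, there exist $\ell_{\mathbf m}\in\mathbb{N}$ with $\ell_{\mathbf m}\ge d$ and $\alpha_{\mathbf m}\in\{+1,-1\}^d$ such that for any probability measure $\mu$ with support contained in $T_{\mathbf m}$, $$d_{\alpha_{\mathbf m}}\big(\mathcal{P}^k\mu,\mu^\star_{\mathbf m}\big)\le\Big(1-\frac1{n^{\ell_{\mathbf m}}}\Big)^{\lfloor k/\ell_{\mathbf m}\rfloor}\qquad (k>0).$$ In the case $d=1$, this convergence is a (stronger) contraction: $$d_F\big(\mathcal{P}^{\ell_{\mathbf m}}\mu,\mu^\star_{\mathbf m}\big)\le\Big(1-\frac1{n^{\ell_{\mathbf m}}}\Big)d_F(\mu,\mu^\star_{\mathbf m})$$ for every probability measure $\mu$ with support contained in $T_{\mathbf m}$. The measures $\mu^\star_{\mathbf m}$ ($\mathbf m\in\mathcal M$) are the only invariant measures supported in $I$, and their number $|\mathcal M|$ is bounded by the number of local minima of $F$. (c) For any probability measure $\mu_0\in\mathscr{P}(I)$, $\mu_k:=\mathcal{P}^k\mu_0$ converges geometrically to the invariant measure $$\mu^\star=\sum_{\mathbf m\in\mathcal M}c_{\mathbf m}(\mu_0)\,\mu^\star_{\mathbf m},\qquad c_{\mathbf m}(\mu_0)=\int_I g_{\mathbf m}(x)\,d\mu_0(x).$$ Here $\{g_{\mathbf m}\}_{\mathbf m\in\mathcal M}$ exist and are the unique set of functions satisfying: (i) each $g_{\mathbf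 m}:I\to\mathbb{R}$ is a left eigenvector of $\mathcal{P}$, i.e. $\mathcal{P}^\star g_{\mathbf m}=g_{\mathbf m}$, where $(\mathcal{P}^\star g)(x)=\frac1n\sum_{i=1}^n g(\varphi_i(x))$; (ii) they form a partition of unity for the set $I$, i.e. the $g_{\mathbf m}$ are continuous, non-negative functions with $\sum_{\mathbf m\in\mathcal M}g_{\mathbf m}(x)=1$ for each $x\in I$; (iii) $g_{\mathbf m}(x)=1$ for all $x\in T_{\mathbf m}$ and $g_{\mathbf m}(x)=0$ for all $x\in T_{\mathbf m'}$ with $\mathbf m'\ne\mathbf m$; in particular $\int_I g_{\mathbf m}\,d\mu^\star_{\mathbf m'}=\delta_{\mathbf m\mathbf m'}$ (Kronecker delta). The convergence $\mu_k\to\mu^\star$ is in the sense that $$\tilde d(\mu_k,\mu^\star)\le 3\Big(1-\frac1{n^\ell}\Big)^{\lfloor k/\ell\rfloor}\qquad(k>0),$$ where $\ell:=2\max\{\ell_0,\max_{\mathbf m\in\mathcal M}\ell_{\mathbf m}\}\ge d$, and $\tilde d$ is the metric defined for $\mu,\nu\in\mathscr{P}(I)$ by $$\tilde d(\mu,\nu):=d_{\rm TV}\big(\mu|_B,\nu|_B\big)+\sum_{\mathbf m\in\mathcal M}d_{\alpha_{\mathbf m}}\big(\mu|_{T_{\mathbf m}},\nu|_{T_{\mathbf m}}\big),$$ with $\nu|_A$ denoting the restriction of the finite measure $\nu$ to the Borel set $A$. In the case $d=1$ the estimate becomes $$d_F(\mu_k,\mu^\star)\le 3\Big(1-\frac1{n^\ell}\Big)^{\lfloor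 k/\ell\rfloor}\qquad(k>0).$$
   Context: Setting. $f_1,\dots,f_n:\mathbb{R}^d\to\mathbb{R}$, each $f_i\ne0$ (not identically zero), are separable: $f_i(x)=\sum_{j=1}^d f_i^{(j)}(x_j)$ for $x=(x_1,\dots,x_d)$, with $f_i^{(j)}:\mathbb{R}\to\mathbb{R}$; some $f_i^{(j)}$ may be identically $0$. For a step-size $\eta>0$, $\varphi_i(x)=x-\eta\nabla f_i(x)=(\varphi_i^{(1)}(x_1),\dots,\varphi_i^{(d)}(x_d))$ with $\varphi_i^{(j)}(s)=s-\eta\,\frac{d}{ds}f_i^{(j)}(s)$. The constant step-size stochastic gradient descent iterates are $X_{k+1}=\varphi_{i_k}(X_k)$ with $i_k$ i.i.d. uniform on $\{1,\dots,n\}$; their laws evolve by $\mu_{k+1}=\mathcal{P}\mu_k$. Assumptions. For all $i,j$ with $f_i^{(j)}\neq 0$: (A1) $f_i^{(j)}\in C^1(\mathbb{R})$; (A2) $f_i^{(j)}$ has a finite number of critical points; (A3) $f_i^{(j)}(x)\to\infty$ as $|x|\to\infty$. For each $j$ let $\mathcal{C}^{(j)}=\bigcup_{i:\,f_i^{(j)}\ne0}\{x:\frac{d}{dx}f_i^{(j)}(x)=0\}$ (finite), and $I^{(j)}=[a,b]$ where $a,b$ (depending on $j$) are the smallest and largest elements of $\mathcal{C}^{(j)}$. The state space is $I=I^{(1)}\times\cdots\times I^{(d)}$. (A4) For a constant $K>0$, the derivative of every $f_i^{(j)}$ is $K$-Lipschitz on $I^{(j)}$. (A5) For each $j$, the functions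 $f_1^{(j)},\dots,f_n^{(j)}$ share no common critical point: $\bigcap_{i=1}^n\{s\in\mathbb{R}:\frac{d}{ds}f_i^{(j)}(s)=0\}=\emptyset$. The sets $T_{\mathbf m}$. For a family $\{h_i\}_{i=1}^n$ of functions on $\mathbb{R}$ put $L=\bigcup_i\{x:h_i'(x)>0\}$ and $R=\bigcup_i\{x:h_i'(x)<0\}$; the associated $T$-intervals are the closed intervals $[l,r]$, $l<r$, with $(l,r)\subset L\cap R$, $l\in\partial L$, $r\in\partial R$. For each $j$ let $T_1^{(j)},\dots,T_{M_j}^{(j)}$ be the $T$-intervals associated with $\{f_i^{(j)}\}_{i=1}^n$. Let $\mathcal{M}=\{1,\dots,M_1\}\times\cdots\times\{1,\dots,M_d\}$ and for $\mathbf m=(m_1,\dots,m_d)\in\mathcal M$ let $T_{\mathbf m}=T^{(1)}_{m_1}\times\cdots\times T^{(d)}_{m_d}$. Dynamics. A non-empty set $S\subset\mathbb{R}^d$ is positive invariant if $\varphi_i(S)\subset S$ for all $1\le i\le n$ (for Borel $S$ this is equivalent to $S$ being absorbing, i.e. the transition probability $p(x,S)=\frac1n\#\{i:\varphi_i(x)\in S\}$ equals $1$ for all $x\in S$). A Borel set $B$ is uniformly transient if $\sup_{x\in B}\sum_{k=0}^\infty(\mathcal{P}^k\delta_x)(B)<\infty$, where $\delta_x$ is the Dirac measure. A path of length $m$ is $\vec p=(i_1,\dots,i_m)\in\{1,\dots,n\}^m$, and $\varphi_{\vec p}=\varphi_{i_m}\circ\cdots\circ\varphi_{i_1}$. $\mathscr{P}(I)$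 denotes the Borel probability measures supported on $I$; a probability measure $\mu$ is invariant if $\mathcal{P}\mu=\mu$. Metrics. For $\alpha\in\{+1,-1\}^d$ (by convention normalized so that $\alpha_1=+1$) define the partial order $x\preceq_\alpha y$ iff $\alpha_j(y_j-x_j)\ge0$ for all $j$. A map $\gamma$ is monotone with respect to $\preceq_\alpha$ if $x\preceq_\alpha y$ implies $\gamma(x)\preceq_\alpha\gamma(y)$. Let $\mathcal{A}_\alpha$ be the family of all sets $\{y\in\mathbb{R}^d:\gamma(y)\preceq_\alpha c\}$ with $c\in\mathbb{R}^d$ and $\gamma:\mathbb{R}^d\to\mathbb{R}^d$ continuous and monotone with respect to $\preceq_\alpha$. For finite non-negative Borel measures $\mu,\nu$ on $I$, $d_\alpha(\mu,\nu)=\sup_{A\in\mathcal{A}_\alpha}|\mu(A\cap I)-\nu(A\cap I)|$, and $d_{\rm TV}(\mu,\nu)=\sup_A|\mu(A)-\nu(A)|$ over all Borel sets $A$. In dimension $d=1$ with $I=[a,b]$, $d_F(\mu,\nu)=\sup_{x\in[a,b]}|\mu([a,x])-\nu([a,x])|$.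
   Formalization: ''The measures μ*_m are the only invariant measures supported in I'' is false when |M| ≥ 2, since mixtures are invariant; it is proved as: every invariant probability measure supported in I is a convex combination of the μ*_m, and the extremal ones are exactly the μ*_m. *)

(* Defs.v *)
(* R^d is represented by 'rV[R]_d with its product topology. *)
From HB Require Import structures.
From mathcomp Require Import all_boot all_order all_algebra.
From mathcomp Require Import all_classical all_reals all_analysis.

Set Implicit Arguments.
Unset Strict Implicit.
Unset Printing Implicit Defensive.

Import Order.TTheory GRing.Theory Num.Theory.
Import numFieldNormedType.Exports.

Local Open Scope ring_scope.
Local Open Scope classical_set_scope.

(* R^d with its Borel sigma-algebra *)
Notation borelRV R d := (g_sigma_algebraType (@open 'rV[R%type]_d)).

Notation probRV R d := (probability (borelRV R d) R%type).

Definition borel_set (R : realType) (d : nat) (A : set 'rV[R]_d) : Prop :=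
  @measurable _ (borelRV R d) A.

Definition nonzero_fun (T : Type) (R : realType) (h : T -> R) : Prop :=
  exists x, h x != 0.

Definition critical (R : realType) (h : R -> R) : set R :=
  [set s | h^`() s = 0].

Definition C1 (R : realType) (h : R -> R) : Prop :=
  (forall s, derivable h s 1) /\ continuous h^`().

Definition coercive (R : realType) (h : R -> R) : Prop :=
  h s @[s --> +oo] --> +oo /\ h s @[s --> -oo] --> +oo.

Definition separable_by (R : realType) (n d : nat)
    (f : 'I_n -> 'rV[R]_d -> R) (fc : 'I_n -> 'I_d -> R -> R) : Prop :=
  forall i x, f i x = \sum_(j < d) fc i j (x 0 j).

Definition crit_union (R : realType) (n d : nat)
    (fc : 'I_n -> 'I_d -> R -> R) (j : 'I_d) : set R :=
  \bigcup_(i in [set i | nonzero_fun (fc i j)]) critical (fc i j).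

(* Under the standing assumptions crit_union fc j is finite and nonempty, so
   inf and sup are its smallest and largest elements. *)
Definition Imin (R : realType) (n d : nat)
  (fc : 'I_n -> 'I_d -> R -> R) (j : 'I_d) : R := inf (crit_union fc j).

Definition Imax (R : realType) (n d : nat)
  (fc : 'I_n -> 'I_d -> R -> R) (j : 'I_d) : R := sup (crit_union fc j).

Definition Icoord (R : realType) (n d : nat)
    (fc : 'I_n -> 'I_d -> R -> R) (j : 'I_d) : set R :=
  `[Imin fc j, Imax fc j].

Definition state_space (R : realType) (n d : nat)
    (fc : 'I_n -> 'I_d -> R -> R) : set 'rV[R]_d :=
  [set x | forall j, Icoord fc j (x 0 j)].

Definition boundary (T : topologicalType) (A : set T) : set T :=
  closure A `\` interior A.

Definition Lset (R : realType) (n : nat) (h : 'I_n -> R -> R) : set R :=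
  \bigcup_i [set s | 0 < (h i)^`() s].

Definition Rset (R : realType) (n : nat) (h : 'I_n -> R -> R) : set R :=
  \bigcup_i [set s | (h i)^`() s < 0].

(* The T-interval [l, r] is encoded by the pair (l, r) of its endpoints. *)
Definition Tintervals (R : realType) (n : nat) (h : 'I_n -> R -> R) :
    set (R * R) :=
  [set p | [/\ p.1 < p.2, `]p.1, p.2[ `<=` Lset h `&` Rset h,
               boundary (Lset h) p.1 & boundary (Rset h) p.2]].

(* A multi-index m is the choice of a T-interval m j in every coordinate j. *)
Definition Mset (R : realType) (n d : nat) (fc : 'I_n -> 'I_d -> R -> R) :
    set {ffun 'I_d -> R * R} :=
  [set m | forall j, Tintervals (fun i => fc i j) (m j)].

Definition Trect (R : realType) (d : nat) (m : {ffun 'I_d -> R * R}) :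
    set 'rV[R]_d :=
  [set x | forall j, x 0 j \in `[(m j).1, (m j).2]].

Definition gradient (R : realType) (d : nat) (f : 'rV[R]_d -> R)
    (x : 'rV[R]_d) : 'rV[R]_d :=
  \row_(j < d) 'D_(delta_mx 0 j) f x.

Definition sgd_map (R : realType) (n d : nat) (eta : R)
    (f : 'I_n -> 'rV[R]_d -> R) (i : 'I_n) (x : 'rV[R]_d) : 'rV[R]_d :=
  x - eta *: gradient (f i) x.

Definition mean_objective (R : realType) (n d : nat)
    (f : 'I_n -> 'rV[R]_d -> R) (x : 'rV[R]_d) : R :=
  n%:R^-1 * \sum_(i < n) f i x.

Definition local_minimizers (R : realType) (d : nat) (F : 'rV[R]_d -> R) :
    set 'rV[R]_d :=
  [set x | \forall y \near x, F x <= F y].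

(* Measures are handled through their underlying set functions; only the
   values on Borel sets are meaningful. *)
Definition same_measure (R : realType) (d : nat)
    (mu nu : set 'rV[R]_d -> \bar R) : Prop :=
  forall A, borel_set A -> mu A = nu A.

Definition meas_support (R : realType) (d : nat) (mu : set 'rV[R]_d -> \bar R) :
    set 'rV[R]_d :=
  [set x | forall U : set 'rV[R]_d, open U -> U x -> (0 < mu U)%E].

Definition meas_restrict (R : realType) (d : nat) (mu : set 'rV[R]_d -> \bar R)
    (D : set 'rV[R]_d) : set 'rV[R]_d -> \bar R :=
  fun A => mu (A `&` D).

Definition markov_op (R : realType) (n d : nat)
    (phi : 'I_n -> 'rV[R]_d -> 'rV[R]_d) (mu : set 'rV[R]_d -> \bar R) :
    set 'rV[R]_d -> \bar R :=
  fun A => ((n%:R^-1 : R)%:E * \sum_(i < n) mu (phi i @^-1` A))%E.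

Definition markov_dual (R : realType) (n d : nat)
    (phi : 'I_n -> 'rV[R]_d -> 'rV[R]_d) (g : 'rV[R]_d -> R) : 'rV[R]_d -> R :=
  fun x => n%:R^-1 * \sum_(i < n) g (phi i x).

Definition invariant_measure (R : realType) (n d : nat)
    (phi : 'I_n -> 'rV[R]_d -> 'rV[R]_d) (mu : set 'rV[R]_d -> \bar R) : Prop :=
  same_measure (markov_op phi mu) mu.

Definition positive_invariant (R : realType) (n d : nat)
    (phi : 'I_n -> 'rV[R]_d -> 'rV[R]_d) (S : set 'rV[R]_d) : Prop :=
  S !=set0 /\ forall i, phi i @` S `<=` S.

Definition transition (R : realType) (n d : nat)
    (phi : 'I_n -> 'rV[R]_d -> 'rV[R]_d) (x : 'rV[R]_d) (S : set 'rV[R]_d) : R :=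
  n%:R^-1 * #|[pred i | phi i x \in S]|%:R.

Definition absorbing (R : realType) (n d : nat)
    (phi : 'I_n -> 'rV[R]_d -> 'rV[R]_d) (S : set 'rV[R]_d) : Prop :=
  [/\ borel_set S, S !=set0 & forall x, S x -> transition phi x S = 1].

Definition uniformly_transient (R : realType) (n d : nat)
    (phi : 'I_n -> 'rV[R]_d -> 'rV[R]_d) (B : set 'rV[R]_d) : Prop :=
  borel_set B /\
  (ereal_sup [set (\sum_(0 <= k <oo)
     iter k (markov_op phi) (@dirac _ (borelRV R d) x R) B)%E | x in B]
   < +oo)%E.

(* The first entry of the path is applied first. *)
Definition along_path (R : realType) (n d : nat)
    (phi : 'I_n -> 'rV[R]_d -> 'rV[R]_d) (p : seq 'I_n) (x : 'rV[R]_d) :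
    'rV[R]_d :=
  foldl (fun y i => phi i y) x p.

(* Sign vectors alpha in {+1, -1}^d are encoded by booleans: alpha_j is
   (-1) ^+ alpha j, so false stands for +1. *)
Definition le_sign (R : realType) (d : nat) (alpha : {ffun 'I_d -> bool})
    (x y : 'rV[R]_d) : Prop :=
  forall j, 0 <= (-1) ^+ alpha j * (y 0 j - x 0 j).

Definition sign_monotone (R : realType) (d : nat) (alpha : {ffun 'I_d -> bool})
    (gamma : 'rV[R]_d -> 'rV[R]_d) : Prop :=
  forall x y, le_sign alpha x y -> le_sign alpha (gamma x) (gamma y).

Definition Afamily (R : realType) (d : nat) (alpha : {ffun 'I_d -> bool}) :
    set (set 'rV[R]_d) :=
  [set A | exists (gamma : 'rV[R]_d -> 'rV[R]_d) (c : 'rV[R]_d),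
     [/\ continuous gamma, sign_monotone alpha gamma
       & A = [set y | le_sign alpha (gamma y) c]]].

Definition d_sign (R : realType) (d : nat) (I : set 'rV[R]_d)
    (alpha : {ffun 'I_d -> bool}) (mu nu : set 'rV[R]_d -> \bar R) : \bar R :=
  ereal_sup [set `|mu (A `&` I) - nu (A `&` I)|%E | A in Afamily alpha].

Definition d_TV (R : realType) (d : nat) (mu nu : set 'rV[R]_d -> \bar R) :
    \bar R :=
  ereal_sup [set `|mu A - nu A|%E | A in @borel_set R d].

(* For d = 1 and I = [a, b], the set lower_box I x below is [a, x]. *)
Definition lower_box (R : realType) (d : nat) (I : set 'rV[R]_d) (x : 'rV[R]_d) :
    set 'rV[R]_d :=
  [set y | I y /\ forall j, y 0 j <= x 0 j].

Definition d_F (R : realType) (d : nat) (I : set 'rV[R]_d)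
    (mu nu : set 'rV[R]_d -> \bar R) : \bar R :=
  ereal_sup [set `|mu (lower_box I x) - nu (lower_box I x)|%E | x in I].

Definition d_tilde (R : realType) (d : nat) (I B : set 'rV[R]_d)
    (M : set {ffun 'I_d -> R * R})
    (alpha : {ffun 'I_d -> R * R} -> {ffun 'I_d -> bool})
    (mu nu : set 'rV[R]_d -> \bar R) : \bar R :=
  (d_TV (meas_restrict mu B) (meas_restrict nu B) +
   \sum_(m \in M)
     d_sign I (alpha m) (meas_restrict mu (Trect m)) (meas_restrict nu (Trect m)))%E.

Definition geom_rate (R : realType) (n l : nat) : R := 1 - (n%:R ^+ l)^-1.

(* Functions on I are represented by functions on R^d whose values outside I
   are irrelevant. *)
Definition absorption_family (R : realType) (n d : nat)
    (phi : 'I_n -> 'rV[R]_d -> 'rV[R]_d) (I : set 'rV[R]_d)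
    (M : set {ffun 'I_d -> R * R})
    (g : {ffun 'I_d -> R * R} -> 'rV[R]_d -> R) : Prop :=
  [/\ forall m, M m -> forall x, I x -> markov_dual phi (g m) x = g m x,
      forall m, M m ->
        {within I, continuous (g m)} /\ (forall x, I x -> 0 <= g m x),
      forall x, I x -> \sum_(m \in M) g m x = 1
    & forall m, M m ->
        (forall x, Trect m x -> g m x = 1) /\
        (forall m', M m' -> m' <> m -> forall x, Trect m' x -> g m x = 0)].

Definition absorption_coef (R : realType) (d : nat) (I : set 'rV[R]_d)
    (mu : probRV R d) (g : 'rV[R]_d -> R) : \bar R :=
  (\int[mu]_(x in (I : set (borelRV R d))) (g x)%:E)%E.

Definition extremal_invariant (R : realType) (n d : nat)
    (phi : 'I_n -> 'rV[R]_d -> 'rV[R]_d) (I : set 'rV[R]_d)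
    (nu : probRV R d) : Prop :=
  [/\ meas_support nu `<=` I, invariant_measure phi nu
    & forall (nu1 nu2 : probRV R d) (t : R),
        meas_support nu1 `<=` I -> meas_support nu2 `<=` I ->
        invariant_measure phi nu1 -> invariant_measure phi nu2 ->
        0 < t < 1 ->
        same_measure nu (fun A => t%:E * nu1 A + (1 - t)%:E * nu2 A)%E ->
        same_measure nu1 nu /\ same_measure nu2 nu].

(* Main.v *)
(* Since eta < 1/K, every coordinate map s - eta h'(s) is increasing on I^(j),
   so each word of maps acts monotonically. A T-interval is trapped, and by
   (A5) some map moves strictly at every point, so from anywhere in I^(j) a
   word of uniformly bounded length enters a T-interval; treating the
   coordinates one after the other gives l0.

   Inside T_m, in each coordinate there are words driving everything close to
   the left end, resp. the right end. Combining them yields two words p, q of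
   equal length l_m whose images of T^(j) are disjoint in every coordinate j,
   and alpha_m(j) records which image lies on the left. A set that is downward
   closed for the order of alpha_m then contains the image of p or misses the
   image of q, so the oscillation on T_m of the k-step probability of hitting
   it contracts by 1 - n^(-l_m) every l_m steps. Orthants are downward closed
   and generate the Borel sets, whence uniqueness. The invariant measure itself
   is the law of the limit of the backward iterates i_1, i_1 i_2, ... started at
   the corner of left ends: these increase by monotonicity, and the random
   indices are realized as the base-n digits of a uniform number of [0, 1[.

   The function g_m is the probability of absorption in T_m; two harmonic
   functions that agree on T differ by at most the probability of still being
   in B, which decays geometrically. *)
Require Import Defs.
From HB Require Import structures.
From mathcomp Require Import all_boot all_order all_algebra.
From mathcomp Require Import lra.
From mathcomp Require Import all_classical all_reals all_analysis.
From mathcomp Require Import measurable_realfun.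

Set Implicit Arguments.
Unset Strict Implicit.
Unset Printing Implicit Defensive.

Import Order.TTheory GRing.Theory Num.Theory.
Import numFieldNormedType.Exports.

Local Open Scope ring_scope.
Local Open Scope classical_set_scope.

(** * Increasing maps of the line *)

(** All estimates are made on functions rather than on measures: [iter_markov_mean] writes P^k mu
    (A) as the integral of the k-fold dual of the indicator of A, so a pointwise bound on the state
    space gives the bound for every mu. The rate 1 - n^(-l) has one source, [average_one_le]: among
    the n^l words of length l a single one is known to help, and the others lose nothing.

    The obstacle in several dimensions is that one index drives all coordinates at once, so words
    cannot be chosen coordinate by coordinate. Reaching T survives this because a T-interval, once
    entered, is never left. For the splitting of T_m, the order of the two images in a further
    coordinate may be dictated by the words already built, which is why a sign vector has to be
    found instead of prescribed.

    The factor 2 in l splits the time into a half for entering T and a half for mixing inside the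
    T_m that was entered. The factor 3 counts the mass still in B at time k, the mass not yet
    absorbed at half time, and the mixing error. *)

Section line_dynamics.
Context (R : realType) (n : nat).
Implicit Types (s : 'I_n -> R -> R) (w : seq 'I_n).

Definition run s w x := foldl (fun y i => s i y) x w.

Lemma run_cat s w1 w2 x : run s (w1 ++ w2) x = run s w2 (run s w1 x).
Proof. by rewrite /run foldl_cat. Qed.

Lemma run_rcons s w i x : run s (rcons w i) x = s i (run s w x).
Proof. by rewrite /run foldl_rcons. Qed.

Lemma continuous_run s w : (forall i, continuous (s i)) -> continuous (run s w).
Proof.
move=> hs; elim: w => [|i w IH] x; first exact: cvg_id.
apply: (@continuous_comp _ _ _ (s i) (run s w)); [exact: hs|exact: IH].
Qed.

(** Otherwise all endpoints of words have a supremum at most t. Some map pushes this supremum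
    strictly right, and by continuity it pushes a nearby endpoint beyond the supremum. *)
Lemma move_right s x t : (forall i, continuous (s i)) ->
  (forall y, x <= y <= t -> exists i, y < s i y) -> exists w, t < run s w x.
Proof.
move=> hs hx; apply: contrapT => hw.
have le_t w : run s w x <= t.
  by rewrite leNgt; apply/negP => h; apply: hw; exists w.
pose E := [set run s w x | w in setT].
have Ex : E x by exists [::].
have Eub : ubound E t by move=> _ [w _ <-].
have Esup : has_sup E by split; [exists x|exists t].
have xy : x <= sup E by apply: sup_upper_bound.
have yt : sup E <= t by apply: ge_sup => //; exists x.
have [i hi] : exists i, sup E < s i (sup E) by apply: hx; rewrite xy yt.
have /(hs i (sup E)) : nbhs (s i (sup E)) [set z | sup E < z].
  by apply: open_nbhs_nbhs; split => //; exact: open_gt.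
move=> /nbhs_ballP[e /= e0 he].
have [z [w _ <-] hz] := sup_adherent e0 Esup.
have hzs : run s w x <= sup E by apply: sup_upper_bound => //; exists w.
have : sup E < s i (run s w x).
  by apply: he; rewrite /ball /= ger0_norm ?subr_ge0// ltrBlDl -ltrBlDr.
rewrite -run_rcons ltNge => /negP; apply; apply: sup_upper_bound => //.
by exists (rcons w i).
Qed.

Lemma move_left s x t : (forall i, continuous (s i)) ->
  (forall y, t <= y <= x -> exists i, s i y < y) -> exists w, run s w x < t.
Proof.
move=> hs hx; pose s' i y := - s i (- y).
have hs' i : continuous (s' i).
  move=> y; apply: continuousN.
  by apply: (@continuous_comp _ _ _ -%R (s i)); [exact: opp_continuous|exact: hs].
have run' w y : run s' w (- y) = - run s w y.
  by elim: w y => //= i w IH y; rewrite -IH /s' opprK.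
have [|w hw] := @move_right s' (- x) (- t) hs'.
  move=> y hy; have [|i hi] := hx (- y); first by lra.
  by exists i; rewrite /s'; lra.
by exists w; move: hw; rewrite run'; lra.
Qed.

End line_dynamics.

Section next_point.
Context (R : realType).

Lemma prev_in_closed (Z : set R) a x : closed Z -> Z a -> a <= x ->
  exists l, [/\ Z l, l <= x, a <= l & forall y, l < y <= x -> ~ Z y].
Proof.
move=> Zc Za ax; pose A := Z `&` [set y | y <= x].
have Ac : closed A by apply: closedI => //; exact: closed_le.
have Aa : A a by [].
have Aub : ubound A x by move=> y [].
have As : has_sup A by split; [exists a|exists x].
have [Zr xr] : A (sup A).
  by rewrite [in X in X _](closure_id A).1//; apply: closure_sup; [exists a|exists x].
exists (sup A); split => //; first by apply: sup_upper_bound.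
move=> y /andP[ly yx] Zy.
suff : y <= sup A by rewrite leNgt ly.
by apply: sup_upper_bound.
Qed.

Lemma next_in_closed (Z : set R) x b : closed Z -> Z b -> x <= b ->
  exists r, [/\ Z r, x <= r, r <= b & forall y, x <= y < r -> ~ Z y].
Proof.
move=> Zc Zb xb.
have Zc' : closed (-%R @^-1` Z).
  by apply: preimage_closed => // y _; exact: opp_continuous.
have [||l [Zl lx bl hl]] := @prev_in_closed _ (- b) (- x) Zc'.
- by rewrite /= opprK.
- by rewrite lerN2.
exists (- l); split => //; [lra|lra|].
move=> y hy Zy; apply: (hl (- y)); last by rewrite /= opprK.
lra.
Qed.

End next_point.

(** * T-intervals as trapping sets of the coordinate maps *)

Section Tinterval_dynamics.
Context (R : realType) (n : nat) (D : 'I_n -> R -> R) (eta a b : R).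
Hypothesis D_cont : forall i, continuous (D i).
Hypothesis eta_gt0 : 0 < eta.
Hypothesis le_ab : a <= b.
Hypothesis D_neq0 : forall x, exists i, D i x != 0.
Hypothesis Da : forall i, D i a <= 0.
Hypothesis Db : forall i, 0 <= D i b.

Definition step i x := x - eta * D i x.

Hypothesis step_incr : forall i x y, a <= x -> x < y -> y <= b -> step i x < step i y.

(** T-intervals read off from signs of derivatives, without boundaries of L and R: the ends are
    walls, and inside one can move both ways. [TintervalsP] proves the equivalence with
    [Tintervals]. *)
Definition Tspec (p : R * R) := [/\ a <= p.1, p.1 < p.2, p.2 <= b,
  (forall i, D i p.1 <= 0) /\ (forall i, 0 <= D i p.2) &
  forall y, p.1 < y < p.2 -> (exists i, 0 < D i y) /\ (exists i, D i y < 0)].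

Lemma step_cont i : continuous (step i).
Proof.
move=> x; apply: cvgB; first exact: cvg_id.
by apply: cvgM; [exact: cvg_cst|exact: D_cont].
Qed.

Lemma step_left i x : (step i x < x) = (0 < D i x).
Proof. by rewrite /step ltrBlDr ltrDl pmulr_rgt0. Qed.

Lemma step_right i x : (x < step i x) = (D i x < 0).
Proof. by rewrite /step ltrBrDr gtrDl pmulr_rlt0. Qed.

Lemma step_le i x y : a <= x -> x <= y -> y <= b -> step i x <= step i y.
Proof.
move=> ax; rewrite le_eqVlt => /predU1P[->//|xy yb].
by apply: ltW; apply: step_incr.
Qed.

(** No map moves l to the left or r to the right, and a monotone map keeps x between the images of l
    and r. *)
Lemma step_itv i l r x : a <= l -> r <= b ->
  (forall i, D i l <= 0) -> (forall i, 0 <= D i r) ->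
  l <= x <= r -> l <= step i x <= r.
Proof.
move=> al rb Dl Dr /andP[lx xr]; apply/andP; split.
  apply: (@le_trans _ _ (step i l)).
    by rewrite leNgt step_left -leNgt.
  by apply: step_le => //; apply: le_trans xr rb.
apply: (@le_trans _ _ (step i r)).
  by apply: step_le => //; apply: le_trans al lx.
by rewrite leNgt step_right -leNgt.
Qed.

Lemma run_itv w l r x : a <= l -> r <= b ->
  (forall i, D i l <= 0) -> (forall i, 0 <= D i r) ->
  l <= x <= r -> l <= run step w x <= r.
Proof.
by move=> al rb Dl Dr; elim: w x => //= i w IH x lxr; apply: IH; apply: step_itv.
Qed.

Lemma run_incr w x y : a <= x -> x < y -> y <= b -> run step w x < run step w y.
Proof.
elim: w x y => //= i w IH x y ax xy yb.
have /andP[ax' _] : a <= step i x <= b.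
  by apply: step_itv => //; rewrite ax (le_trans (ltW xy)).
have /andP[_ yb'] : a <= step i y <= b.
  by apply: step_itv => //; rewrite yb (le_trans ax (ltW xy)).
by apply: IH => //; apply: step_incr.
Qed.

Lemma run_left x t : (forall y, t <= y <= x -> exists i, 0 < D i y) ->
  exists w, run step w x < t.
Proof.
move=> h; apply: move_left; first exact: step_cont.
by move=> y /h[i hi]; exists i; rewrite step_left.
Qed.

Lemma run_right x t : (forall y, x <= y <= t -> exists i, D i y < 0) ->
  exists w, t < run step w x.
Proof.
move=> h; apply: move_right; first exact: step_cont.
by move=> y /h[i hi]; exists i; rewrite step_right.
Qed.

(** Some map moves left at every point of ]l, r]: inside by definition, at r because no derivative
    is negative there and one is nonzero. *)
Lemma Tspec_sink_l p e : Tspec p -> 0 < e -> exists w, run step w p.2 < p.1 + e.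
Proof.
move=> [al lr rb [Dl Dr] hlr] e0; apply: run_left => y /andP[ly yr].
have [ltyr|geyr] := ltP y p.2.
  by apply: (hlr y _).1; rewrite ltyr andbT (lt_le_trans _ ly)// ltrDl.
have -> : y = p.2 by apply/eqP; rewrite eq_le yr.
by have [i hi] := D_neq0 p.2; exists i; rewrite lt_def hi Dr.
Qed.

Lemma Tspec_sink_r p e : Tspec p -> 0 < e -> exists w, p.2 - e < run step w p.1.
Proof.
move=> [al lr rb [Dl Dr] hlr] e0; apply: run_right => y /andP[ly yr].
have [ltyl|geyl] := ltP p.1 y.
  by apply: (hlr y _).2; rewrite ltyl/= (le_lt_trans yr)// ltrBlDr ltrDl.
have -> : y = p.1 by apply/eqP; rewrite eq_le ly geyl.
by have [i hi] := D_neq0 p.1; exists i; rewrite lt_neqAle hi Dl.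
Qed.

(** [Lc] and [Rc] are the complements of L and R: the walls that no map crosses to the left, resp.
    to the right. Both are closed, so nearest walls exist. *)
Let Lc := [set x | forall i, D i x <= 0].
Let Rc := [set x | forall i, 0 <= D i x].

Let Lc_closed : closed Lc.
Proof.
rewrite (_ : Lc = \bigcap_(i : 'I_n) (D i @^-1` [set y | y <= 0])).
  apply: closed_bigI => i _; apply: preimage_closed; last exact: closed_le.
  by move=> x _; exact: D_cont.
by apply/seteqP; split => [x h i _|x h i]; apply: h.
Qed.

Let Rc_closed : closed Rc.
Proof.
rewrite (_ : Rc = \bigcap_(i : 'I_n) (D i @^-1` [set y | 0 <= y])).
  apply: closed_bigI => i _; apply: preimage_closed; last exact: closed_ge.
  by move=> x _; exact: D_cont.
by apply/seteqP; split => [x h i _|x h i]; apply: h.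
Qed.

Let notLc x : ~ Lc x -> exists i, 0 < D i x.
Proof. by move=> /existsNP[i /negP]; rewrite -ltNge; exists i. Qed.

Let notRc x : ~ Rc x -> exists i, D i x < 0.
Proof. by move=> /existsNP[i /negP]; rewrite -ltNge; exists i. Qed.

Let LcRc x : Lc x -> ~ Rc x.
Proof.
move=> Lx Rx; have [i] := D_neq0 x.
by rewrite (@le_anti _ _ (D i x) 0) ?eqxx// Lx Rx.
Qed.

(** A T-interval is found by looking for the walls nearest to x. The word ends strictly inside it,
    so the same word serves all points near x; the compactness argument of [Tspec_uniform_reach]
    depends on this. *)
Lemma reach_Tspec x : a <= x <= b ->
  exists w p, Tspec p /\ p.1 < run step w x < p.2.
Proof.
move=> /andP[ax xb].
(* [l, r] is a T-interval left of x: walk left below r; by monotonicity the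
   walk stays above the image of l, which is at least l *)
have back l r : Lc l -> a <= l -> l < x -> (forall y, l < y <= x -> ~ Lc y) ->
    Rc r -> l <= r -> r <= x -> (forall y, l <= y < r -> ~ Rc y) ->
    exists w p, Tspec p /\ p.1 < run step w x < p.2.
  move=> Ll al lx hl Rr lr rx hr.
  have ltlr : l < r.
    rewrite lt_neqAle lr andbT; apply/eqP => lE.
    by apply: (LcRc Ll); rewrite lE.
  have Tp : Tspec (l, r).
    split => //=; first exact: le_trans xb.
    move=> y /andP[ly yr]; split.
      by apply: notLc; apply: hl; rewrite ly (le_trans (ltW yr)).
    by apply: notRc; apply: hr; rewrite yr ltW.
  have [w hw] : exists w, run step w x < r.
    apply: run_left => y /andP[ry yx]; apply: notLc; apply: hl.
    by rewrite yx andbT (lt_le_trans ltlr).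
  exists w, (l, r); split => //=; rewrite hw andbT.
  apply: (@le_lt_trans _ _ (run step w l)); last exact: run_incr.
  suff /andP[] : l <= run step w l <= b by [].
  by apply: run_itv => //; rewrite lexx (le_trans (ltW lx)).
have [Rx|nRx] := pselect (Rc x).
  have nLx : ~ Lc x by move=> /LcRc.
  have [l [Ll lx al hl]] := prev_in_closed Lc_closed Da ax.
  have ltlx : l < x.
    by rewrite lt_neqAle lx andbT; apply/eqP => lE; apply: nLx; rewrite -lE.
  have [r [Rr lr rx hr]] := next_in_closed Rc_closed Rx lx.
  exact: (back l r).
have [r [Rr xr rb hr]] := next_in_closed Rc_closed Db xb.
have ltxr : x < r.
  by rewrite lt_neqAle xr andbT; apply/eqP => lE; apply: nRx; rewrite lE.
have [l [Ll lr al hl]] := prev_in_closed Lc_closed Da (le_trans ax xr).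
have ltlr : l < r.
  rewrite lt_neqAle lr andbT; apply/eqP => lE.
  by apply: (LcRc Ll); rewrite lE.
(* If x lies left of l, walk right beyond l. The walk cannot overshoot r, since it stays below the
   walk from r, which never exceeds r. *)
have [lex|ltlx] := leP x l.
  have Tp : Tspec (l, r).
    split => //= y /andP[ly yr]; split.
      by apply: notLc; apply: hl; rewrite ly (ltW yr).
    by apply: notRc; apply: hr; rewrite yr (le_trans lex (ltW ly)).
  have [w hw] : exists w, l < run step w x.
    apply: run_right => y /andP[xy yl]; apply: notRc; apply: hr.
    by rewrite xy (le_lt_trans yl).
  exists w, (l, r); split => //=; rewrite hw /=.
  apply: (@lt_le_trans _ _ (run step w r)); first exact: run_incr.
  suff /andP[] : a <= run step w r <= r by [].
  by apply: run_itv => //; rewrite lexx (le_trans ax).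
(* Right walls between l and x are not excluded, so [l, r] need not be a T-interval; the first right
   wall after l closes one. *)
have [r' [Rr' lr' r'r hr']] := next_in_closed Rc_closed Rr lr.
have hlx y : l < y <= x -> ~ Lc y.
  by move=> /andP[ly yx]; apply: hl; rewrite ly (le_trans yx).
have [r'x|ltxr'] := leP r' x; first exact: (back l r').
exists [::], (l, r'); split; last by rewrite /= ltlx.
split => //=; [exact: lt_trans ltxr'|exact: le_trans rb|].
move=> y /andP[ly yr]; split.
  by apply: notLc; apply: hl; rewrite ly (le_trans (ltW yr)).
by apply: notRc; apply: hr'; rewrite yr ltW.
Qed.

(** A wall cannot lie inside a T-interval, where both directions are open, and two T-intervals
    cannot touch, since a common end would be a wall on both sides and hence a common critical
    point. *)
Lemma Tspec_inj p q x : Tspec p -> Tspec q ->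
  p.1 <= x <= p.2 -> q.1 <= x <= q.2 -> p = q.
Proof.
have key p' q' : Tspec p' -> Tspec q' -> p'.1 <= x <= p'.2 -> q'.1 <= x <= q'.2 ->
    (q'.1 <= p'.1) /\ (p'.2 <= q'.2).
  move=> [ap pl pb [Dp1 Dp2] hp] [aq ql qb [Dq1 Dq2] hq] /andP[px xp] /andP[qx xq].
  have out1 y : (forall i, D i y <= 0) -> ~ (p'.1 < y < p'.2).
    by move=> h /hp[[i hi] _]; have := h i; rewrite leNgt hi.
  have out2 y : (forall i, 0 <= D i y) -> ~ (p'.1 < y < p'.2).
    by move=> h /hp[_ [i hi]]; have := h i; rewrite leNgt hi.
  split; rewrite leNgt; apply/negP => lt.
    have [lt2|] := ltP q'.1 p'.2; first by apply: (out1 q'.1 Dq1); rewrite lt.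
    move=> ge2; have e : q'.1 = p'.2 by apply/eqP; rewrite eq_le ge2 (le_trans qx xp).
    by apply: (@LcRc p'.2); [rewrite -e|].
  have [lt2|] := ltP p'.1 q'.2; first by apply: (out2 q'.2 Dq2); rewrite lt2.
  move=> ge2; have e : q'.2 = p'.1 by apply/eqP; rewrite eq_le ge2 (le_trans px xq).
  by apply: (@LcRc p'.1) => //; rewrite -e.
move=> Tp Tq px qx; have [k1 k2] := key p q Tp Tq px qx.
have [k3 k4] := key q p Tq Tp qx px.
by apply/eqP; rewrite -pair_eqE /= /pair_eq !eq_le k1 k2 k3 k4.
Qed.

(** The open sets of points sent inside by a fixed word cover [a, b], so finitely many words
    suffice. Letters appended to the shorter words do no harm, because T-intervals are trapped. *)
Lemma Tspec_uniform_reach : exists N, forall x, a <= x <= b ->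
  exists w p, [/\ size w = N, Tspec p & p.1 <= run step w x <= p.2].
Proof.
pose O (w : seq 'I_n) := [set x | exists p, Tspec p /\ p.1 < run step w x < p.2].
have Oo w : open (O w).
  rewrite (_ : O w = \bigcup_(p in Tspec) (run step w @^-1` `]p.1, p.2[)).
    apply: bigcup_open => p _; apply: open_comp; last exact: interval_open.
    by move=> x _; exact: continuous_run step_cont x.
  apply/seteqP; split=> x [p].
    by move=> [Tp hp]; exists p => //=; rewrite in_itv.
  by move=> Tp /=; rewrite in_itv => hp; exists p.
have := @segment_compact R a b; rewrite compact_cover.
move=> /(_ (seq 'I_n) setT O (fun w _ => Oo w))[|W _ hW].
  move=> x /=; rewrite in_itv /= => /reach_Tspec[w [p [Tp hp]]].
  by exists w => //; exists p.
have [i0 _] := D_neq0 a.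
exists (\max_(w <- finmap.enum_fset W) size w) => x hx.
have [|w /= Ww [p [Tp hp]]] := hW x; first by rewrite /= in_itv.
have hs : (size w <= \max_(w <- finmap.enum_fset W) size w)%N by exact: leq_bigmax_seq.
exists (w ++ nseq (\max_(w <- finmap.enum_fset W) size w - size w) i0), p; split => //.
  by rewrite size_cat size_nseq subnKC.
have [ap pl pb [Dp1 Dp2] _] := Tp.
rewrite run_cat; apply: run_itv => //.
by case/andP: hp => h1 h2; rewrite !ltW.
Qed.

End Tinterval_dynamics.

(** * Coercive functions and their T-intervals *)

Section coercive_functions.
Context (R : realType).
Implicit Types h : R -> R.

Lemma C1_is_derive h (x : R) : C1 h -> is_derive x 1 h (h^`() x).
Proof. by move=> [hd _]; rewrite derive1E; exact: derivableP. Qed.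

Lemma C1_continuous h : C1 h -> continuous h.
Proof. by move=> [hd _] x; apply/differentiable_continuous/derivable1_diffP. Qed.

Lemma C1_MVT h x y : C1 h -> x < y ->
  exists2 z, x < z < y & h y - h x = derive1 h z * (y - x).
Proof.
move=> hC xy; have [z hz e] := @MVT R h h^`() x y xy
  (fun z _ => C1_is_derive z hC) (continuous_subspaceT (C1_continuous hC)).
by exists z => //; move: hz; rewrite in_itv.
Qed.

Lemma C1_zero_between h x y : C1 h -> x <= y -> h^`() x <= 0 -> 0 <= h^`() y ->
  exists2 z, x <= z <= y & h^`() z = 0.
Proof.
move=> [_ hc] xy hx hy.
have [||z] := @IVT R h^`() x y 0 xy; first exact: continuous_subspaceT.
  by rewrite ge_min le_max hx hy orbT.
by rewrite in_itv; exists z.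
Qed.

Lemma coercive_derive_lt0 h x : C1 h -> coercive h ->
  exists2 z, z < x & h^`() z < 0.
Proof.
move=> hC [_ /cvgryPgt/(_ (h x))]; rewrite nearE => -[M [Mr hM]].
pose y := Num.min M x - 1.
have yx : y < x by rewrite /y ltrBlDr gt_min ltrDl ltr01 orbT.
have yM : y < M by rewrite /y ltrBlDr gt_min ltrDl ltr01.
have [z /andP[yz zx] e] := C1_MVT hC yx; exists z => //.
have := hM _ yM => hxy; have : derive1 h z * (x - y) < 0 by rewrite -e subr_lt0.
by rewrite pmulr_llt0// subr_gt0.
Qed.

Lemma coercive_derive_gt0 h x : C1 h -> coercive h ->
  exists2 z, x < z & 0 < h^`() z.
Proof.
move=> hC [/cvgryPgt/(_ (h x)) + _]; rewrite nearE => -[M [Mr hM]].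
pose y := Num.max M x + 1.
have yx : x < y by rewrite /y -ltrBlDr lt_max gtrDl ltrN10 orbT.
have yM : M < y by rewrite /y -ltrBlDr lt_max gtrDl ltrN10.
have [z /andP[yz zx] e] := C1_MVT hC yx; exists z => //.
have := hM _ yM => hxy; have : 0 < derive1 h z * (y - x) by rewrite -e subr_gt0.
by rewrite pmulr_lgt0// subr_gt0.
Qed.

Lemma coercive_critical h : C1 h -> coercive h -> critical h !=set0.
Proof.
move=> hC hco; have [z z0 hz] := coercive_derive_lt0 0 hC hco.
have [y y0 hy] := coercive_derive_gt0 0 hC hco.
have zy : z <= y by rewrite ltW// (lt_trans z0).
by have [c _ hc] := C1_zero_between hC zy (ltW hz) (ltW hy); exists c.
Qed.

(** Coercivity gives a negative derivative somewhere left of a; a positive one at a would force a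
    critical point strictly in between. *)
Lemma coercive_critical_lb h a : C1 h -> coercive h -> lbound (critical h) a ->
  h^`() a <= 0.
Proof.
move=> hC hco ha; rewrite leNgt; apply/negP => a0.
have [z za hz] := coercive_derive_lt0 a hC hco.
have [c /andP[zc ca] hc] := C1_zero_between hC (ltW za) (ltW hz) (ltW a0).
suff ac : a = c by move: a0; rewrite ac hc ltxx.
by apply/eqP; rewrite eq_le ca ha.
Qed.

Lemma coercive_critical_ub h b : C1 h -> coercive h -> ubound (critical h) b ->
  0 <= h^`() b.
Proof.
move=> hC hco hb; rewrite leNgt; apply/negP => b0.
have [z bz hz] := coercive_derive_gt0 b hC hco.
have [c /andP[bc cz] hc] := C1_zero_between hC (ltW bz) (ltW b0) (ltW hz).
suff bc' : b = c by move: b0; rewrite bc' hc ltxx.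
by apply/eqP; rewrite eq_le bc hb.
Qed.

Lemma finite_bounds (A : set R) : finite_set A -> has_lbound A /\ has_ubound A.
Proof.
move=> /finite_seqP[s ->].
have le_sum x : x \in s -> `|x| <= \sum_(y <- s) `|y|.
  by move=> xs; rewrite (big_rem x xs) /= lerDl sumr_ge0.
split; [exists (- \sum_(y <- s) `|y|)|exists (\sum_(y <- s) `|y|)] => x /= /le_sum.
  by rewrite ler_norml => /andP[].
by rewrite ler_norml => /andP[].
Qed.

Lemma not_nonzero_fun (T : Type) (h : T -> R) : ~ nonzero_fun h -> h = cst 0.
Proof.
move=> hh; apply/funext => x /=; apply/eqP/negPn/negP => hx.
by apply: hh; exists x.
Qed.

Lemma derive1_cst0 (h : R -> R) : h = cst 0 -> h^`() = cst 0.
Proof. by move=> ->; apply/funext => x; rewrite derive1_cst. Qed.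

End coercive_functions.

Section real_line.
Context (R : realType).

Lemma cvg_sum_ord T (F : set_system T) (FF : Filter F) n (f : 'I_n -> T -> R) (l : 'I_n -> R) :
  (forall i, f i x @[x --> F] --> l i) ->
  \sum_(i < n) f i x @[x --> F] --> \sum_(i < n) l i.
Proof.
move=> hf; elim: (index_enum _) => [|i s IH].
  by rewrite big_nil; under eq_fun do rewrite big_nil; exact: cvg_cst.
by rewrite big_cons; under eq_fun do rewrite big_cons; exact: cvgD.
Qed.

Lemma closure_itvoo_left (l r : R) : l < r -> closure `]l, r[ l.
Proof.
move=> lr B /nbhs_ballP[e /= e0 he].
exists (l + Num.min (e / 2) ((r - l) / 2)).
have m0 : 0 < Num.min (e / 2) ((r - l) / 2) by rewrite lt_min !divr_gt0// subr_gt0.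
split.
  rewrite /= in_itv /= ltrDl m0 /=.
  have : Num.min (e / 2) ((r - l) / 2) <= (r - l) / 2 by rewrite ge_min lexx orbT.
  lra.
apply: he; rewrite /ball /= opprD addNKr normrN gtr0_norm//.
have : Num.min (e / 2) ((r - l) / 2) <= e / 2 by rewrite ge_min lexx.
lra.
Qed.

Lemma closure_itvoo_right (l r : R) : l < r -> closure `]l, r[ r.
Proof.
move=> lr B /nbhs_ballP[e /= e0 he].
exists (r - Num.min (e / 2) ((r - l) / 2)).
have m0 : 0 < Num.min (e / 2) ((r - l) / 2) by rewrite lt_min !divr_gt0// subr_gt0.
split.
  rewrite /= in_itv /= ltrBlDr ltrDl m0 andbT.
  have : Num.min (e / 2) ((r - l) / 2) <= (r - l) / 2 by rewrite ge_min lexx orbT.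
  lra.
apply: he; rewrite /ball /= opprB addrC subrK gtr0_norm//.
have : Num.min (e / 2) ((r - l) / 2) <= e / 2 by rewrite ge_min lexx.
lra.
Qed.

Lemma lipschitz_itv (k a b x y : R) (h : R -> R) : k.-lipschitz_(`[a, b]) h ->
  a <= x -> x <= b -> a <= y -> y <= b -> `|h y - h x| <= k * `|y - x|.
Proof.
move=> hl ax xb ay yb; have := hl (y, x); apply.
by split => /=; rewrite in_itv /= ?ax ?ay.
Qed.

End real_line.

Section interior_minimum.
Context (R : realType).

(** Moving inward from either end lowers h, so a minimizer over [l, r] is not an end. *)
Lemma C1_interior_min (h : R -> R) l r : C1 h -> l < r ->
  h^`() l < 0 -> 0 < h^`() r ->
  exists2 c, l < c < r & forall y, l <= y <= r -> h c <= h y.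
Proof.
move=> hC lr hl hr.
have hc : {within `[l, r], continuous h} by apply/continuous_subspaceT/C1_continuous.
have [c + hmin] := EVT_min (ltW lr) hc; rewrite in_itv /= => /andP[lc cr].
have hmin' y : l <= y <= r -> h c <= h y by move=> hy; apply: hmin; rewrite in_itv.
exists c => //; rewrite !lt_neqAle lc cr !andbT; apply/andP; split; apply/eqP => e.
- have /(hC.2 l) : nbhs (h^`() l) [set z | z < 0].
    by apply: open_nbhs_nbhs; split => //; exact: open_lt.
  move=> /nbhs_ballP[d /= d0 hd].
  pose y := Num.min (l + d / 2) r.
  have ly : l < y by rewrite lt_min lr ltrDl divr_gt0.
  have [z /andP[lz zy] ez] := C1_MVT hC ly.
  have zd : h^`() z < 0.
    apply: hd; rewrite /ball /= distrC ger0_norm ?subr_ge0 ?(ltW lz)//.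
    have : y <= l + d / 2 by rewrite ge_min lexx.
    lra.
  have : h y - h l < 0 by rewrite ez pmulr_llt0 ?subr_gt0.
  rewrite subr_lt0 ltNge => /negP; apply; rewrite e; apply: hmin'.
  by rewrite (ltW ly)/= ge_min lexx orbT.
- have /(hC.2 r) : nbhs (h^`() r) [set z | 0 < z].
    by apply: open_nbhs_nbhs; split => //; exact: open_gt.
  move=> /nbhs_ballP[d /= d0 hd].
  pose y := Num.max (r - d / 2) l.
  have yr : y < r by rewrite gt_max lr andbT ltrBlDr ltrDl divr_gt0.
  have [z /andP[lz zy] ez] := C1_MVT hC yr.
  have zd : 0 < h^`() z.
    apply: hd; rewrite /ball /= ger0_norm ?subr_ge0 ?(ltW zy)//.
    have : r - d / 2 <= y by rewrite le_max lexx.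
    lra.
  have : 0 < h r - h y by rewrite ez pmulr_lgt0 ?subr_gt0.
  rewrite subr_gt0 ltNge => /negP; apply; rewrite -e; apply: hmin'.
  by rewrite (ltW yr) andbT le_max lexx orbT.
Qed.

Lemma C1_sum n (h : 'I_n -> R -> R) : (forall i, C1 (h i)) ->
  C1 (fun x => \sum_(i < n) h i x) /\
  (fun x => \sum_(i < n) h i x)^`() = (fun x => \sum_(i < n) derive1 (h i) x).
Proof.
move=> hC.
have hd (x : R) : is_derive x 1 (fun x => \sum_(i < n) h i x) (\sum_(i < n) derive1 (h i) x).
  have := @is_derive_sum R R^o R^o n h x 1 (fun i => (h i)^`() x) (fun i => C1_is_derive x (hC i)).
  by rewrite (_ : \sum_(i < n) h i = fun x => \sum_(i < n) h i x)//; apply/funext => y; rewrite fct_sumE.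
have e : (fun x => \sum_(i < n) h i x)^`() = (fun x => \sum_(i < n) derive1 (h i) x).
  by apply/funext => x; rewrite derive1E; have [_ ->] := hd x.
split => //; split; first by move=> x; have [] := hd x.
rewrite e => x; apply: cvg_sum_ord => i; exact: (hC i).2.
Qed.

End interior_minimum.

(** * T-intervals of a family of coercive functions *)

Section Tintervals.
Context (R : realType) (n : nat) (h : 'I_n -> R -> R) (K eta : R).
Hypothesis hA1 : forall i, nonzero_fun (h i) -> C1 (h i).
Hypothesis hA2 : forall i, nonzero_fun (h i) -> finite_set (critical (h i)).
Hypothesis hA3 : forall i, nonzero_fun (h i) -> coercive (h i).
Hypothesis hA5 : \bigcap_i critical (h i) = set0.
Hypothesis heta : 0 < eta < K^-1.
Hypothesis hK : 0 < K.

Let C := \bigcup_(i in [set i | nonzero_fun (h i)]) critical (h i).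
Let a := inf C.
Let b := sup C.
Hypothesis hA4 : forall i, K.-lipschitz_(`[a, b]) (h i)^`().
Let D i : R -> R := derive1 (h i).

Lemma C1_fc i : C1 (h i).
Proof.
have [/hA1//|/not_nonzero_fun e] := pselect (nonzero_fun (h i)).
rewrite /C1 (derive1_cst0 e) e; split => x; last exact: cvg_cst.
exact: derivable_cst.
Qed.

Lemma D_continuous i : continuous (D i).
Proof. exact: (C1_fc i).2. Qed.

Lemma D_neq0 x : exists i, D i x != 0.
Proof.
apply: contrapT => /forallNP hx.
have : (\bigcap_i critical (h i)) x.
  by move=> i _; rewrite /critical /=; apply/eqP/negPn/negP; exact: hx.
by rewrite hA5.
Qed.

Lemma D_neq0_nonzero i x : D i x != 0 -> nonzero_fun (h i).
Proof.
move=> hx; apply: contrapT => /not_nonzero_fun e.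
by move: hx; rewrite /D (derive1_cst0 e) eqxx.
Qed.

Lemma C_finite : finite_set C.
Proof. by apply: bigcup_finite => // i; exact: hA2. Qed.

Lemma C_nonempty : C !=set0.
Proof.
have [i /D_neq0_nonzero hi] := D_neq0 0.
by have [c hc] := coercive_critical (hA1 hi) (hA3 hi); exists c, i.
Qed.

Lemma C_has_inf : has_inf C.
Proof. by split; [exact: C_nonempty|exact: (finite_bounds C_finite).1]. Qed.

Lemma C_has_sup : has_sup C.
Proof. by split; [exact: C_nonempty|exact: (finite_bounds C_finite).2]. Qed.

Lemma C_itv x : C x -> a <= x <= b.
Proof.
move=> Cx; apply/andP; split; first exact: inf_lbound C_has_inf.2 _ Cx.
exact: sup_ubound C_has_sup.2 _ Cx.
Qed.

Lemma le_ab : a <= b.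
Proof. by have [c /C_itv/andP[/le_trans]] := C_nonempty; apply. Qed.

Lemma D_a i : D i a <= 0.
Proof.
have [hi|/not_nonzero_fun/derive1_cst0 e] := pselect (nonzero_fun (h i)).
  apply: coercive_critical_lb; [exact: hA1|exact: hA3|].
  by move=> x hx; have /andP[] : a <= x <= b by apply: C_itv; exists i.
by rewrite /D e.
Qed.

Lemma D_b i : 0 <= D i b.
Proof.
have [hi|/not_nonzero_fun/derive1_cst0 e] := pselect (nonzero_fun (h i)).
  apply: coercive_critical_ub; [exact: hA1|exact: hA3|].
  by move=> x hx; have /andP[] : a <= x <= b by apply: C_itv; exists i.
by rewrite /D e.
Qed.

Lemma eta_gt0 : 0 < eta. Proof. by case/andP: heta. Qed.

Lemma step_incr i x y : a <= x -> x < y -> y <= b ->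
  step D eta i x < step D eta i y.
Proof.
move=> ax xy yb; rewrite /step.
have : `|D i y - D i x| <= K * `|y - x|.
  by apply: (lipschitz_itv (hA4 i)) => //; [exact: le_trans (ltW xy) yb|exact: le_trans (ltW xy)].
rewrite (ger0_norm (_ : 0 <= y - x)) ?subr_ge0 ?(ltW xy)// => hl.
have h1 : eta * (D i y - D i x) <= eta * (K * (y - x)).
  by rewrite ler_pM2l ?eta_gt0// (le_trans _ hl)// ler_norm.
have h2 : eta * K < 1 by rewrite -ltr_pdivlMr// mul1r; case/andP: heta.
have h3 : eta * K * (y - x) < y - x by rewrite gtr_pMl// subr_gt0.
lra.
Qed.

Let Lopen : open (Lset h).
Proof.
apply: bigcup_open => i _; rewrite -[X in open X]/(D i @^-1` [set z | 0 < z]).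
by apply: open_comp; [move=> x _; exact: D_continuous|exact: open_gt].
Qed.

Let Ropen : open (Rset h).
Proof.
apply: bigcup_open => i _; rewrite -[X in open X]/(D i @^-1` [set z | z < 0]).
by apply: open_comp; [move=> x _; exact: D_continuous|exact: open_lt].
Qed.

Let notL x : ~ Lset h x -> forall i, D i x <= 0.
Proof. by move=> hx i; rewrite leNgt; apply/negP => hi; apply: hx; exists i. Qed.

Let notR x : ~ Rset h x -> forall i, 0 <= D i x.
Proof. by move=> hx i; rewrite leNgt; apply/negP => hi; apply: hx; exists i. Qed.

(** L is open, so no derivative is positive at x. If x were not in C, every nonzero function would
    have a negative derivative near x, and the zero functions never enter L; then x would not be in
    the closure of L. *)
Lemma boundary_L (x : R) : boundary (Lset h) x -> C x.
Proof.
move=> [clx]; rewrite /interior => nx.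
have nLx : ~ Lset h x by move=> Lx; apply: nx; exact: open_nbhs_nbhs.
have Dle := notL nLx.
apply: contrapT => nCx.
have hi i : D i x < 0 \/ ~ nonzero_fun (h i).
  have [nz|] := pselect (nonzero_fun (h i)); [left|by right].
  rewrite lt_neqAle Dle andbT; apply/eqP => e; apply: nCx; exists i => //.
suff : \forall y \near x, forall i, D i y <= 0.
  move=> /clx[y [[i _ /= hy]]] /(_ i); rewrite /D; lra.
suff hn i : \forall y \near x, D i y <= 0.
  exact: (@filter_forall R 'I_n (fun i y => D i y <= 0) (nbhs x) _ hn).
have [lt0|/not_nonzero_fun/derive1_cst0 e] := hi i.
  have hz : nbhs (D i x) [set z | z < 0].
    by apply: open_nbhs_nbhs; split => //; exact: open_lt.
  by apply: (@filterS _ (nbhs x) _ (D i @^-1` [set z | z < 0]) _ _ (@D_continuous i x _ hz)) => y /ltW.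
by apply: (@filterE _ (nbhs x)) => y; rewrite /D e.
Qed.

Lemma boundary_R (x : R) : boundary (Rset h) x -> C x.
Proof.
move=> [clx]; rewrite /interior => nx.
have nLx : ~ Rset h x by move=> Lx; apply: nx; exact: open_nbhs_nbhs.
have Dle := notR nLx.
apply: contrapT => nCx.
have hi i : 0 < D i x \/ ~ nonzero_fun (h i).
  have [nz|] := pselect (nonzero_fun (h i)); [left|by right].
  rewrite lt_def Dle andbT; apply/eqP => e; apply: nCx; exists i => //.
suff : \forall y \near x, forall i, 0 <= D i y.
  move=> /clx[y [[i _ /= hy]]] /(_ i); rewrite /D; lra.
suff hn i : \forall y \near x, 0 <= D i y.
  exact: (@filter_forall R 'I_n (fun i y => 0 <= D i y) (nbhs x) _ hn).
have [lt0|/not_nonzero_fun/derive1_cst0 e] := hi i.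
  have hz : nbhs (D i x) [set z | 0 < z].
    by apply: open_nbhs_nbhs; split => //; exact: open_gt.
  by apply: (@filterS _ (nbhs x) _ (D i @^-1` [set z | 0 < z]) _ _ (@D_continuous i x _ hz)) => y /ltW.
by apply: (@filterE _ (nbhs x)) => y; rewrite /D e.
Qed.

Lemma Tintervals_finite : finite_set (Tintervals h).
Proof.
apply: (@sub_finite_set _ _ (C `*` C)); last exact: finite_setX C_finite C_finite.
by move=> p [_ _ /boundary_L ? /boundary_R ?]; split.
Qed.

(** Boundary points of the open sets L and R lie outside them, hence are walls, and they are
    critical, hence in [a, b]. Conversely the ends are walls that are limits of points of L and
    R. *)
Lemma TintervalsP p : Tintervals h p <-> Tspec D a b p.
Proof.
split=> [[lr hlr bl br]|[al lr rb [Dl Dr] hlr]].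
  have /andP[al _] := C_itv (boundary_L bl).
  have /andP[_ rb] := C_itv (boundary_R br).
  split => //.
    split; [apply: notL => hx; apply: bl.2|apply: notR => hx; apply: br.2].
      exact: open_nbhs_nbhs.
    exact: open_nbhs_nbhs.
  move=> y hy; have [|[i _ hi] [i' _ hi']] := hlr y; first by rewrite /= in_itv.
  by split; [exists i|exists i'].
have hin : `]p.1, p.2[ `<=` Lset h `&` Rset h.
  move=> y; rewrite /= in_itv => /hlr[[i hi] [i' hi']].
  by split; [exists i|exists i'].
split => //; split.
- have := closure_itvoo_left lr.
  by apply: closure_subset => y /hin[].
- move=> /interior_subset[i _ /=]; have := Dl i; rewrite /D; lra.
- have := closure_itvoo_right lr.
  by apply: closure_subset => y /hin[].
- move=> /interior_subset[i _ /=]; have := Dr i; rewrite /D; lra.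
Qed.

(** At the left end all derivatives are nonpositive and by (A5) one is nonzero, so their sum is
    negative; at the right end it is positive. This puts a minimum of the sum inside. *)
Lemma Tinterval_min p : Tintervals h p ->
  exists2 c, p.1 < c < p.2 &
    forall y, p.1 <= y <= p.2 -> \sum_(i < n) h i c <= \sum_(i < n) h i y.
Proof.
move=> /TintervalsP[al lr rb [Dl Dr] hlr].
have [hC e] := C1_sum C1_fc.
apply: (C1_interior_min hC lr); rewrite e.
  rewrite lt_neqAle sumr_le0 ?andbT; last by move=> i _; exact: Dl.
  rewrite -oppr_eq0 -sumrN psumr_eq0; last by move=> i _; rewrite oppr_ge0; exact: Dl.
  have [i hi] := D_neq0 p.1; apply/allPn; exists i; rewrite ?mem_index_enum//=.
  by rewrite oppr_eq0.
rewrite lt_def sumr_ge0 ?andbT; last by move=> i _; exact: Dr.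
rewrite psumr_eq0; last by move=> i _; exact: Dr.
by have [i hi] := D_neq0 p.2; apply/allPn; exists i; rewrite ?mem_index_enum.
Qed.

End Tintervals.

(** * Borel measures on row vectors *)

Section borel_row_vectors.
Context (R : realType) (d : nat).
Local Notation V := 'rV[R]_d.

(** A countable base of open cubes: rational centres and radii 1/(k+1). *)
Definition rat_box (q : {ffun 'I_d -> rat} * nat) : set V :=
  [set x | forall j, `|x 0 j - ratr (q.1 j)| < q.2.+1%:R^-1].

Lemma rat_box_nbhs (U : set V) x : open U -> U x ->
  exists q, rat_box q x /\ rat_box q `<=` U.
Proof.
move=> Uo Ux; have /nbhs_ballP[e /= e0 he] : nbhs x U by exact: open_nbhs_nbhs.
have e20 : 0 < e / 2 by rewrite divr_gt0.
have [k _ hk] := near_infty_natSinv_lt (PosNum e20).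
have {}hk : k.+1%:R^-1 < e / 2 by apply: hk => /=.
have k0 : 0 < k.+1%:R^-1 :> R by rewrite invr_gt0.
have /choice[q hq] : forall j : 'I_d, exists q : rat, `|x 0 j - ratr q| < k.+1%:R^-1.
  move=> j; have [|q] := @rat_in_itvoo R (x 0 j - k.+1%:R^-1) (x 0 j + k.+1%:R^-1).
    by rewrite ltrBlDr -addrA ltrDl addr_gt0.
  rewrite in_itv /= => /andP[q1 q2]; exists q.
  by rewrite distrC ltr_norml ltrBrDl q1 ltrBlDl.
exists ([ffun j => q j], k); split; first by move=> j; rewrite ffunE.
move=> y hy; apply: he; split => // i j; rewrite (ord1 i) /ball /=.
have := hy j; have := hq j; rewrite ffunE /= => h1 h2.
apply: (le_lt_trans (ler_distD (ratr (q j)) _ _)); rewrite (distrC _ (y 0 j)).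
by rewrite [e]splitr ltrD// ?(lt_trans h1)// (lt_trans h2).
Qed.

Lemma open_rat_box q : open (rat_box q).
Proof.
rewrite openE => x hx; apply/nbhs_ballP.
pose e := \big[Order.min/1]_(j < d) (q.2.+1%:R^-1 - `|x 0 j - ratr (q.1 j)|).
have e0 : 0 < e.
  rewrite /e; elim/big_ind : _ => [//|a b a0 b0|j _]; first by rewrite lt_min a0.
  by rewrite subr_gt0.
exists e => //= y [_ hy] j; have := hy 0 j; rewrite /ball /= => hyj.
have he : e <= q.2.+1%:R^-1 - `|x 0 j - ratr (q.1 j)| by exact: bigmin_le_cond.
apply: (le_lt_trans (ler_distD (x 0 j) _ _)); rewrite (distrC (y 0 j)) -ltrBrDr.
exact: lt_le_trans he.
Qed.

Lemma open_bigcup_rat_box (U : set V) : open U ->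
  U = \bigcup_q (if `[< rat_box q `<=` U >] then rat_box q else set0).
Proof.
move=> Uo; apply/seteqP; split => x.
  move=> Ux; have [q [qx qU]] := rat_box_nbhs Uo Ux.
  by exists q => //; rewrite asboolT.
by move=> [q _]; case: asboolP => // h /h.
Qed.

Lemma borel_open (U : set V) : open U -> borel_set U.
Proof. exact: sub_sigma_algebra. Qed.

Lemma borel_closed (U : set V) : closed U -> borel_set U.
Proof.
move=> /closed_openC/borel_open h; rewrite -(setCK U); exact: measurableC.
Qed.

(** Open sets are countable unions of rational boxes, and the preimage of a box is a finite
    intersection of conditions on single coordinates. *)
Lemma measurable_borelRV d0 (T : measurableType d0) (D : set T) (Z : T -> borelRV R d) :
  (forall j, measurable_fun D (fun u => Z u 0 j : R)) -> measurable_fun D Z.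
Proof.
move=> hZ mD; apply: (@measurability _ _ T (borelRV R d) _ _ (@open V)) => //.
move=> _ [U Uo <-].
rewrite (open_bigcup_rat_box Uo) preimage_bigcup setI_bigcupr.
apply: (countable_bigcupT_measurable (countableP _)) => q; case: asboolP => _; last first.
  by rewrite preimage_set0 setI0.
pose A j := D `&` (fun u => Z u 0 j : R) @^-1`
   `](ratr (q.1 j) - q.2.+1%:R^-1), (ratr (q.1 j) + q.2.+1%:R^-1)[%classic.
have mA j : measurable (A j) by apply: hZ.
rewrite (_ : _ `&` _ = D `&` \bigcap_(j : 'I_d) A j).
  by apply: measurableI => //; apply: fin_bigcap_measurable => //; exact: finite_finset.
apply/seteqP; split=> [u [Du hu]|u [Du hu]]; split => // j; last first.
  have [_ /=] := hu j I; rewrite in_itv /= => /andP[q1 q2].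
  by rewrite ltr_norml ltrBrDl q1 ltrBlDl.
move=> _; split => //=; have := hu j.
rewrite ltr_norml => /andP[]; rewrite ltrBrDl => q1; rewrite ltrBlDl => q2.
by rewrite in_itv /= q1 q2.
Qed.

Lemma continuous_borel (g : V -> V) : continuous g ->
  measurable_fun setT (g : borelRV R d -> borelRV R d).
Proof.
move=> gc; apply: (@measurability _ _ (borelRV R d) (borelRV R d) _ _ (@open V)) => //.
move=> _ [U Uo <-]; rewrite setTI; apply: borel_open; apply: open_comp => // x _; exact: gc.
Qed.

Lemma continuous_coordwise (g : V -> V) :
  (forall j, continuous (fun x : V => g x 0 j : R)) -> continuous g.
Proof.
move=> gc x B /nbhs_ballP[e /= e0 he].
have hx : nbhs x [set y | forall j, `|g x 0 j - g y 0 j| < e].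
  apply: (@filter_forall _ _ (fun j y => `|g x 0 j - g y 0 j| < e) (nbhs x)) => j.
  apply: (gc j x [set z | `|g x 0 j - z| < e]); apply/nbhs_ballP.
  by exists e.
apply: (@filterS _ (nbhs x) _ _ _ _ hx) => y hy.
by apply: he; split => // i j; rewrite (ord1 i); exact: hy.
Qed.

Lemma within_continuous_borel (I : set V) (g : V -> R) : closed I ->
  {within I, continuous g} -> measurable_fun (I : set (borelRV R d)) (g : borelRV R d -> R).
Proof.
move=> Ic /continuousP gc; apply: (measurability _ (RGenOpens.measurableE R)).
move=> _ [_ [a [b ->] <-]].
have /open_subspaceP[W Wo WE] := gc _ (@interval_open R (BRight a) (BLeft b) isT isT).
rewrite setIC -WE; apply: measurableI; [exact: borel_open|exact: borel_closed].
Qed.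

(** * Orthants as a generating pi-system of the Borel sets *)

Section orthants.
Variable alpha : {ffun 'I_d -> bool}.

Definition orthant (c : V) : set V := [set y | le_sign alpha y c].

Lemma sign_mul_sq j (x : R) : (-1) ^+ alpha j * ((-1) ^+ alpha j * x) = x.
Proof. by rewrite mulrA -expr2 sqrr_sign mul1r. Qed.

Lemma le_sign_trans (x y z : V) : le_sign alpha x y -> le_sign alpha y z -> le_sign alpha x z.
Proof.
move=> xy yz j; have -> : z 0 j - x 0 j = (z 0 j - y 0 j) + (y 0 j - x 0 j).
  by rewrite addrA subrK.
by rewrite mulrDr addr_ge0.
Qed.

Lemma closed_orthant c : closed (orthant c).
Proof.
rewrite (_ : orthant c = \bigcap_j [set y | 0 <= (-1) ^+ alpha j * (c 0 j - y 0 j)]).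
  apply: closed_bigI => j _.
  rewrite -[X in closed X]/((fun y : V => (-1) ^+ alpha j * (c 0 j - y 0 j)) @^-1` [set z | 0 <= z]).
  have hc : continuous (fun y : V => (-1) ^+ alpha j * (c 0 j - y 0 j)).
    move=> x; apply: (@continuous_comp _ _ _ (fun y : V => y 0 j) (fun z : R => (-1) ^+ alpha j *
      (c 0 j - z))).
      exact: coord_continuous.
    by apply: cvgM; [exact: cvg_cst|apply: cvgB; [exact: cvg_cst|exact: cvg_id]].
  by apply: preimage_closed => [x _|]; [exact: hc|exact: closed_ge].
by apply/seteqP; split => [y h j _|y h j]; exact: h.
Qed.

(** The new corner is the coordinatewise minimum for the order of alpha: signs are applied, the
    minimum is taken, and the signs are undone. *)
Lemma orthantI c1 c2 : exists c, orthant c1 `&` orthant c2 = orthant c.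
Proof.
exists (\row_j ((-1) ^+ alpha j * Num.min ((-1) ^+ alpha j * c1 0 j) ((-1) ^+ alpha j * c2 0 j))).
apply/seteqP; split => [y [h1 h2] j|y h].
  by have := h1 j; have := h2 j; rewrite mxE !mulrBr sign_mul_sq !subr_ge0 le_min => -> ->.
by split=> j; have := h j; rewrite mxE !mulrBr sign_mul_sq !subr_ge0 le_min => /andP[].
Qed.

Definition big_orthant (N : nat) : set V := orthant (\row_j ((-1) ^+ alpha j * N%:R)).

Lemma big_orthant_cover : \bigcup_N big_orthant N = setT.
Proof.
apply/seteqP; split => // y _.
have /choice[N hN] : forall j, exists N : nat, (-1) ^+ alpha j * y 0 j <= N%:R.
  move=> j; exists (Num.bound `|(-1) ^+ alpha j * y 0 j|).
  by apply: (le_trans (ler_norm _)); apply: ltW; rewrite archi_boundP.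
exists (\max_j N j) => // j; rewrite mxE mulrBr sign_mul_sq subr_ge0.
by apply: (le_trans (hN j)); rewrite ler_nat leq_bigmax.
Qed.

Lemma borel_orthants :
  @measurable _ (borelRV R d) = <<s range orthant >>.
Proof.
apply/seteqP; split; last first.
  apply: smallest_sub; first exact: sigma_algebra_measurable.
  by move=> _ [c _ <-]; apply: borel_closed; exact: closed_orthant.
pose T' := g_sigma_algebraType (range orthant).
suff : measurable_fun setT (id : T' -> borelRV R d).
  by move=> h A mA; have := h measurableT A mA; rewrite setTI.
apply: measurable_borelRV => j.
(* The minus sign turns half-spaces that are downward closed for alpha into preimages of the rays
   [t, +oo[, which generate the Borel sets of the line. *)
pose f (y : T') : R := - ((-1) ^+ alpha j * (y : V) 0 j).
suff mf : measurable_fun setT f.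
  rewrite (_ : (fun u : T' => (u : V) 0 j) = (fun u => - (-1) ^+ alpha j * f u)).
    by apply: measurable_funM => //; exact: measurable_cst.
  by apply/funext => u; rewrite /f mulrNN sign_mul_sq.
apply: (measurability _ (RGenCInfty.measurableE R)) => _ [_ [t ->] <-]; rewrite setTI.
(* Corners fixed in direction j and receding to infinity in all others: their orthants exhaust the
   half-space. *)
pose c N : V := \row_k ((-1) ^+ alpha k * (if k == j then - t else N%:R)).
rewrite (_ : _ @^-1` _ = \bigcup_N (orthant (c N) : set T')).
  by apply: bigcupT_measurable => N; apply: sub_sigma_algebra; exists (c N).
apply/seteqP; split => y /=.
  rewrite in_itv /= andbT /f => hy.
  have : setT y by []. 
  rewrite -big_orthant_cover => -[N _ hN]; exists N => // k.
  rewrite mxE mulrBr sign_mul_sq subr_ge0; case: eqP => [->|_]; first by lra.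
  by have := hN k; rewrite mxE mulrBr sign_mul_sq subr_ge0.
move=> [N _ /(_ j)]; rewrite mxE eqxx mulrBr sign_mul_sq subr_ge0 in_itv /= andbT /f; lra.
Qed.

Lemma orthant_measure_unique (m1 m2 : {measure set (borelRV R d) -> \bar R}) :
  (m1 setT < +oo)%E -> (forall c, m1 (orthant c) = m2 (orthant c)) ->
  forall A, borel_set A -> m1 A = m2 A.
Proof.
move=> m1oo m12 A mA; apply: (@measure_unique _ R (borelRV R d) (range orthant) big_orthant _ _ _ _
  m1 m2) => //.
- exact: borel_orthants.
- by move=> _ _ [c1 _ <-] [c2 _ <-]; have [c ->] := orthantI c1 c2; exists c.
- exact: big_orthant_cover.
- by move=> _ [c _ <-].
- move=> k; apply: le_lt_trans m1oo; apply: le_measure; rewrite ?inE //.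
  by apply: borel_closed; exact: closed_orthant.
Qed.

End orthants.

(** A point outside the support has a null neighbourhood, hence lies in a null rational box, and
    there are only countably many of these. *)
Lemma support_null (mu : {measure set (borelRV R d) -> \bar R}) (A : set V) :
  closed A -> meas_support mu `<=` A -> mu (~` A) = 0%E.
Proof.
move=> Ac hA; pose N q := if `[< mu (rat_box q) = 0%E >] then rat_box q else set0.
have mN q : borel_set (N q).
  by rewrite /N; case: ifP => _; [apply: borel_open; exact: open_rat_box|exact: measurable0].
have muN q : mu (N q) = 0%E by rewrite /N; case: asboolP => //; rewrite measure0.
pose N' k := if unpickle k is Some q then N q else set0.
have NN' : \bigcup_q N q = \bigcup_k N' k.
  apply/seteqP; split => x [k _ hk]; last first.
    by move: hk; rewrite /N'; case: unpickle => // q; exists q.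
  by exists (pickle k) => //; rewrite /N' pickleK.
have mN' k : borel_set (N' k).
  by rewrite /N'; case: unpickle => [q|]; [exact: mN|exact: measurable0].
have N0 : mu (\bigcup_q N q) = 0%E.
  rewrite NN'; apply/negligibleP; first exact: bigcupT_measurable.
  apply: negligible_bigcup => k; apply/negligibleP; first exact: mN'.
  rewrite /N'; case: unpickle => [q|]; last exact: measure0.
  by rewrite /N; case: asboolP => //; rewrite measure0.
apply/eqP; rewrite eq_le measure_ge0 andbT -N0.
apply: le_measure; rewrite ?inE.
- by apply: measurableC; exact: borel_closed.
- exact: (countable_bigcupT_measurable (countableP _)).
move=> x /= nAx; have : ~ meas_support mu x by move/hA.
rewrite /meas_support /= => /existsNP[U] /not_implyP[Uo] /not_implyP[Ux /negP].
rewrite -leNgt => U0; have [q [qx qU]] := rat_box_nbhs Uo Ux.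
exists q => //; rewrite /N asboolT //; apply/eqP; rewrite eq_le measure_ge0 andbT.
apply: le_trans U0; apply: le_measure; rewrite ?inE //; apply: borel_open => //.
exact: open_rat_box.
Qed.

Lemma null_support (mu : {measure set (borelRV R d) -> \bar R}) (A : set V) :
  closed A -> mu (~` A) = 0%E -> meas_support mu `<=` A.
Proof.
move=> Ac A0 x hx; apply: contrapT => nAx.
have := hx _ (closed_openC Ac) nAx; by rewrite A0 ltxx.
Qed.

(** Translates the supports of the theorem into full mass, the form in which all later arguments use
    them. *)
Lemma support_prob1 (mu : probRV R d) (A : set V) : closed A ->
  meas_support mu `<=` A <-> mu A = 1%E.
Proof.
move=> Ac; have mA := borel_closed Ac; split => [/(support_null Ac) A0|A1].
  by have := probability_setC mu (measurableC mA); rewrite setCK A0 sube0.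
by apply: null_support => //; have := probability_setC mu mA; rewrite A1 subee.
Qed.

End borel_row_vectors.

(** * Duality between measures and bounded functions *)

Section bounded_measurable.
Context (R : realType) (d : nat) (I : set 'rV[R]_d).
Hypothesis Iclosed : closed I.
Local Notation V := 'rV[R]_d.
Local Notation BI := (I : set (borelRV R d)).
Implicit Types (mu : probRV R d) (g : V -> R).

(** Measurability and bounds are asked on I only, because the absorption probabilities are shown
    continuous only within I. *)
Definition bounded_borel g :=
  measurable_fun BI (g : borelRV R d -> R) /\
  exists C, forall x, I x -> `|g x| <= C.

Definition mean mu g : R := \int[mu]_(x in BI) g x.

Let mI : borel_set I. Proof. exact: borel_closed. Qed.

Lemma bounded_borel_integrable mu g : bounded_borel g ->
  mu.-integrable BI (EFin \o g).
Proof.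
move=> [mg [C hC]]; apply: measurable_bounded_integrable => //.
  by apply: (@le_lt_trans _ _ 1%E); [exact: probability_le1|exact: ltry].
exists C; split; first exact: num_real.
by move=> M CM x Ix; apply: le_trans (hC _ Ix) (ltW CM).
Qed.

Lemma bounded_borel_cst c : bounded_borel (fun=> c).
Proof. by split; [exact: measurable_cst|exists `|c|]. Qed.

Lemma bounded_borel_indic A : borel_set A -> bounded_borel (\1_A).
Proof.
move=> mA; split; last first.
  by exists 1 => x _; rewrite indicE ger0_norm// lern1; case: (_ \in _).
exact: measurable_indic.
Qed.

Lemma bounded_borelD g1 g2 : bounded_borel g1 -> bounded_borel g2 ->
  bounded_borel (fun x => g1 x + g2 x).
Proof.
move=> [m1 [C1 h1]] [m2 [C2 h2]]; split; first exact: measurable_funD.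
exists (C1 + C2) => x Ix; apply: le_trans (ler_normD _ _) _.
by apply: lerD; [exact: h1|exact: h2].
Qed.

Lemma bounded_borelZ c g : bounded_borel g -> bounded_borel (fun x => c * g x).
Proof.
move=> [m1 [C1 h1]]; split; first by apply: measurable_funM => //; exact: measurable_cst.
exists (`|c| * C1) => x Ix; rewrite normrM ler_wpM2l//; exact: h1.
Qed.

Lemma bounded_borelB g1 g2 : bounded_borel g1 -> bounded_borel g2 ->
  bounded_borel (fun x => g1 x - g2 x).
Proof.
move=> h1 h2; have := bounded_borelD h1 (bounded_borelZ (-1) h2).
by under [X in bounded_borel X]eq_fun do rewrite mulN1r.
Qed.

Lemma bounded_borel_sum m (g : 'I_m -> V -> R) : (forall i, bounded_borel (g i)) ->
  bounded_borel (fun x => \sum_(i < m) g i x).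
Proof.
move=> hg; elim: (index_enum _) => [|i s IH].
  by under [X in bounded_borel X]eq_fun do rewrite big_nil; exact: bounded_borel_cst.
by under [X in bounded_borel X]eq_fun do rewrite big_cons; exact: bounded_borelD.
Qed.

Lemma eq_mean mu g1 g2 : (forall x, I x -> g1 x = g2 x) -> mean mu g1 = mean mu g2.
Proof. by move=> e; apply: eq_Rintegral => x; rewrite inE => /e. Qed.

Lemma meanD mu g1 g2 : bounded_borel g1 -> bounded_borel g2 ->
  mean mu (fun x => g1 x + g2 x) = mean mu g1 + mean mu g2.
Proof. by move=> h1 h2; apply: RintegralD => //; exact: bounded_borel_integrable. Qed.

Lemma meanB mu g1 g2 : bounded_borel g1 -> bounded_borel g2 ->
  mean mu (fun x => g1 x - g2 x) = mean mu g1 - mean mu g2.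
Proof. by move=> h1 h2; apply: RintegralB => //; exact: bounded_borel_integrable. Qed.

Lemma meanZ mu c g : bounded_borel g -> mean mu (fun x => c * g x) = c * mean mu g.
Proof. by move=> h1; apply: RintegralZl => //; exact: bounded_borel_integrable. Qed.

Lemma mean_sum mu m (g : 'I_m -> V -> R) : (forall i, bounded_borel (g i)) ->
  mean mu (fun x => \sum_(i < m) g i x) = \sum_(i < m) mean mu (g i).
Proof.
move=> hg.
suff : bounded_borel (fun x => \sum_(i < m) g i x) /\
  mean mu (fun x => \sum_(i < m) g i x) = \sum_(i < m) mean mu (g i) by case.
elim: (index_enum _) => [|i s [bs IH]].
  rewrite big_nil; split.
    by under [X in bounded_borel X]eq_fun do rewrite big_nil; exact: bounded_borel_cst.
  rewrite (@eq_mean _ _ (fun=> 0)); last by move=> x _; rewrite big_nil.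
  by rewrite /mean Rintegral_cst// mul0r.
split; first by under [X in bounded_borel X]eq_fun do rewrite big_cons; exact: bounded_borelD.
rewrite big_cons -IH -meanD//.
by apply: eq_mean => x _; rewrite big_cons.
Qed.

Lemma mean_le mu g1 g2 : bounded_borel g1 -> bounded_borel g2 ->
  (forall x, I x -> g1 x <= g2 x) -> mean mu g1 <= mean mu g2.
Proof. by move=> h1 h2 h; apply: le_Rintegral => //; exact: bounded_borel_integrable. Qed.

Lemma mean_cst mu c : mu I = 1%E -> mean mu (fun=> c) = c.
Proof.
move=> I1; transitivity (c * fine (mu I)); first exact: Rintegral_cst.
by rewrite I1 mulr1.
Qed.

Lemma mean_norm_le mu g1 g2 : bounded_borel g1 -> bounded_borel g2 ->
  (forall x, I x -> `|g1 x| <= g2 x) -> `|mean mu g1| <= mean mu g2.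
Proof.
move=> h1 h2 h; rewrite ler_norml -[X in X <= _ <= _]mulN1r -meanZ//; apply/andP; split.
  apply: mean_le => //; first exact: bounded_borelZ.
  by move=> x Ix; have := h x Ix; rewrite mulN1r ler_norml => /andP[].
by apply: mean_le => // x Ix; have := h x Ix; rewrite ler_norml => /andP[].
Qed.

Lemma prob1_setI mu A : mu I = 1%E -> borel_set A -> mu (A `&` I) = mu A.
Proof.
move=> I1 mA; apply/eqP; rewrite eq_le; apply/andP; split.
  by apply: le_measure; rewrite ?inE//; exact: measurableI.
have I0 : mu (~` I) = 0%E by have := probability_setC mu mI; rewrite I1 subee.
apply: (@le_trans _ _ (mu ((A `&` I) `|` ~` I))).
  apply: le_measure; rewrite ?inE//.
    by apply: measurableU; [exact: measurableI|exact: measurableC].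
  by move=> x Ax; have [Ix|nIx] := pselect (I x); [left|right].
apply: le_trans (measureU2 _ _ _) _; [exact: measurableI|exact: measurableC|].
by rewrite [X in (_ + X)%E](_ : _ = 0%E)// adde0.
Qed.

Lemma mean_indic mu A : mu I = 1%E -> borel_set A ->
  mu A = (mean mu (\1_A))%:E.
Proof.
move=> I1 mA; rewrite -(prob1_setI I1 mA).
have -> : mean mu \1_A = fine (mu (A `&` I)) by rewrite /mean /Rintegral integral_indic.
rewrite fineK// ge0_fin_numE//.
apply: (@le_lt_trans _ _ 1%E); last exact: ltry.
by apply: probability_le1; exact: measurableI.
Qed.

Lemma mean_EFin mu g : bounded_borel g ->
  (\int[mu]_(x in BI) (g x)%:E = (mean mu g)%:E)%E.
Proof.
move=> /(bounded_borel_integrable mu) hg; rewrite /mean /Rintegral fineK//.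
exact: integrable_fin_num.
Qed.

End bounded_measurable.

(** * Duality of the Markov operator and its action on functions *)

Section duality.
Context (R : realType) (n d : nat) (I : set 'rV[R]_d).
Variable phi : 'I_n -> 'rV[R]_d -> 'rV[R]_d.
Hypothesis Iclosed : closed I.
Hypothesis phic : forall i, continuous (phi i).
Hypothesis phiI : forall i x, I x -> I (phi i x).
Local Notation V := 'rV[R]_d.
Local Notation U := (markov_dual phi).

Lemma bounded_borel_comp i g : bounded_borel I g -> bounded_borel I (g \o phi i).
Proof.
move=> [mg [C hC]]; split; last by exists C => x Ix; apply: hC; exact: phiI.
apply: (@measurable_comp _ _ _ (borelRV R d) (borelRV R d) _ (I : set (borelRV R d))) mg _ => //.
- exact: borel_closed.
- by move=> _ [x Ix <-]; exact: phiI.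
- by apply: measurable_funTS; exact: continuous_borel.
Qed.

Lemma bounded_borel_dual g : bounded_borel I g -> bounded_borel I (U g).
Proof.
move=> hg; apply: bounded_borelZ; apply: bounded_borel_sum => // i.
exact: bounded_borel_comp.
Qed.

Lemma bounded_borel_iter k g : bounded_borel I g -> bounded_borel I (iter k U g).
Proof. by move=> hg; elim: k => //= k IH; exact: bounded_borel_dual. Qed.

Lemma iter_dual_sum k c m (g : 'I_m -> V -> R) x :
  iter k U (fun y => c * \sum_(i < m) g i y) x = c * \sum_(i < m) iter k U (g i) x.
Proof.
elim: k x => //= k IH x; rewrite /markov_dual.
rewrite (eq_bigr (fun i => c * \sum_(j < m) iter k U (g j) (phi i x))); last by move=> i _; exact: IH.
by rewrite -mulr_sumr mulrCA exchange_big /= -mulr_sumr.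
Qed.

Lemma borel_preimage i A : borel_set A -> borel_set (phi i @^-1` A).
Proof.
move=> mA; have := continuous_borel (@phic i) measurableT mA; by rewrite setTI.
Qed.

(** Reduces statements on P^k mu to pointwise ones on functions. The outer P replaces A by its
    preimages, which corresponds to the innermost dual step on the indicator. *)
Lemma iter_markov_mean (mu : probRV R d) k A : mu I = 1%E -> borel_set A ->
  iter k (markov_op phi) mu A = (mean I mu (iter k U (\1_A)))%:E.
Proof.
move=> I1; elim: k A => [|k IH] A mA /=; first exact: mean_indic.
rewrite {1}/markov_op.
rewrite (eq_bigr (fun i => (mean I mu (iter k U (\1_(phi i @^-1` A))))%:E)); last first.
  by move=> i _; apply: IH; exact: borel_preimage.
have bi i : bounded_borel I (iter k U (\1_(phi i @^-1` A))).
  by apply: bounded_borel_iter; apply: bounded_borel_indic => //; exact: borel_preimage.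
rewrite sumEFin -EFinM -mean_sum// -meanZ//; last exact: bounded_borel_sum.
congr EFin; apply: eq_mean => x _; rewrite -iter_dual_sum.
rewrite -[RHS]/(iter k.+1 U (\1_A) x) iterSr; congr (iter k U _ x).
Qed.

End duality.

(** * Existence of a stationary measure *)

Lemma mnormalize_prob1 d (T : measurableType d) (R : realType)
    (mu : {measure set T -> \bar R}) (P : probability T R) A :
  mu setT = 1%E -> mnormalize mu P A = mu A.
Proof. by move=> h; rewrite /mnormalize h eqe oner_eq0 /= invr1 mule1. Qed.

(** * Base-n digits of a uniform number *)

Section digits.
Context (R : realType).
Local Notation lambda := (@lebesgue_measure R).
Local Notation unit_itv := (`[0, 1[%classic : set (measurableTypeR R)).

Let munit : measurable unit_itv. Proof. exact: measurable_itv. Qed.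

Let munit1 : mrestr lambda munit setT = 1%E.
Proof. by rewrite /mrestr setTI lebesgue_measure_itv /= lte01 oppr0 adde0. Qed.

(** Lebesgue measure on [0, 1[; its mass is already 1, and [mnormalize] only supplies the structure
    of a probability. *)
Definition uniform01 : probability (measurableTypeR R) R :=
  mnormalize (mrestr lambda munit) (@dirac _ (measurableTypeR R) (0 : R) R).

Lemma uniform01E A : uniform01 A = lambda (A `&` `[0, 1[).
Proof.
exact: (mnormalize_prob1 _ _ munit1).
Qed.

Lemma uniform01_itv : uniform01 `[0, 1[%classic = 1%E.
Proof. by rewrite uniform01E setIid lebesgue_measure_itv /= lte01 oppr0 adde0. Qed.

Lemma lebesgue_affine (a b : R) (A : set (measurableTypeR R)) : 0 < a -> measurable A ->
  lambda A = (a%:E * lambda ((fun v : R => (a * (v + b))%R) @^-1` A))%E.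
Proof.
move=> a0 mA.
pose f (v : measurableTypeR R) : measurableTypeR R := a * (v + b).
have mf : measurable_fun setT f.
  apply: measurable_funM; first exact: measurable_cst.
  by apply: measurable_funD => //; exact: measurable_cst.
pose nu : {measure set (measurableTypeR R) -> \bar R} :=
  mscale (NngNum (ltW a0))
    (measure_function_pushforward__canonical__measure_function_Measure lambda mf).
rewrite -[RHS]/(nu A).
apply: lebesgue_measure_unique => // X /ocitvP[->|[[x y] /= xy ->]].
  by rewrite !measure0.
rewrite /mscale /= /pushforward /=.
rewrite (_ : _ @^-1` _ = `](a^-1 * x - b), (a^-1 * y - b)]%classic).
  rewrite !lebesgue_measure_itv /= !lte_fin ltrD2r ltr_pM2l ?invr_gt0// xy -!EFinD.
  by rewrite -EFinM opprB addrA subrK mulrBr !mulVKf ?gt_eqF.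
apply/seteqP; split => v /=; rewrite !in_itv /= /f.
  by rewrite ltrBlDr lerBrDr ltr_pdivrMl// ler_pdivlMl.
by rewrite ltrBlDr lerBrDr ltr_pdivrMl// ler_pdivlMl.
Qed.

Lemma unit_digit n (u : R) : (0 < n)%N -> 0 <= u < 1 ->
  exists (i : 'I_n) (v : R), 0 <= v < 1 /\ u = n%:R^-1 * (v + (i : nat)%:R).
Proof.
move=> n0 /andP[u0 u1]; have n0' : 0 < n%:R :> R by rewrite ltr0n.
have nu0 : 0 <= n%:R * u by rewrite mulr_ge0// ltW.
have /andP[h1 h2] := truncn_itv nu0.
have hi : (Num.truncn (n%:R * u) < n)%N by rewrite truncn_lt_nat// gtr_pMr.
exists (Ordinal hi), (n%:R * u - (Num.truncn (n%:R * u))%:R); split.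
  by rewrite subr_ge0 h1 ltrBlDr addrC natr1.
by rewrite /= subrK mulKf// gt_eqF.
Qed.

Lemma digit_itv n (i : 'I_n) (v : R) : 0 <= v < 1 -> 0 <= n%:R^-1 * (v + (i : nat)%:R) < 1.
Proof.
move=> /andP[v0 v1]; have n0 : 0 < n%:R :> R by rewrite ltr0n (leq_ltn_trans _ (ltn_ord i)).
rewrite mulr_ge0 ?addr_ge0 ?invr_ge0 ?ler0n//= mulrC ltr_pdivrMr// mul1r.
have : (i : nat)%:R + 1 <= n%:R :> R by rewrite natr1 ler_nat.
lra.
Qed.

Lemma digit_uniq (i j : nat) (v : R) : 0 <= v < 1 -> (j%:R <= v + i%:R < j%:R + 1) = (j == i).
Proof.
move=> /andP[v0 v1]; apply/idP/eqP => [/andP[h1 h2]|->]; last by rewrite lerDr v0 addrC ltrD2l.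
apply/eqP; rewrite eqn_leq -ltnS -(ltnS i) -!(ltr_nat R) -!natr1; apply/andP; split.
  by apply: (le_lt_trans h1); rewrite addrC ltrD2l.
by apply: le_lt_trans h2; rewrite lerDr.
Qed.

(** The first digit is uniform and, given it, the rest is again uniform: [0, 1[ is cut by first
    digit into n pieces [J i], each an affine copy of the whole. *)
Lemma uniform01_digits n (A : set (measurableTypeR R)) : (0 < n)%N -> measurable A ->
  uniform01 A = ((n%:R^-1)%:E *
    \sum_(i < n) uniform01 ((fun v : R => (n%:R^-1 * (v + (i : nat)%:R))%R) @^-1` A))%E.
Proof.
move=> n0 mA; have n0' : 0 < n%:R^-1 :> R by rewrite invr_gt0 ltr0n.
have nn0 : n%:R != 0 :> R by rewrite pnatr_eq0 -lt0n.
pose J (i : nat) := `[0, 1[%classic `&` [set u : R | i%:R <= n%:R * u < i%:R + 1].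
have JE : `[0, 1[%classic = \big[setU/set0]_(i < n) J i.
  rewrite -bigcup_mkord; apply/seteqP; split => [u|u [k _ []//]].
  rewrite /= in_itv /= => u01; have [k [v [v01 uE]]] := unit_digit n0 u01.
  exists (k : nat); first by rewrite /=.
  by split; rewrite /= ?in_itv//= uE mulVKf// digit_uniq.
have mJ i : measurable (J i : set (measurableTypeR R)).
  rewrite (_ : J i = `[0, 1[%classic `&` `[(n%:R^-1 * i%:R), (n%:R^-1 * (i%:R + 1))[%classic).
    by apply: measurableI; exact: measurable_itv.
  apply/seteqP; split => u [h1 h2]; split => //=; move: h2; rewrite /= in_itv /=.
    by rewrite ler_pdivrMl ?ltr0n// ltr_pdivlMl ?ltr0n.
  by rewrite ler_pdivrMl ?ltr0n// ltr_pdivlMl ?ltr0n.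
rewrite uniform01E JE big_distrr /= measure_bigsetU_ord; last 2 first.
- by move=> i; exact: measurableI.
- move=> i j _ _ [u [[_ [/= u01 h1]] [_ [_ /= h2]]]]; apply: val_inj => /=.
  have [k [v [v01 uE]]] := unit_digit n0 u01.
  have nuE : n%:R * u = v + (k : nat)%:R by rewrite uE mulVKf.
  by move: h1 h2; rewrite nuE !digit_uniq// => /eqP <- /eqP <-.
rewrite ge0_sume_distrr //; apply: eq_bigr => i _.
transitivity (lambda (A `&` J i)) => //; rewrite uniform01E.
rewrite (@lebesgue_affine n%:R^-1 (i : nat)%:R) //; last exact: measurableI.
congr (_ * lambda _)%E; apply/seteqP; split => v /=; rewrite !in_itv /=.
  move=> [Av [_ /=]]; rewrite mulVKf// => /andP[h1 h2]; split => //; lra.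
move=> [Av v01]; split => //; split; first exact: digit_itv.
by rewrite /= mulVKf// digit_uniq.
Qed.

End digits.

(** * Backward iterates and their limit law *)

Section stationary.
Context (R : realType) (n d : nat) (s : 'I_n -> 'I_d -> R -> R) (lo hi : 'I_d -> R).
Hypothesis n_gt0 : (0 < n)%N.
Hypothesis lohi : forall j, lo j <= hi j.
Hypothesis s_cont : forall i j, continuous (s i j).
Hypothesis s_itv : forall i j x, lo j <= x <= hi j -> lo j <= s i j x <= hi j.
Hypothesis s_mono : forall i j x y, lo j <= x -> x <= y -> y <= hi j -> s i j x <= s i j y.

(* If [i_1 i_2 ...] are the base-n digits of u, then [backward k j u] is the
   j-th coordinate of [phi_(i_1) (... (phi_(i_k) lo))]. *)
Fixpoint backward (k : nat) (j : 'I_d) (u : R) : R :=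
  if k is k'.+1 then
    \sum_(i < n) \1_(`[0, 1[%classic : set R) (n%:R * u - (i : nat)%:R) *
      s i j (backward k' j (n%:R * u - (i : nat)%:R))
  else \1_(`[0, 1[%classic : set R) u * lo j.

Lemma backward_out k j u : ~ (0 <= u < 1) -> backward k j u = 0.
Proof.
move=> hu; case: k => [|k] /=.
  by rewrite indicE memNset ?mul0r//= in_itv.
rewrite big1// => i _; rewrite indicE memNset ?mul0r//= in_itv /= => h; apply: hu.
have := digit_itv i h; rewrite subrK mulKf// pnatr_eq0 -lt0n//.
Qed.

(** Only the term of the true first digit survives the indicators. The sum form makes measurability
    immediate; this lemma recovers the recursion from it. *)
Lemma backwardS k j (i : 'I_n) v : 0 <= v < 1 ->
  backward k.+1 j (n%:R^-1 * (v + (i : nat)%:R)) = s i j (backward k j v).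
Proof.
move=> v01 /=; rewrite mulVKf ?pnatr_eq0 -?lt0n//.
rewrite (bigD1 i) //= addrK indicE mem_set ?mul1r /= ?in_itv//.
rewrite big1 ?addr0// => i' i'i; rewrite indicE memNset ?mul0r//= in_itv /=.
rewrite subr_ge0 ltrBlDl => h.
by move: i'i; rewrite -(inj_eq val_inj) -(digit_uniq i i' v01) h.
Qed.

Lemma backward_itv k j u : 0 <= u < 1 -> lo j <= backward k j u <= hi j.
Proof.
elim: k u => [|k IH] u u01.
  by rewrite /= indicE mem_set ?mul1r /= ?in_itv// lexx lohi.
have [i [v [v01 ->]]] := unit_digit n_gt0 u01.
by rewrite backwardS//; apply: s_itv; exact: IH.
Qed.

(** A new map enters innermost and can only raise the least point [lo]; the outer maps preserve the
    inequality by monotonicity. *)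
Lemma backward_leS k j u : 0 <= u < 1 -> backward k j u <= backward k.+1 j u.
Proof.
elim: k u => [|k IH] u u01.
  rewrite [leLHS]/= indicE mem_set ?mul1r /= ?in_itv//.
  by have /andP[] := backward_itv 1 j u01.
have [i [v [v01 ->]]] := unit_digit n_gt0 u01; rewrite !(backwardS _ _ _ v01).
have /andP[h1 _] := backward_itv k j v01.
have /andP[_ h2] := backward_itv k.+1 j v01.
by apply: s_mono => //; exact: IH.
Qed.

Definition backward_lim j u := limn (fun k => backward k j u).

Lemma backward_cvg j u : (fun k => backward k j u) @ \oo --> backward_lim j u.
Proof.
have [u01|u01] := pselect (0 <= u < 1); last first.
  rewrite /backward_lim (_ : (fun k => backward k j u) = fun=> 0); first exact: is_cvg_cst.
  by apply/funext => k; rewrite backward_out.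
apply: nondecreasing_is_cvgn.
  by apply/nondecreasing_seqP => k; exact: backward_leS.
by exists (hi j) => _ [k _ <-]; have /andP[] := backward_itv k j u01.
Qed.

Lemma backward_lim_itv j u : 0 <= u < 1 -> lo j <= backward_lim j u <= hi j.
Proof.
move=> u01; apply/andP; split.
  apply: limr_ge; first exact: backward_cvg.
  by apply: nearW => k; have /andP[] := backward_itv k j u01.
apply: limr_le; first exact: backward_cvg.
by apply: nearW => k; have /andP[] := backward_itv k j u01.
Qed.

(** In the limit, prepending the digit i amounts to applying the i-th map. With the self-similarity
    of the uniform law this is invariance of the law of the limit. *)
Lemma backward_lim_digit j (i : 'I_n) v : 0 <= v < 1 ->
  backward_lim j (n%:R^-1 * (v + (i : nat)%:R)) = s i j (backward_lim j v).
Proof.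
move=> v01; have := @backward_cvg j (n%:R^-1 * (v + (i : nat)%:R)).
rewrite -(cvg_shiftS (fun k => backward k j _)).
rewrite (_ : [sequence _]_k = fun k => s i j (backward k j v)); last first.
  by apply/funext => k; exact: backwardS.
move=> h1; have h2 : (fun k => s i j (backward k j v)) @ \oo --> s i j (backward_lim j v).
  by apply: continuous_cvg; [exact: s_cont|exact: backward_cvg].
have <- := cvg_lim (@Rhausdorff R) h1; exact: (cvg_lim (@Rhausdorff R) h2).
Qed.

Lemma measurable_backward k j :
  measurable_fun setT (backward k j : measurableTypeR R -> measurableTypeR R).
Proof.
elim: k => [|k IH] /=.
  apply: measurable_funM => //; apply: measurable_indic; exact: measurable_itv.
apply: measurable_sum => i.
have ma : measurable_fun setT (fun u : measurableTypeR R => n%:R * u - (i : nat)%:R : measurableTypeR R).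
  by apply: measurable_funB => //; exact: measurable_funM.
apply: measurable_funM.
  apply: (measurableT_comp _ ma); apply: measurable_indic; exact: measurable_itv.
apply: measurableT_comp; first exact: continuous_measurable_fun (@s_cont i j).
exact: measurableT_comp.
Qed.

Lemma measurable_backward_lim j :
  measurable_fun setT (backward_lim j : measurableTypeR R -> measurableTypeR R).
Proof.
apply: (@measurable_fun_cvg _ _ _ _ (fun k => backward k j)).
  by move=> k; exact: measurable_backward.
by move=> x _; exact: backward_cvg.
Qed.

Lemma stationary_exists (phi : 'I_n -> 'rV[R]_d -> 'rV[R]_d) :
  (forall i, continuous (phi i)) ->
  (forall i x j, phi i x 0 j = s i j (x 0 j)) ->
  exists mu : probRV R d, mu [set x | forall j, lo j <= (x : 'rV[R]_d) 0 j <= hi j] = 1%E /\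
    invariant_measure phi mu.
Proof.
move=> phic phiE.
pose Z (u : measurableTypeR R) : borelRV R d := \row_j backward_lim j u.
have mZ : measurable_fun setT Z.
  apply: measurable_borelRV => j.
  by under eq_fun do rewrite mxE; exact: measurable_backward_lim.
have mpre A : borel_set A -> measurable (Z @^-1` A).
  by move=> mA; have := mZ measurableT _ mA; rewrite setTI.
exists (distribution (uniform01 R) (mfun_Sub (mem_set mZ))); split.
  rewrite -[LHS]/(uniform01 R (Z @^-1` [set x | forall j, lo j <= (x : 'rV[R]_d) 0 j <= hi j])).
  rewrite uniform01E -(uniform01_itv R) uniform01E; congr (lebesgue_measure _).
  apply/seteqP; split => u [] //=; rewrite in_itv /= => u01; split => // j.
  by rewrite mxE; exact: backward_lim_itv.
move=> A mA; rewrite /markov_op.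
rewrite -[RHS]/(uniform01 R (Z @^-1` A)) (uniform01_digits n_gt0); last exact: mpre.
congr (_ * _)%E; apply: eq_bigr => i _.
rewrite -[LHS]/(uniform01 R (Z @^-1` (phi i @^-1` A))) !uniform01E.
have ZE v : 0 <= v < 1 -> Z (n%:R^-1 * (v + (i : nat)%:R)) = phi i (Z v).
  move=> v01; apply/rowP => j; rewrite phiE !mxE; exact: backward_lim_digit.
congr (lebesgue_measure _); apply/seteqP; split => v [/= hA]; rewrite in_itv /= => v01;
  by split; rewrite /= ?in_itv//= ?ZE// -ZE.
Qed.

End stationary.

(** * Splitting words and contraction of oscillations *)

Section indicator.
Context (R : realType) (T : Type).
Implicit Types (A : set T).

Lemma indic_in A x : A x -> \1_A x = 1 :> R.
Proof. by move=> Ax; rewrite indicE mem_set. Qed.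

Lemma indic_out A x : ~ A x -> \1_A x = 0 :> R.
Proof. by move=> Ax; rewrite indicE memNset. Qed.

Lemma indic_ge0 A x : 0 <= \1_A x :> R.
Proof. by rewrite indicE ler0n. Qed.

Lemma indic_le1 A x : \1_A x <= 1 :> R.
Proof. by rewrite indicE lern1; case: (_ \in _). Qed.

End indicator.

Section markov_dual_theory.
Context (R : realType) (n d : nat) (phi : 'I_n -> 'rV[R]_d -> 'rV[R]_d).
Hypothesis n_gt0 : (0 < n)%N.
Local Notation V := 'rV[R]_d.
Local Notation U := (markov_dual phi).

Definition preserved (S : set V) := forall i x, S x -> S (phi i x).

Lemma nR_neq0 : n%:R != 0 :> R. Proof. by rewrite pnatr_eq0 -lt0n. Qed.
Lemma nRV_gt0 : 0 < n%:R^-1 :> R. Proof. by rewrite invr_gt0 ltr0n. Qed.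

Lemma average_cst (c : R) : n%:R^-1 * \sum_(i < n) c = c.
Proof. by rewrite sumr_const card_ord -(mulr_natl c) mulKf// nR_neq0. Qed.

Lemma average_le (a b : 'I_n -> R) : (forall i, a i <= b i) ->
  n%:R^-1 * \sum_(i < n) a i <= n%:R^-1 * \sum_(i < n) b i.
Proof. by move=> ab; rewrite ler_pM2l ?nRV_gt0//; apply: ler_sum => i _. Qed.

Lemma geom_rate_ge0 l : 0 <= geom_rate R n l.
Proof. by rewrite subr_ge0 invf_le1 ?exprn_gt0 ?ltr0n// exprn_ege1// ler1n. Qed.

Lemma geom_rate_lt1 l : geom_rate R n l < 1.
Proof. by rewrite gtrBl invr_gt0 exprn_gt0// ltr0n. Qed.

Lemma geom_rate_le l l' : (l <= l')%N -> geom_rate R n l <= geom_rate R n l'.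
Proof.
move=> ll'; rewrite lerD2l lerN2 lef_pV2 ?posrE ?exprn_gt0 ?ltr0n//.
by rewrite ler_weXn2l// ler1n.
Qed.

(** One good branch at level l yields level l+1: (n - 1 + (1 - n^(-l))) / n = 1 - n^(-(l+1)). *)
Lemma average_one_le (a : 'I_n -> R) i (c : R) l : (forall j, a j <= c) ->
  a i <= geom_rate R n l * c -> n%:R^-1 * \sum_(j < n) a j <= geom_rate R n l.+1 * c.
Proof.
move=> ac ai; rewrite ler_pdivrMl ?ltr0n// (bigD1 i) //=.
apply: (le_trans (lerD ai (ler_sum _ (fun j _ => ac j)))).
rewrite sumr_const -[X in X <= _]addrC.
have -> : #|[pred j | j != i]| = n.-1 by rewrite cardC1 card_ord.
rewrite -(mulr_natl c) -mulrDl mulrA.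
suff -> : n.-1%:R + geom_rate R n l = n%:R * geom_rate R n l.+1 by [].
rewrite /geom_rate exprS invfM mulrBr mulr1 mulrA divff ?nR_neq0// mul1r.
have -> : n%:R = n.-1%:R + 1 :> R by rewrite natr1 prednK.
by rewrite addrA.
Qed.

Lemma iter_dual_le (S : set V) k g1 g2 : preserved S -> (forall x, S x -> g1 x <= g2 x) ->
  forall x, S x -> iter k U g1 x <= iter k U g2 x.
Proof.
move=> hS h; elim: k => [|k IH] x Sx /=; first exact: h.
by apply: average_le => i; apply: IH; exact: hS.
Qed.

Lemma eq_iter_dual (S : set V) k g1 g2 : preserved S -> (forall x, S x -> g1 x = g2 x) ->
  forall x, S x -> iter k U g1 x = iter k U g2 x.
Proof.
move=> hS h x Sx; apply/eqP; rewrite eq_le.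
by rewrite !(@iter_dual_le S)// => y Sy; rewrite h.
Qed.

Lemma iter_dual_cst k (c : R) x : iter k U (fun=> c) x = c.
Proof.
elim: k x => //= k IH x; rewrite /markov_dual -[RHS]average_cst.
by congr (_ * _); apply: eq_bigr => i _; exact: IH.
Qed.

Lemma iter_dual_cst_on (S : set V) k g (c : R) : preserved S -> (forall x, S x -> g x = c) ->
  forall x, S x -> iter k U g x = c.
Proof. by move=> hS h x Sx; rewrite (@eq_iter_dual S k g (fun=> c))// iter_dual_cst. Qed.

Lemma iter_dual_lin k (a b : R) g1 g2 x :
  iter k U (fun y => a * g1 y + b * g2 y) x = a * iter k U g1 x + b * iter k U g2 x.
Proof.
elim: k x => //= k IH x; rewrite /markov_dual.
rewrite (eq_bigr (fun i => a * iter k U g1 (phi i x) + b * iter k U g2 (phi i x))); last by move=>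
  i _; exact: IH.
by rewrite big_split /= -!mulr_sumr mulrDr !(mulrCA n%:R^-1).
Qed.

Lemma iter_dualD k g1 g2 x :
  iter k U (fun y => g1 y + g2 y) x = iter k U g1 x + iter k U g2 x.
Proof.
rewrite -[iter k U g1 x]mul1r -[X in _ + X]mul1r -iter_dual_lin.
by congr (iter k U _ x); apply/funext => y; rewrite !mul1r.
Qed.

Lemma iter_dualZ k a g x : iter k U (fun y => a * g y) x = a * iter k U g x.
Proof.
rewrite -[RHS]addr0 -(mul0r (iter k U g x)) -iter_dual_lin.
by congr (iter k U _ x); apply/funext => y; rewrite mul0r addr0.
Qed.

Lemma iter_dualB k g1 g2 x :
  iter k U (fun y => g1 y - g2 y) x = iter k U g1 x - iter k U g2 x.
Proof.
rewrite -[iter k U g1 x]mul1r -[X in _ - X]mul1r -mulNr -iter_dual_lin.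
by congr (iter k U _ x); apply/funext => y; rewrite mul1r mulN1r.
Qed.

Lemma iter_dual_norm_le (S : set V) k g1 g2 : preserved S ->
  (forall x, S x -> `|g1 x| <= g2 x) -> forall x, S x -> `|iter k U g1 x| <= iter k U g2 x.
Proof.
move=> hS h x Sx; rewrite ler_norml; apply/andP; split.
  rewrite -mulN1r -iter_dualZ; apply: (@iter_dual_le S) => // y Sy.
  by have := h y Sy; rewrite mulN1r ler_norml => /andP[].
by apply: (@iter_dual_le S) => // y Sy; have := h y Sy; rewrite ler_norml => /andP[].
Qed.

Lemma preserved_path S w x : preserved S -> S x -> S (along_path phi w x).
Proof. by move=> hS; elim: w x => //= i w IH x Sx; apply: IH; exact: hS. Qed.

(** Among all words of this length, w contributes at most 0 and the others at most c. *)
Lemma iter_dual_path_le (S : set V) (g : V -> R) (c : R) w x : preserved S ->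
  (forall y, S y -> g y <= c) -> S x -> g (along_path phi w x) <= 0 ->
  iter (size w) U g x <= geom_rate R n (size w) * c.
Proof.
move=> hS gc; elim: w x => [|i w IH] x Sx /= gx.
  by rewrite /geom_rate expr0 invr1 subrr mul0r.
apply: (@average_one_le _ i) => [j|]; last by apply: IH => //; exact: hS.
rewrite -(iter_dual_cst (size w) c (phi j x)).
by apply: (@iter_dual_le S) => //; exact: hS.
Qed.

(* On the branch of the word p the test set has become trivial on S, so one of
   the n ^ size p branches of Phi (size p) A contributes 0. *)
Lemma split_decay (S : set V) (C : set (set V)) (Phi : nat -> set V -> R) (c : R) p A :
  (forall i A', C A' -> C (phi i @^-1` A')) ->
  (forall k A', C A' -> Phi k.+1 A' = n%:R^-1 * \sum_(i < n) Phi k (phi i @^-1` A')) ->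
  (forall A', C A' -> `|Phi 0 A'| <= c) ->
  (forall A', C A' -> S `<=` A' \/ S `<=` ~` A' -> Phi 0 A' = 0) ->
  C A ->
  (forall x, S x -> A (along_path phi p x)) \/ (forall x, S x -> ~ A (along_path phi p x)) ->
  `|Phi (size p) A| <= geom_rate R n (size p) * c.
Proof.
move=> Cphi PhiS Phic Phi0.
have le_c k A' : C A' -> `|Phi k A'| <= c.
  elim: k A' => [|k IH] A' CA'; first exact: Phic.
  rewrite PhiS// normrM ger0_norm ?(ltW nRV_gt0)// -[leRHS]average_cst.
  apply: le_trans (average_le (fun i => IH _ (Cphi i _ CA'))).
  by rewrite ler_pM2l ?nRV_gt0// ler_norm_sum.
(* Reading the word from its end: the path of [rcons p i] lies in A exactly when the path of p lies
   in the preimage of A by the i-th map. *)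
elim/last_ind: p A => [|p i IH] A CA hA.
  by rewrite /geom_rate expr0 invr1 subrr mul0r Phi0// normr0.
rewrite size_rcons PhiS// normrM ger0_norm ?(ltW nRV_gt0)//.
apply: (@le_trans _ _ (n%:R^-1 * \sum_(i < n) `|Phi (size p) (phi i @^-1` A)|)).
  by rewrite ler_pM2l ?nRV_gt0// ler_norm_sum.
apply: (@average_one_le _ i) => [j|]; first by apply: le_c; exact: Cphi.
apply: IH; first exact: Cphi.
have e x : along_path phi (rcons p i) x = phi i (along_path phi p x).
  by rewrite /along_path foldl_rcons.
by case: hA => h; [left|right] => x Sx; have := h x Sx; rewrite e.
Qed.

End markov_dual_theory.

(** * Oscillation of lower sets under two splitting words *)

Section splitting.
Context (R : realType) (n d : nat) (phi : 'I_n -> 'rV[R]_d -> 'rV[R]_d).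
Hypothesis n_gt0 : (0 < n)%N.
Local Notation V := 'rV[R]_d.
Local Notation U := (markov_dual phi).
Variables (S : set V) (alpha : {ffun 'I_d -> bool}) (p q : seq 'I_n) (x0 : V).
Hypothesis S_inv : preserved phi S.
Hypothesis phi_mono : forall i x y, S x -> S y -> le_sign alpha x y ->
  le_sign alpha (phi i x) (phi i y).
Hypothesis size_pq : size q = size p.
Hypothesis Sx0 : S x0.
Hypothesis p_below : forall x, S x -> le_sign alpha (along_path phi p x) x0.
Hypothesis q_above : forall x, S x -> le_sign alpha x0 (along_path phi q x).

(** Downward closed relative to S only, because the maps are known to be monotone there and not on
    the whole space. This makes the class stable under preimages by the maps. *)
Definition lower_set : set (set V) :=
  [set A | forall x y, S x -> S y -> le_sign alpha x y -> A y -> A x].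

Lemma lower_set_preimage i A : lower_set A -> lower_set (phi i @^-1` A).
Proof.
move=> hA x y Sx Sy xy /=; apply: hA; [exact: S_inv|exact: S_inv|exact: phi_mono].
Qed.

(** The pivot x0 lies above the image of p and below the image of q; the alternative is whether A
    contains x0. *)
Lemma lower_set_split A : lower_set A ->
  (forall x, S x -> A (along_path phi p x)) \/ (forall x, S x -> ~ A (along_path phi q x)).
Proof.
move=> hA; have [Ax0|nAx0] := pselect (A x0); [left|right] => x Sx.
  by apply: (hA _ x0) => //; [exact: preserved_path|exact: p_below].
move=> h; apply: nAx0; apply: (hA _ (along_path phi q x)) => //.
  exact: preserved_path.
exact: q_above.
Qed.

Lemma iterS_dual_indic k A x : iter k.+1 U (\1_A) x =
  n%:R^-1 * \sum_(i < n) iter k U (\1_(phi i @^-1` A)) x.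
Proof. by rewrite iterSr -iter_dual_sum; congr (iter k U _ x). Qed.

(** The induction runs over all lower sets at once, since a step replaces A by preimages. The
    remainder r makes the bound available at every time, not only at multiples of the word
    length. *)
Lemma lower_set_osc m r A x y : lower_set A -> S x -> S y ->
  `|iter (m * size p + r) U (\1_A) x - iter (m * size p + r) U (\1_A) y|
    <= geom_rate R n (size p) ^+ m.
Proof.
move=> + Sx Sy; elim: m A => [|m IH] A hA.
  have itv01 z : S z -> 0 <= iter (0 * size p + r) U (\1_A) z <= 1.
    move=> Sz; apply/andP; split.
      rewrite -(@iter_dual_cst _ _ _ phi n_gt0 (0 * size p + r) 0 z).
      by apply: (@iter_dual_le _ _ _ phi n_gt0 S) => // t _; exact: indic_ge0.
    rewrite -(@iter_dual_cst _ _ _ phi n_gt0 (0 * size p + r) 1 z).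
    by apply: (@iter_dual_le _ _ _ phi n_gt0 S) => // t _; exact: indic_le1.
  rewrite expr0 ler_norml; have := itv01 x Sx; have := itv01 y Sy; lra.
(* Shifted in time so that Phi 0 is bounded by the induction hypothesis; a further word length then
   gains one factor. *)
pose Phi k A := iter (m * size p + r + k) U (\1_A) x - iter (m * size p + r + k) U (\1_A) y.
have key w : (forall x, S x -> A (along_path phi w x)) \/ (forall x, S x -> ~ A (along_path phi w x)) ->
    `|Phi (size w) A| <= geom_rate R n (size w) * geom_rate R n (size p) ^+ m.
  move=> hw; apply: (@split_decay _ _ _ phi n_gt0 S lower_set Phi) => //.
  - by move=> i A'; exact: lower_set_preimage.
  - move=> k A' _; rewrite /Phi addnS !iterS_dual_indic -mulrBr; congr (_ * _).
    by rewrite -sumrB.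
  - by move=> A' hA'; rewrite /Phi addn0; exact: IH.
  - move=> A' _ [h|h]; rewrite /Phi.
      have h1 z : S z -> \1_A' z = 1 :> R by move=> /h; exact: indic_in.
      by rewrite !(iter_dual_cst_on _ _ S_inv h1)// subrr.
    have h0 z : S z -> \1_A' z = 0 :> R by move=> /h; exact: indic_out.
    by rewrite !(iter_dual_cst_on _ _ S_inv h0)// subrr.
rewrite mulSn -addnA addnC exprS.
have [h|h] := lower_set_split hA; first by apply: key; left.
by have := key q (or_intror h); rewrite size_pq.
Qed.

End splitting.

(** * Absorption probabilities *)

Section finite_sums.
Context (R : realType) (J : choiceType).

(** A single enumeration of M that serves real sums, extended real sums and the maximum
    simultaneously. *)
Lemma finite_sum_seq (M : set J) : finite_set M ->
  exists s : seq J, [/\ uniq s, (forall m, m \in s <-> M m),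
    (forall F : J -> R, \sum_(m \in M) F m = \sum_(m <- s) F m),
    (forall F : J -> \bar R, (\sum_(m \in M) F m = \sum_(m <- s) F m)%E) &
    (forall F : J -> nat, \big[maxn/0%N]_(m \in M) F m = \max_(m <- s) F m)].
Proof.
move=> Mf; exists (finmap.enum_fset (fset_set M)); split.
- exact: finmap.fset_uniq.
- move=> m; split => [|Mm]; first by rewrite in_fset_set// inE.
  by rewrite in_fset_set// inE.
- by move=> F; rewrite fsbig_finite.
- by move=> F; rewrite fsbig_finite.
- by move=> F; rewrite fsbig_finite.
Qed.

Lemma big_seq_single (s : seq J) (F : J -> R) m : uniq s -> m \in s ->
  (forall m', m' \in s -> m' != m -> F m' = 0) -> \sum_(m' <- s) F m' = F m.
Proof.
move=> us ms h; rewrite (bigD1_seq m)//= big_seq_cond big1 ?addr0//.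
by move=> m' /andP[]; exact: h.
Qed.

Lemma cvg_sum_seq T (F : set_system T) (FF : Filter F) (s : seq J) (f : J -> T -> R) (l : J -> R) :
  (forall m, m \in s -> f m x @[x --> F] --> l m) ->
  \sum_(m <- s) f m x @[x --> F] --> \sum_(m <- s) l m.
Proof.
elim: s => [|i s IH] hf.
  by rewrite big_nil; under eq_fun do rewrite big_nil; exact: cvg_cst.
rewrite big_cons; under eq_fun do rewrite big_cons; apply: cvgD.
  by apply: hf; rewrite inE eqxx.
by apply: IH => m ms; apply: hf; rewrite inE ms orbT.
Qed.

Lemma expr_small (r e : R) : 0 <= r -> r < 1 -> 0 < e -> exists k, r ^+ k <= e.
Proof.
move=> r0 r1 e0; have /cvgrPdist_le/(_ e e0)[k _ hk] : (fun k => r ^+ k) @ \oo --> (0 : R).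
  by apply: cvg_expr; rewrite ger0_norm.
exists k; have := hk k (leqnn k); rewrite sub0r normrN ger0_norm// exprn_ge0//.
Qed.

End finite_sums.

Section absorption.
Context (R : realType) (n d : nat) (phi : 'I_n -> 'rV[R]_d -> 'rV[R]_d).
Hypothesis n_gt0 : (0 < n)%N.
Local Notation V := 'rV[R]_d.
Local Notation U := (markov_dual phi).
Context (J : choiceType) (M : set J) (Tm : J -> set V) (I : set V) (l0 : nat).
Hypothesis phic : forall i, continuous (phi i).
Hypothesis I_inv : preserved phi I.
Hypothesis M_fin : finite_set M.
Hypothesis Tm_closed : forall m, M m -> closed (Tm m).
Hypothesis Tm_sub : forall m, M m -> Tm m `<=` I.
Hypothesis Tm_inv : forall m, M m -> preserved phi (Tm m).
Hypothesis Tm_disj : trivIset M Tm.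
Let T := \bigcup_(m in M) Tm m.
Let B := I `\` T.
Hypothesis reach : forall x, I x -> exists w, size w = l0 /\ T (along_path phi w x).
Local Notation rho0 := (geom_rate R n l0).

Lemma Tm_uniq m m' x : M m -> M m' -> Tm m x -> Tm m' x -> m = m'.
Proof. by move=> Mm Mm' h h'; apply: (Tm_disj Mm Mm'); exists x. Qed.

Lemma T_inv : preserved phi T.
Proof. by move=> i x [m Mm Tx]; exists m => //; exact: Tm_inv. Qed.

Lemma iter_B_T k x : T x -> iter k U (\1_B) x = 0.
Proof.
by apply: (iter_dual_cst_on n_gt0 _ T_inv) => y Ty; apply: indic_out => -[].
Qed.

Lemma iter_indic_ge0 k (A : set V) x : 0 <= iter k U (\1_A) x.
Proof.
rewrite -(iter_dual_cst phi n_gt0 k 0 x).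
by apply: (@iter_dual_le _ _ _ phi n_gt0 setT) => // y _; exact: indic_ge0.
Qed.

Lemma iter_indic_le1 k (A : set V) x : iter k U (\1_A) x <= 1.
Proof.
rewrite -(iter_dual_cst phi n_gt0 k 1 x).
by apply: (@iter_dual_le _ _ _ phi n_gt0 setT) => // y _; exact: indic_le1.
Qed.

(** Keeping the indicator on the right, rather than 1, lets the bound be iterated in time and
    integrated against any measure. *)
Lemma iter_l0_B x : I x -> iter l0 U (\1_B) x <= rho0 * \1_B x.
Proof.
move=> Ix; have [Tx|nTx] := pselect (T x).
  by rewrite iter_B_T// mulr_ge0 ?geom_rate_ge0// indic_ge0.
have [w [<- hw]] := reach Ix; rewrite (indic_in R (_ : B x))//.
apply: (@iter_dual_path_le _ _ _ phi n_gt0 I) => //.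
by rewrite indic_out// => -[].
Qed.

Lemma iter_B_le k x : I x -> iter k U (\1_B) x <= rho0 ^+ (k %/ l0).
Proof.
rewrite {1}(divn_eq k l0) => Ix; elim: (k %/ l0)%N => [|q IH].
  by rewrite expr0 iter_indic_le1.
rewrite mulSn -addnA addnC iterD exprS.
apply: (@le_trans _ _ (iter (q * l0 + k %% l0) U (fun y => rho0 * \1_B y) x)).
  by apply: (@iter_dual_le _ _ _ phi n_gt0 I) => // y; exact: iter_l0_B.
by rewrite iter_dualZ ler_wpM2l// geom_rate_ge0.
Qed.

(** A trapped set is never left, so the probability of being in it can only grow with time. *)
Lemma iter_Tm_homo m x : M m ->
  {homo (fun k => iter k U (\1_(Tm m)) x) : a b / (a <= b)%N >-> a <= b}.
Proof.
move=> Mm; apply/nondecreasing_seqP => k; rewrite iterSr.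
apply: (@iter_dual_le _ _ _ phi n_gt0 setT) => // y _.
have [Ty|nTy] := pselect (Tm m y); last first.
  by rewrite (indic_out _ nTy); exact: (@iter_indic_ge0 1).
suff -> : U (\1_(Tm m)) y = 1 by exact: indic_le1.
by apply: (@iter_dual_cst_on _ _ _ phi n_gt0 (Tm m) 1) => //; [exact: Tm_inv|exact: indic_in].
Qed.

Definition absorption_prob (m : J) (x : V) : R := limn (fun k => iter k U (\1_(Tm m)) x).
Local Notation g := absorption_prob.

Lemma absorption_cvg m x : M m -> (fun k => iter k U (\1_(Tm m)) x) @ \oo --> g m x.
Proof.
move=> Mm; apply: nondecreasing_is_cvgn; first exact: iter_Tm_homo.
by exists 1 => _ [k _ <-]; exact: iter_indic_le1.
Qed.

Lemma iter_le_absorption m k x : M m -> iter k U (\1_(Tm m)) x <= g m x.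
Proof.
move=> Mm; apply: (nondecreasing_cvgn_le (iter_Tm_homo x Mm)).
exact: absorption_cvg.
Qed.

Lemma absorption_ge0 m x : M m -> 0 <= g m x.
Proof. by move=> Mm; apply: le_trans (iter_le_absorption 0 x Mm); exact: indic_ge0. Qed.

Lemma absorption_le1 m x : M m -> g m x <= 1.
Proof.
move=> Mm; apply: limr_le; first exact: absorption_cvg.
by apply: nearW => k; exact: iter_indic_le1.
Qed.

Lemma absorption_harmonic m x : M m -> U (g m) x = g m x.
Proof.
move=> Mm; have h1 := @absorption_cvg m x Mm; rewrite -cvg_shiftS in h1.
have h2 : (fun k => iter k.+1 U (\1_(Tm m)) x) @ \oo --> U (g m) x.
  apply: cvgM; first exact: cvg_cst.
  by apply: cvg_sum_ord => i; exact: absorption_cvg.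
by rewrite -(cvg_lim (@Rhausdorff R) h1); apply/esym; exact: (cvg_lim (@Rhausdorff R) h2).
Qed.

Lemma absorption_in m x : M m -> Tm m x -> g m x = 1.
Proof.
move=> Mm Tx; apply/eqP; rewrite eq_le absorption_le1//=.
by rewrite -{1}(indic_in R Tx); exact: (@iter_le_absorption m 0).
Qed.

Lemma iter_Tm_other m m' k x : M m -> M m' -> m' <> m -> Tm m' x ->
  iter k U (\1_(Tm m)) x = 0.
Proof.
move=> Mm Mm' mm' Tx; apply: (@iter_dual_cst_on _ _ _ phi n_gt0 (Tm m')) => //.
  exact: Tm_inv.
by move=> y T'y; apply: indic_out => Ty; apply: mm'; exact: (Tm_uniq Mm' Mm T'y).
Qed.

Lemma absorption_other m m' x : M m -> M m' -> m' <> m -> Tm m' x -> g m x = 0.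
Proof.
move=> Mm Mm' mm' Tx; rewrite /absorption_prob.
under eq_fun do rewrite (iter_Tm_other _ Mm Mm' mm' Tx).
exact: lim_cst.
Qed.

Lemma iter_harmonic k h x : (forall y, I y -> U h y = h y) -> I x -> iter k U h x = h x.
Proof.
move=> hh; elim: k x => // k IH x Ix; rewrite iterSr -[RHS]IH//.
by apply: (@eq_iter_dual _ _ _ phi n_gt0 I).
Qed.

Lemma indic_B_sum x (s : seq J) : uniq s -> (forall m, m \in s <-> M m) -> I x ->
  \sum_(m <- s) \1_(Tm m) x = 1 - \1_B x :> R.
Proof.
move=> us sM Ix; have [[m Mm Tx]|nTx] := pselect (T x).
  rewrite (@big_seq_single _ _ s _ m)//; last first.
  - move=> m' /sM Mm' m'm; apply: indic_out => T'x; case/eqP: m'm.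
    exact: (Tm_uniq Mm' Mm T'x).
  - exact/sM.
  by rewrite indic_in// indic_out ?subr0// => -[_]; apply; exists m.
rewrite (indic_in R (_ : B x))// subrr big_seq big1// => m /sM Mm.
by apply: indic_out => Tx; apply: nTx; exists m.
Qed.

Lemma iter_dual_sum_seq k (s : seq J) (h : J -> V -> R) x :
  iter k U (fun y => \sum_(m <- s) h m y) x = \sum_(m <- s) iter k U (h m) x.
Proof.
elim: s => [|m s IH].
  rewrite big_nil -[RHS](iter_dual_cst phi n_gt0 k 0 x); congr (iter k U _ x).
  by apply/funext => y; rewrite big_nil.
rewrite big_cons -IH -iter_dualD; congr (iter k U _ x).
by apply/funext => y; rewrite big_cons.
Qed.

Lemma iter_Tm_sum k x (s : seq J) : uniq s -> (forall m, m \in s <-> M m) -> I x ->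
  \sum_(m <- s) iter k U (\1_(Tm m)) x = 1 - iter k U (\1_B) x.
Proof.
move=> us sM Ix; rewrite -iter_dual_sum_seq -[X in X - _](iter_dual_cst phi n_gt0 k 1 x) -iter_dualB.
by apply: (@eq_iter_dual _ _ _ phi n_gt0 I) => // y; exact: indic_B_sum.
Qed.

Hypothesis l0_gt0 : (0 < l0)%N.

Lemma iter_B_cvg0 x : I x -> (fun k => iter k U (\1_B) x) @ \oo --> (0 : R).
Proof.
move=> Ix; apply/cvgrPdist_le => e e0.
have [q hq] := expr_small (geom_rate_ge0 R n_gt0 l0) (geom_rate_lt1 R n_gt0 l0) e0.
exists (q * l0)%N => // k /= hk; rewrite sub0r normrN ger0_norm ?iter_indic_ge0//.
apply: le_trans (iter_B_le k Ix) _; apply: le_trans hq.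
apply: ler_wiXn2l; rewrite ?geom_rate_ge0 ?(ltW (geom_rate_lt1 _ _ _))//.
by rewrite leq_divRL.
Qed.

Lemma absorption_sum x (s : seq J) : uniq s -> (forall m, m \in s <-> M m) -> I x ->
  \sum_(m <- s) g m x = 1.
Proof.
move=> us sM Ix.
have h1 : (fun k => \sum_(m <- s) iter k U (\1_(Tm m)) x) @ \oo --> \sum_(m <- s) g m x.
  by apply: cvg_sum_seq => m /sM Mm; exact: absorption_cvg.
have h2 : (fun k => \sum_(m <- s) iter k U (\1_(Tm m)) x) @ \oo --> (1 - 0 : R).
  under eq_fun do rewrite iter_Tm_sum//.
  by apply: cvgB; [exact: cvg_cst|exact: iter_B_cvg0].
rewrite -(cvg_lim (@Rhausdorff R) h1) (cvg_lim (@Rhausdorff R) h2).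
by rewrite subr0.
Qed.

Lemma harmonic_close h1 h2 k x : (forall y, I y -> `|h1 y - h2 y| <= \1_B y) -> I x ->
  `|iter k U h1 x - iter k U h2 x| <= rho0 ^+ (k %/ l0).
Proof.
move=> h Ix; rewrite -iter_dualB; apply: le_trans (iter_B_le k Ix).
exact: (@iter_dual_norm_le _ _ _ phi n_gt0 I).
Qed.

Lemma harmonic_uniq h1 h2 x : (forall y, I y -> U h1 y = h1 y) ->
  (forall y, I y -> U h2 y = h2 y) -> (forall y, I y -> `|h1 y - h2 y| <= \1_B y) ->
  I x -> h1 x = h2 x.
Proof.
move=> u1 u2 h Ix; apply/eqP; rewrite -subr_eq0 -normr_le0; apply/ler_addgt0Pl => e e0.
rewrite addr0.
have [q hq] := expr_small (geom_rate_ge0 R n_gt0 l0) (geom_rate_lt1 R n_gt0 l0) e0.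
rewrite -(iter_harmonic (q * l0) u1)// -(iter_harmonic (q * l0) u2)//.
by apply: le_trans (harmonic_close (q * l0) h Ix) _; rewrite mulnK.
Qed.

Lemma continuous_iter k h : continuous h -> continuous (iter k U h).
Proof.
move=> hc; elim: k => //= k IH x; rewrite /markov_dual.
apply: (@continuous_comp _ _ _ (fun y => \sum_(i < n) iter k U h (phi i y))
  (fun z : R => n%:R^-1 * z)); last by apply: cvgM; [exact: cvg_cst|exact: cvg_id].
apply: (@cvg_sum_ord _ _ (nbhs x)) => i.
apply: (@continuous_comp _ _ _ (phi i) (iter k U h)); [exact: phic|exact: IH].
Qed.

(** Indicators are not continuous, so the iteration starts from a Urysohn function, 1 on [Tm m] and
    0 on the other trapping sets. It differs from g only on B, so its continuous iterates converge
    to the harmonic g uniformly on I. *)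
Lemma absorption_continuous m : M m -> {within I, continuous (g m)}.
Proof.
move=> Mm; pose T' := \bigcup_(m' in M `\ m) Tm m'.
have T'c : closed T'.
  apply: closed_bigcup; first exact: finite_setD.
  by move=> m' [Mm' _]; exact: Tm_closed.
have T'T : T' `&` Tm m = set0.
  apply/seteqP; split => // x [[m' [Mm' m'm] T'x] Tx]; apply: m'm.
  exact: (Tm_uniq Mm' Mm T'x).
have sep := normal_uniform_separator (@pseudometric_normal R _) T'c (Tm_closed Mm) T'T.
pose g0 : V -> R := Urysohn T' (Tm m).
have g0T' x : T' x -> g0 x = 0.
  by move=> T'x; apply: (@Urysohn_sub0 _ R _ _ sep); exists x.
have g0T x : Tm m x -> g0 x = 1.
  by move=> Tx; apply: (@Urysohn_sub1 _ R _ _ sep); exists x.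
have g001 x : 0 <= g0 x <= 1.
  have : range g0 (g0 x) by exists x.
  by move=> /Urysohn_range; rewrite /= in_itv.
have close y : I y -> `|g m y - g0 y| <= \1_B y.
  move=> Iy; have [[m' Mm' T'y]|nTy] := pselect (T y).
    suff -> : g m y = g0 y by rewrite subrr normr0 indic_ge0.
    have [e|m'm] := pselect (m' = m).
      by rewrite e in T'y; rewrite absorption_in// g0T.
    by rewrite (absorption_other Mm Mm')// g0T'//; exists m'.
  rewrite (indic_in R (_ : B y))// ler_norml.
  by have := g001 y; have := absorption_ge0 y Mm; have := absorption_le1 y Mm; lra.
apply/subspace_continuousP => x Ix; apply/cvgrPdist_le => e e0.
have e3 : 0 < e / 3 by rewrite divr_gt0.
have [q hq] := expr_small (geom_rate_ge0 R n_gt0 l0) (geom_rate_lt1 R n_gt0 l0) e3.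
have hG y : I y -> `|g m y - iter (q * l0) U g0 y| <= e / 3.
  move=> Iy; rewrite -{1}(@iter_harmonic (q * l0) (g m) y)//; last first.
    by move=> z _; exact: absorption_harmonic.
  by apply: le_trans (harmonic_close (q * l0) close Iy) _; rewrite mulnK.
have Gc := @continuous_iter (q * l0) g0 (@Urysohn_continuous _ R _ _) x.
have /cvgrPdist_le/(_ _ e3) hx := Gc.
near=> y.
have Iy : I y by near: y; exact: withinT.
have h1 : `|iter (q * l0) U g0 x - iter (q * l0) U g0 y| <= e / 3.
  by near: y; exact: cvg_within.
rewrite -[leLHS]/(`|g m x - g m y|).
have := hG x Ix; have := hG y Iy; move: h1; rewrite !ler_norml; lra.
Unshelve. all: by end_near.
Qed.

(** Condition on time s. Paths already in [Tm m] have t steps left to mix, with error delta; paths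
    absorbed only later have probability g minus the probability of being in [Tm m] at time s, and
    count entirely as error. *)
Lemma absorption_main m s t (A : set V) (c delta : R) x : M m -> I x ->
  0 <= c <= 1 -> 0 <= delta ->
  (forall y, Tm m y -> `|iter t U (\1_A) y - c| <= delta) ->
  `|iter (s + t) U (\1_(A `&` Tm m)) x - g m x * c| <=
    delta * iter s U (\1_(Tm m)) x + (g m x - iter s U (\1_(Tm m)) x).
Proof.
move=> Mm Ix /andP[c0 c1] d0 hA; rewrite iterD.
set v := iter t U _.
have v0 y : 0 <= v y by exact: iter_indic_ge0.
have vg y : v y <= g m y.
  apply: le_trans (iter_le_absorption t y Mm).
  apply: (@iter_dual_le _ _ _ phi n_gt0 setT) => // z _.
  have [Tz|nTz] := pselect (Tm m z); first by rewrite (indic_in R Tz) indic_le1.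
  by rewrite !indic_out// => -[].
have vT y : Tm m y -> v y = iter t U (\1_A) y.
  move=> Ty; apply: (@eq_iter_dual _ _ _ phi n_gt0 (Tm m)) => //; first exact: Tm_inv.
  move=> z Tz; have [Az|nAz] := pselect (A z); first by rewrite !indic_in.
  by rewrite !indic_out// => -[].
(* The last term vanishes on [Tm m] and equals g, which dominates v, elsewhere; being harmonic, g
   passes unchanged through the s outer steps. *)
have up y : I y -> v y <= (c + delta) * \1_(Tm m) y + (g m y - \1_(Tm m) y).
  move=> Iy; have [Ty|nTy] := pselect (Tm m y).
    rewrite (absorption_in Mm Ty) (indic_in R Ty) subrr addr0 mulr1 vT//.
    by have := hA y Ty; rewrite ler_norml; lra.
  by rewrite (indic_out R nTy) mulr0 add0r subr0.
have low y : I y -> (c - delta) * \1_(Tm m) y <= v y.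
  move=> Iy; have [Ty|nTy] := pselect (Tm m y).
    rewrite (indic_in R Ty) mulr1 vT//.
    by have := hA y Ty; rewrite ler_norml; lra.
  by rewrite (indic_out R nTy) mulr0.
have := @iter_dual_le _ _ _ phi n_gt0 I s _ _ I_inv up x Ix.
rewrite iter_dualD iter_dualZ iter_dualB.
rewrite (@iter_harmonic s (g m) x)//; last by move=> z _; exact: absorption_harmonic.
have := @iter_dual_le _ _ _ phi n_gt0 I s _ _ I_inv low x Ix.
rewrite iter_dualZ.
have := iter_le_absorption s x Mm; have := @iter_indic_ge0 s (Tm m) x.
set a := iter s U (\1_(Tm m)) x; set b := iter s U v x; set G := g m x.
move=> a0 aG h1 h2; rewrite ler_norml; apply/andP; split; nra.
Qed.

End absorption.

(** * Convergence inside one trapping set *)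

Section probabilities.
Context (R : realType) (d : nat).
Implicit Types (mu nu : probRV R d) (A S : set 'rV[R]_d).

Definition pr mu A : R := fine (mu A).

Lemma prE mu A : borel_set A -> mu A = (pr mu A)%:E.
Proof. by move=> mA; rewrite /pr fineK// fin_num_measure. Qed.

Lemma pr_ge0 mu A : 0 <= pr mu A.
Proof. by rewrite fine_ge0. Qed.

Lemma pr_le1 mu A : borel_set A -> pr mu A <= 1.
Proof. by move=> mA; rewrite -lee_fin -prE//; exact: probability_le1. Qed.

Lemma pr_sub1 mu S A : borel_set S -> borel_set A -> mu S = 1%E -> S `<=` A -> mu A = 1%E.
Proof.
move=> mS mA S1 SA; apply/eqP; rewrite eq_le; apply/andP; split; first exact: probability_le1.
by rewrite -S1; apply: le_measure; rewrite ?inE.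
Qed.

Lemma pr_out0 mu S A : borel_set S -> borel_set A -> mu S = 1%E -> S `<=` ~` A -> mu A = 0%E.
Proof.
move=> mS mA S1 SA; have := probability_setC mu mS; rewrite S1 subee// => S0.
apply/eqP; rewrite eq_le measure_ge0 andbT -S0.
apply: le_measure; rewrite ?inE//; first exact: measurableC.
by move=> x Ax Sx; exact: (SA x Sx).
Qed.

Lemma ereal_sup_le (E : set (\bar R)) (c : \bar R) : (forall x, E x -> (x <= c)%E) -> (ereal_sup E <= c)%E.
Proof. by move=> h; apply: ge_ereal_sup. Qed.

End probabilities.

Section sink.
Context (R : realType) (n d : nat) (phi : 'I_n -> 'rV[R]_d -> 'rV[R]_d).
Hypothesis n_gt0 : (0 < n)%N.
Local Notation V := 'rV[R]_d.
Local Notation U := (markov_dual phi).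
Local Notation P := (markov_op phi).
Hypothesis phic : forall i, continuous (phi i).

Lemma iter_invariant (nu : probRV R d) k A : invariant_measure phi nu ->
  borel_set A -> iter k P nu A = nu A.
Proof.
move=> hnu; elim: k A => //= k IH A mA; rewrite -[RHS]hnu// /markov_op.
by congr (_ * _)%E; apply: eq_bigr => i _; apply: IH; exact: borel_preimage.
Qed.

Lemma pr_invariant (nu : probRV R d) A : invariant_measure phi nu -> borel_set A ->
  pr nu A = n%:R^-1 * \sum_(i < n) pr nu (phi i @^-1` A).
Proof.
move=> hnu mA; rewrite {1}/pr -hnu// /markov_op.
rewrite (eq_bigr (fun i => (pr nu (phi i @^-1` A))%:E)); last first.
  by move=> i _; apply: prE; exact: borel_preimage.
by rewrite sumEFin -EFinM.
Qed.

Variables (S I : set V) (alpha : {ffun 'I_d -> bool}) (p q : seq 'I_n) (x0 : V).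
Hypothesis S_closed : closed S.
Hypothesis SI : S `<=` I.
Hypothesis S_inv : preserved phi S.
Hypothesis phi_mono : forall i x y, S x -> S y -> le_sign alpha x y ->
  le_sign alpha (phi i x) (phi i y).
Hypothesis size_pq : size q = size p.
Hypothesis size_p : (0 < size p)%N.
Hypothesis Sx0 : S x0.
Hypothesis p_below : forall x, S x -> le_sign alpha (along_path phi p x) x0.
Hypothesis q_above : forall x, S x -> le_sign alpha x0 (along_path phi q x).
Variable mustar : probRV R d.
Hypothesis mustar_S : mustar S = 1%E.
Hypothesis mustar_inv : invariant_measure phi mustar.

Let mS : borel_set S. Proof. exact: borel_closed. Qed.
Local Notation rho := (geom_rate R n (size p)).

Let biter k A : borel_set A -> bounded_borel S (iter k U (\1_A)).
Proof. by move=> mA; apply: bounded_borel_iter => //; exact: bounded_borel_indic. Qed.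

(** By invariance the stationary mass of A is the stationary mean of the k-step hitting probability,
    so the difference is an average of oscillations on S. *)
Lemma sink_pointwise k A x : borel_set A -> lower_set S alpha A -> S x ->
  `|iter k U (\1_A) x - pr mustar A| <= rho ^+ (k %/ size p).
Proof.
move=> mA hA Sx.
have -> : pr mustar A = mean S mustar (iter k U (\1_A)).
  have := iter_invariant k mustar_inv mA; rewrite (@iter_markov_mean _ _ _ S)//.
  by rewrite (prE _ mA) => -[].
rewrite -{1}(@mean_cst _ _ S S_closed mustar (iter k U (\1_A) x))// -meanB//; last 2 first.
- exact: bounded_borel_cst.
- exact: biter.
rewrite -[leRHS](@mean_cst _ _ S S_closed mustar)//.
apply: mean_norm_le => //.
- by apply: bounded_borelB => //; [exact: bounded_borel_cst|exact: biter].
- exact: bounded_borel_cst.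
move=> y Sy; rewrite {1 2}(divn_eq k (size p)).
exact: (lower_set_osc n_gt0 S_inv phi_mono size_pq Sx0 p_below q_above).
Qed.

Lemma sink_measure (mu : probRV R d) k A : mu S = 1%E -> borel_set A -> lower_set S alpha A ->
  (`|iter k P mu A - mustar A| <= (rho ^+ (k %/ size p))%:E)%E.
Proof.
move=> S1 mA hA; rewrite (@iter_markov_mean _ _ _ S)// (prE _ mA) -EFinB abse_EFin lee_fin.
rewrite -{1}(@mean_cst _ _ S S_closed mu (pr mustar A))// -meanB//; last 2 first.
- exact: biter.
- exact: bounded_borel_cst.
rewrite -[leRHS](@mean_cst _ _ S S_closed mu)//.
apply: mean_norm_le => //.
- by apply: bounded_borelB => //; [exact: biter|exact: bounded_borel_cst].
- exact: bounded_borel_cst.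
by move=> y Sy; exact: sink_pointwise.
Qed.

Lemma orthant_lower c : lower_set S alpha (orthant alpha c).
Proof.
by move=> x y _ _; exact: le_sign_trans.
Qed.

Lemma sink_unique (nu : probRV R d) : nu S = 1%E -> invariant_measure phi nu ->
  same_measure nu mustar.
Proof.
move=> nuS nu_inv; apply: (@orthant_measure_unique _ _ alpha).
  exact: (le_lt_trans (probability_le1 nu measurableT) (ltry _)).
move=> c; have mc : borel_set (orthant alpha c) by apply: borel_closed; exact: closed_orthant.
suff e : pr nu (orthant alpha c) = pr mustar (orthant alpha c).
  by transitivity (pr nu (orthant alpha c))%:E; [exact: prE|rewrite e -prE].
apply/eqP; rewrite -subr_eq0 -normr_le0.
apply/ler_addgt0Pl => e e0; rewrite addr0.
have [m hm] := expr_small (geom_rate_ge0 R n_gt0 (size p)) (geom_rate_lt1 R n_gt0 (size p)) e0.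
apply: le_trans hm; have := sink_measure (m * size p) nuS mc (@orthant_lower c).
by rewrite iter_invariant// !(prE _ mc) -EFinB abse_EFin lee_fin mulnK.
Qed.

Lemma Afamily_closed (A : set V) : Afamily alpha A -> closed A.
Proof.
move=> [gamma [c [gc _ ->]]]; rewrite -[X in closed X]/(gamma @^-1` orthant alpha c).
by apply: preimage_closed => [x _|]; [exact: gc|exact: closed_orthant].
Qed.

Lemma Afamily_lower (A : set V) : Afamily alpha A -> lower_set S alpha A.
Proof.
move=> [gamma [c [_ gm ->]]] x y Sx Sy xy /= yc.
exact: le_sign_trans (gm _ _ xy) yc.
Qed.

Lemma lower_setI_super A : lower_set S alpha A -> lower_set S alpha (A `&` I).
Proof. by move=> hA x y Sx Sy xy [Ay _]; split; [exact: (hA x y)|exact: SI]. Qed.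

Lemma sink_d_sign (mu : probRV R d) k : closed I -> mu S = 1%E ->
  (d_sign I alpha (iter k P mu) mustar <= (rho ^+ (k %/ size p))%:E)%E.
Proof.
move=> Ic muS; apply: ereal_sup_le => _ [A hA <-].
apply: sink_measure => //; last by apply: lower_setI_super; exact: Afamily_lower.
by apply: borel_closed; apply: closedI => //; exact: Afamily_closed hA.
Qed.

End sink.

(** * Contraction of [d_F] in dimension one *)

Section sink_d_F.
Context (R : realType) (n d : nat) (phi : 'I_n -> 'rV[R]_d -> 'rV[R]_d).
Hypothesis n_gt0 : (0 < n)%N.
Hypothesis d1 : d = 1%N.
Local Notation V := 'rV[R]_d.
Local Notation P := (markov_op phi).
Hypothesis phic : forall i, continuous (phi i).
Variables (S I : set V) (alpha : {ffun 'I_d -> bool}) (p q : seq 'I_n) (x0 : V).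
Hypothesis S_closed : closed S.
Hypothesis SI : S `<=` I.
Hypothesis S_inv : preserved phi S.
Hypothesis I_inv : preserved phi I.
Hypothesis I_compact : compact I.
Hypothesis alpha0 : forall j, alpha j = false.
Hypothesis phi_mono : forall i x y, I x -> I y -> le_sign alpha x y ->
  le_sign alpha (phi i x) (phi i y).
Hypothesis size_pq : size q = size p.
Hypothesis Sx0 : S x0.
Hypothesis p_below : forall x, S x -> le_sign alpha (along_path phi p x) x0.
Hypothesis q_above : forall x, S x -> le_sign alpha x0 (along_path phi q x).
Variable mustar : probRV R d.
Hypothesis mustar_S : mustar S = 1%E.
Hypothesis mustar_inv : invariant_measure phi mustar.
Local Notation rho := (geom_rate R n (size p)).

Lemma le_signE0 (x y : V) : le_sign alpha x y <-> forall j, x 0 j <= y 0 j.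
Proof. by split=> h j; have := h j; rewrite alpha0 expr0 mul1r subr_ge0. Qed.

Let I_closed : closed I.
Proof. by apply: compact_closed => //; exact: norm_hausdorff. Qed.

Lemma lower_box_closed x : closed (lower_box I x).
Proof.
rewrite (_ : lower_box I x = I `&` \bigcap_j [set y | (y : V) 0 j <= x 0 j]).
  apply: closedI => //; apply: closed_bigI => j _.
  rewrite -[X in closed X]/((fun y : V => y 0 j) @^-1` [set z | z <= x 0 j]).
  by apply: preimage_closed => [y _|]; [exact: coord_continuous|exact: closed_le].
by apply/seteqP; split => [y [Iy h]|y [Iy h]]; split => // j; [move=> _; exact: h|exact: h].
Qed.

Lemma lower_box_lower x : lower_set S alpha (lower_box I x).
Proof.
move=> y z Sy Sz /le_signE0 yz [_ zx]; split; first exact: SI.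
by move=> j; apply: le_trans (yz j) (zx j).
Qed.

(** Sets whose trace on I is an initial segment or empty. Unlike general lower sets these are
    measured by [d_F], so [split_decay] can start from the distance itself instead of 1. *)
Let C : set (set V) := [set A | borel_set A /\
  ((exists2 x, I x & A `&` I = lower_box I x) \/ A `&` I = set0)].

(** A nonempty trace of the preimage is compact, so it has a largest point z; monotonicity of the
    map puts all of I below z into it. *)
Let C_preimage i A : C A -> C (phi i @^-1` A).
Proof.
move=> [mA hA]; split; first exact: borel_preimage.
have [[y [/= Ay Iy]]|/set0P/negP] := pselect ((phi i @^-1` A) `&` I !=set0); last first.
  by rewrite negbK => /eqP; right.
left; case: hA => [[x Ix xE]|h0]; last first.
  have : (A `&` I) (phi i y) by split => //; exact: I_inv.
  by rewrite h0.
have AE : (phi i @^-1` A) `&` I = (phi i @^-1` lower_box I x) `&` I.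
  apply/seteqP; split => z [/= Az Iz]; split => //=.
    by rewrite -xE; split => //; exact: I_inv.
  by move: Az; rewrite -xE => -[].
have Ec : compact ((phi i @^-1` A) `&` I).
  rewrite AE setIC; apply: compact_closedI => //; apply: preimage_closed => [z _|].
    exact: phic.
  exact: lower_box_closed.
have [j0] : exists j0 : 'I_d, true by rewrite d1; exists ord0.
move=> _; have ord_uniq (j : 'I_d) : j = j0.
  by apply: val_inj; case: j j0 => [a ha] [b hb] /=; rewrite d1 !ltnS !leqn0 in ha hb *; rewrite
    (eqP ha) (eqP hb).
have [z + zmax] := @EVT_max_rV R d (fun z => z 0 j0) _ (ex_intro _ y (conj Ay Iy)) Ec
  (continuous_subspaceT (fun z => @coord_continuous R 1 d 0 j0 z)).
rewrite inE => -[/= Az Iz]; exists z => //; apply/seteqP; split => t.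
  move=> ht; split; first by case: ht.
  by move=> j; rewrite (ord_uniq j); apply: zmax; rewrite inE.
move=> [It tz]; split => //=.
have : (A `&` I) (phi i z) by split => //; exact: I_inv.
rewrite xE => -[_ zx].
have : lower_box I x (phi i t).
  split; first exact: I_inv.
  have /le_signE0 h : le_sign alpha (phi i t) (phi i z) by apply: phi_mono => //; apply/le_signE0.
  by move=> j; apply: le_trans (h j) (zx j).
by rewrite -xE => -[].
Qed.

(** [split_decay] is applied to the difference of P^k mu and the stationary measure; at k = 0 it
    vanishes on sets containing S or missing S, as both measures give S mass 1. *)
Lemma sink_d_F (mu : probRV R d) : mu S = 1%E ->
  (d_F I (iter (size p) P mu) mustar <= rho%:E * d_F I mu mustar)%E.
Proof.
move=> muS; have mS : borel_set S by exact: borel_closed.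
have mI : borel_set I by exact: borel_closed.
have muI : mu I = 1%E by exact: (pr_sub1 mS).
have mustarI : mustar I = 1%E by exact: (pr_sub1 mS).
have dF0 : (0 <= d_F I mu mustar)%E.
  apply: (@le_trans _ _ `|mu (lower_box I x0) - mustar (lower_box I x0)|%E); first exact: abse_ge0.
  by apply: ereal_sup_ubound; exists x0 => //; exact: SI.
have dF1 : (d_F I mu mustar <= 1)%E.
  apply: ereal_sup_le => _ [x Ix <-].
  have mx := borel_closed (@lower_box_closed x).
  rewrite !(prE _ mx) -EFinB abse_EFin lee_fin.
  have := pr_ge0 mu (lower_box I x); have := pr_ge0 mustar (lower_box I x).
  have := pr_le1 mu mx; have := pr_le1 mustar mx; rewrite ler_norml; lra.
(* The distance is at most 1, hence finite, and can serve as the real constant of [split_decay]. *)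
have dFE : d_F I mu mustar = (fine (d_F I mu mustar))%:E.
  by rewrite fineK// ge0_fin_numE// (le_lt_trans dF1)// ltry.
apply: ereal_sup_le => _ [x Ix <-].
have mx := borel_closed (@lower_box_closed x).
have iterE k A : borel_set A -> iter k P mu A = (fine (iter k P mu A))%:E.
  by move=> mA; rewrite (@iter_markov_mean _ _ _ I).
pose Phi k A := fine (iter k P mu A) - pr mustar A.
have key w : (forall y, S y -> lower_box I x (along_path phi w y)) \/
    (forall y, S y -> ~ lower_box I x (along_path phi w y)) ->
    `|Phi (size w) (lower_box I x)| <= geom_rate R n (size w) * fine (d_F I mu mustar).
  move=> hw; apply: (@split_decay _ _ _ phi n_gt0 S C Phi) => //.
  - move=> k A [mA _]; rewrite /Phi (pr_invariant phic mustar_inv mA) sumrB mulrBr; congr (_ - _).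
    rewrite /= {1}/markov_op (eq_bigr (fun i => (fine (iter k P mu (phi i @^-1` A)))%:E)).
      by rewrite sumEFin -EFinM.
    by move=> i _; apply: iterE; exact: borel_preimage.
  - move=> A [mA [[y Iy yE]|h0]]; rewrite /Phi /=; last first.
      rewrite /pr -(prob1_setI I_closed muI mA) -(prob1_setI I_closed mustarI mA).
      by rewrite h0 !measure0 subrr normr0 fine_ge0.
    rewrite /pr -(prob1_setI I_closed muI mA) -(prob1_setI I_closed mustarI mA) yE.
    have my := borel_closed (@lower_box_closed y).
    rewrite -lee_fin -dFE -abse_EFin EFinB -!prE//.
    by apply: ereal_sup_ubound; exists y.
  - move=> A [mA _] [SA|SA]; rewrite /Phi /pr /=.
      by rewrite (pr_sub1 mS mA muS SA) (pr_sub1 mS mA mustar_S SA) subrr.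
    by rewrite (pr_out0 mS mA muS SA) (pr_out0 mS mA mustar_S SA) subrr.
  - split => //; left; exists x => //; apply/setIidPl; by move=> y [].
rewrite iterE// (prE _ mx) -EFinB abse_EFin dFE -EFinM lee_fin.
have mono' i y z : S y -> S z -> le_sign alpha y z -> le_sign alpha (phi i y) (phi i z).
  by move=> Sy Sz; apply: phi_mono; exact: SI.
have [h|h] := lower_set_split S_inv Sx0 p_below q_above (@lower_box_lower x).
  by apply: key; left.
by have := key q (or_intror h); rewrite size_pq.
Qed.

End sink_d_F.

(** * Convergence on the whole state space *)

Lemma mnormalizeE d (T : measurableType d) (R : realType)
    (mu : {measure set T -> \bar R}) (P : probability T R) A (c : R) :
  mu setT = c%:E -> 0 < c -> mnormalize mu P A = (mu A * (c^-1)%:E)%E.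
Proof. by move=> h c0; rewrite /mnormalize h eqe gt_eqF. Qed.

Section global.
Context (R : realType) (n d : nat) (phi : 'I_n -> 'rV[R]_d -> 'rV[R]_d).
Hypothesis n_gt0 : (0 < n)%N.
Local Notation V := 'rV[R]_d.
Local Notation U := (markov_dual phi).
Local Notation P := (markov_op phi).
Context (J : choiceType) (M : set J) (Tm : J -> set V) (I : set V) (l0 : nat).
Hypothesis phic : forall i, continuous (phi i).
Hypothesis I_closed : closed I.
Hypothesis I_inv : preserved phi I.
Hypothesis M_fin : finite_set M.
Hypothesis Tm_closed : forall m, M m -> closed (Tm m).
Hypothesis Tm_sub : forall m, M m -> Tm m `<=` I.
Hypothesis Tm_inv : forall m, M m -> preserved phi (Tm m).
Hypothesis Tm_disj : trivIset M Tm.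
Let T := \bigcup_(m in M) Tm m.
Let B := I `\` T.
Hypothesis reach : forall x, I x -> exists w, size w = l0 /\ T (along_path phi w x).
Hypothesis l0_gt0 : (0 < l0)%N.
Local Notation g := (absorption_prob phi Tm).
Local Notation rho0 := (geom_rate R n l0).

(** [low m] abstracts the class of sets on which mixing in [Tm m] is controlled; lower sets are
    substituted for it later. *)
Variables (mustar : J -> probRV R d) (lm : J -> nat) (low : J -> set (set V)).
Hypothesis mustar1 : forall m, M m -> mustar m (Tm m) = 1%E.
Hypothesis mustar_inv : forall m, M m -> invariant_measure phi (mustar m).
Hypothesis mustar_uniq : forall m (nu : probRV R d), M m -> nu (Tm m) = 1%E ->
  invariant_measure phi nu -> same_measure nu (mustar m).
Hypothesis lm_gt0 : forall m, M m -> (0 < lm m)%N.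
Hypothesis mix : forall m k A x, M m -> borel_set A -> low m A -> Tm m x ->
  `|iter k U (\1_A) x - pr (mustar m) A| <= geom_rate R n (lm m) ^+ (k %/ lm m).

Lemma T_closed : closed T.
Proof. exact: closed_bigcup. Qed.

Lemma T_sub : T `<=` I.
Proof. by move=> x [m Mm]; exact: Tm_sub. Qed.

Let mI : borel_set I. Proof. exact: borel_closed. Qed.
Let mT : borel_set T. Proof. exact: borel_closed T_closed. Qed.
Let mB : borel_set B. Proof. exact: measurableD. Qed.
Let mTm m : M m -> borel_set (Tm m). Proof. by move=> /Tm_closed; exact: borel_closed. Qed.

Let biter k A : borel_set A -> bounded_borel I (iter k U (\1_A)).
Proof. by move=> mA; apply: bounded_borel_iter => //; exact: bounded_borel_indic. Qed.

Let bg m : M m -> bounded_borel I (g m).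
Proof.
move=> Mm; split.
  apply: within_continuous_borel => //.
  exact: (absorption_continuous n_gt0 phic I_inv M_fin Tm_closed Tm_inv Tm_disj reach l0_gt0).
exists 1 => x Ix; rewrite ger0_norm ?(absorption_le1 n_gt0 Tm_inv)//.
exact: (absorption_ge0 n_gt0 Tm_inv).
Qed.

Lemma bounded_mean_sum_seq (mu : probRV R d) (s : seq J) (h : J -> V -> R) :
  (forall m, m \in s -> bounded_borel I (h m)) ->
  bounded_borel I (fun x => \sum_(m <- s) h m x) /\
  mean I mu (fun x => \sum_(m <- s) h m x) = \sum_(m <- s) mean I mu (h m).
Proof.
move=> hs; elim: s hs => [|m s IH] hs.
  rewrite big_nil; split.
    by under [X in bounded_borel _ X]eq_fun do rewrite big_nil; exact: bounded_borel_cst.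
  rewrite (@eq_mean _ _ _ _ _ (fun=> 0)); last by move=> x _; rewrite big_nil.
  by rewrite /mean Rintegral_cst// mul0r.
have [|b IHE] := IH; first by move=> m' ms; apply: hs; rewrite inE ms orbT.
have bm : bounded_borel I (h m) by apply: hs; rewrite inE eqxx.
split; first by under [X in bounded_borel _ X]eq_fun do rewrite big_cons; exact: bounded_borelD.
rewrite big_cons -IHE -meanD//.
by apply: eq_mean => x _; rewrite big_cons.
Qed.

Lemma mean_sum_seq (mu : probRV R d) (s : seq J) (h : J -> V -> R) :
  (forall m, m \in s -> bounded_borel I (h m)) ->
  mean I mu (fun x => \sum_(m <- s) h m x) = \sum_(m <- s) mean I mu (h m).
Proof. by move=> hs; have [] := bounded_mean_sum_seq mu hs. Qed.

Lemma pr_mustar_T m A : M m -> borel_set A -> pr (mustar m) (A `&` Tm m) = pr (mustar m) A.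
Proof. by move=> Mm mA; rewrite /pr prob1_setI//; [exact: Tm_closed|exact: mustar1]. Qed.

Lemma pr_mustar_other m m' A : M m -> M m' -> m' <> m -> borel_set A ->
  pr (mustar m') (A `&` Tm m) = 0.
Proof.
move=> Mm Mm' mm' mA; rewrite /pr (pr_out0 (mTm Mm') _ (mustar1 Mm'))//.
  by apply: measurableI => //; exact: mTm.
by move=> x T'x [_ Tx]; apply: mm'; exact: (Tm_uniq Tm_disj Mm' Mm T'x Tx).
Qed.

Lemma pr_mustar_B m A : M m -> borel_set A -> pr (mustar m) (A `&` B) = 0.
Proof.
move=> Mm mA; rewrite /pr (pr_out0 (mTm Mm) _ (mustar1 Mm))//.
  by apply: measurableI => //; exact: mTm.
by move=> x Tx [_ [_]]; apply; exists m.
Qed.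

Section one_measure.
Variable mu : probRV R d.
Hypothesis muI : mu I = 1%E.

Let iterE k A : borel_set A -> iter k P mu A = (mean I mu (iter k U (\1_A)))%:E.
Proof. by move=> mA; exact: iter_markov_mean. Qed.

Lemma transient_contraction : (iter l0 P mu B <= rho0%:E * mu B)%E.
Proof.
rewrite (iterE _ mB) (mean_indic I_closed muI mB) -EFinM lee_fin -meanZ//; last first.
  exact: bounded_borel_indic.
apply: mean_le => //; first exact: biter.
  by apply: bounded_borelZ; exact: bounded_borel_indic.
by move=> x Ix; exact: (iter_l0_B n_gt0 I_inv Tm_inv reach).
Qed.

Lemma mean_B_le k : mean I mu (iter k U (\1_B)) <= rho0 ^+ (k %/ l0).
Proof.
rewrite -[leRHS](@mean_cst _ _ I I_closed mu)//.
apply: mean_le => //; [exact: biter|exact: bounded_borel_cst|].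
by move=> x Ix; exact: (iter_B_le n_gt0 I_inv Tm_inv reach).
Qed.

Definition coef m := mean I mu (g m).

Lemma absorption_coefE m : M m -> absorption_coef I mu (g m) = (coef m)%:E.
Proof. by move=> Mm; rewrite /absorption_coef mean_EFin//; exact: bg. Qed.

Lemma coef_sum (s : seq J) : uniq s -> (forall m, m \in s <-> M m) ->
  \sum_(m <- s) coef m = 1.
Proof.
move=> us sM; rewrite -mean_sum_seq; last by move=> m /sM; exact: bg.
rewrite (@eq_mean _ _ _ _ _ (fun=> 1)); first exact: mean_cst.
by move=> x Ix; exact: (absorption_sum n_gt0 I_inv Tm_inv Tm_disj reach).
Qed.

Definition limit_measure (A : set V) : \bar R :=
  (\sum_(m \in M) absorption_coef I mu (g m) * mustar m A)%E.

Lemma limit_measureE (s : seq J) A : uniq s -> (forall m, m \in s <-> M m) ->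
  (forall F : J -> \bar R, (\sum_(m \in M) F m = \sum_(m <- s) F m)%E) -> borel_set A ->
  limit_measure A = (\sum_(m <- s) coef m * pr (mustar m) A)%:E.
Proof.
move=> us sM hs mA; rewrite /limit_measure hs -sumEFin big_seq [RHS]big_seq.
by apply: eq_bigr => m /sM Mm; rewrite absorption_coefE// (prE _ mA) EFinM.
Qed.

Lemma limit_measure_invariant : invariant_measure phi limit_measure.
Proof.
move=> A mA; have [s [us sM _ hs _]] := finite_sum_seq R M_fin.
rewrite /markov_op (limit_measureE us sM hs mA).
rewrite (eq_bigr (fun i => (\sum_(m <- s) coef m * pr (mustar m) (phi i @^-1` A))%:E)); last first.
  by move=> i _; apply: limit_measureE => //; exact: borel_preimage.
rewrite sumEFin -EFinM; congr EFin; rewrite exchange_big mulr_sumr big_seq [RHS]big_seq.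
apply: eq_bigr => m /sM Mm; rewrite -mulr_sumr mulrCA; congr (_ * _).
by rewrite -pr_invariant//; exact: mustar_inv.
Qed.

(** The error keeps the masses that belong to m instead of a uniform bound, so that summing over m
    costs no factor |M|. *)
Lemma component_bound m s t A (r : R) : M m -> borel_set A -> low m A ->
  geom_rate R n (lm m) ^+ (t %/ lm m) <= r ->
  `|mean I mu (iter (s + t) U (\1_(A `&` Tm m))) - coef m * pr (mustar m) A| <=
    r * mean I mu (iter s U (\1_(Tm m))) + (coef m - mean I mu (iter s U (\1_(Tm m)))).
Proof.
move=> Mm mA lA hr.
have r0 : 0 <= r by apply: le_trans hr; rewrite exprn_ge0// geom_rate_ge0.
have b1 : bounded_borel I (iter (s + t) U (\1_(A `&` Tm m))).
  by apply: biter; apply: measurableI => //; exact: mTm.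
have b2 := bg Mm; have b3 : bounded_borel I (iter s U (\1_(Tm m))) by apply: biter; exact: mTm.
have -> : mean I mu (iter (s + t) U (\1_(A `&` Tm m))) - coef m * pr (mustar m) A =
    mean I mu (fun x => iter (s + t) U (\1_(A `&` Tm m)) x - pr (mustar m) A * g m x).
  by rewrite meanB//; [rewrite meanZ// [X in _ = _ - X]mulrC|exact: bounded_borelZ].
have -> : r * mean I mu (iter s U (\1_(Tm m))) + (coef m - mean I mu (iter s U (\1_(Tm m)))) =
    mean I mu (fun x => r * iter s U (\1_(Tm m)) x + (g m x - iter s U (\1_(Tm m)) x)).
  by rewrite meanD//; [rewrite meanZ// meanB|exact: bounded_borelZ|exact: bounded_borelB].
apply: mean_norm_le => //.
- by apply: bounded_borelB => //; exact: bounded_borelZ.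
- by apply: bounded_borelD; [exact: bounded_borelZ|exact: bounded_borelB].
move=> x Ix; rewrite [pr _ _ * _]mulrC.
apply: (absorption_main n_gt0 I_inv Tm_inv s Mm Ix) => //.
- by rewrite pr_ge0 pr_le1.
- by move=> y Ty; apply: le_trans hr; exact: mix.
Qed.

Lemma component_bound_sum s (r : R) (e : seq J) : uniq e -> (forall m, m \in e <-> M m) ->
  \sum_(m <- e) (r * mean I mu (iter s U (\1_(Tm m))) +
     (coef m - mean I mu (iter s U (\1_(Tm m))))) =
  r * (1 - mean I mu (iter s U (\1_B))) + mean I mu (iter s U (\1_B)).
Proof.
move=> ue eM.
have h : \sum_(m <- e) mean I mu (iter s U (\1_(Tm m))) = 1 - mean I mu (iter s U (\1_B)).
  rewrite -mean_sum_seq; last by move=> m /eM /mTm; exact: biter.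
  rewrite -[X in X - _](@mean_cst _ _ I I_closed mu)// -meanB//; last 2 first.
  - exact: bounded_borel_cst.
  - exact: biter.
  by apply: eq_mean => x Ix; exact: (iter_Tm_sum n_gt0 I_inv Tm_disj s ue eM Ix).
rewrite big_split /= -mulr_sumr sumrB coef_sum// h.
by congr (_ + _); rewrite opprB addrC subrK.
Qed.

Lemma geom_pow_le a b k q : (0 < a)%N -> (a <= b)%N -> (q * a <= k)%N ->
  geom_rate R n a ^+ (k %/ a) <= geom_rate R n b ^+ q.
Proof.
move=> a0 ab qk; apply: (@le_trans _ _ (geom_rate R n a ^+ q)).
  apply: ler_wiXn2l; rewrite ?geom_rate_ge0 ?(ltW (geom_rate_lt1 _ _ _))//.
  by rewrite leq_divRL.
by apply: lerXn2r; rewrite ?nnegrE ?geom_rate_ge0// geom_rate_le.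
Qed.

(** * Time split and error budget *)

Section rates.
Variables (k l : nat).
Let L := maxn l0 (\big[maxn/0%N]_(m \in M) lm m).
Hypothesis lE : l = (2 * L)%N.
Local Notation r := (geom_rate R n l ^+ (k %/ l)).
(** With q = k / l, absorption gets q blocks of length L, and since l = 2L at least as many steps
    remain for mixing. Both phases then decay at least like r. *)
Let s := (k %/ l * L)%N.

Let l0L : (l0 <= L)%N. Proof. exact: leq_maxl. Qed.
Let lmL m : M m -> (lm m <= L)%N.
Proof.
move=> Mm; have [e [ue eM _ _ hs]] := finite_sum_seq R M_fin.
rewrite /L hs; apply: leq_trans (leq_maxr _ _).
by apply: leq_bigmax_seq => //; apply/eM.
Qed.
Let qlk : (k %/ l * l <= k)%N. Proof. exact: leq_divM. Qed.
Let sk : (s <= k)%N.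
Proof. by apply: leq_trans qlk; rewrite /s leq_mul2l lE leq_pmull ?orbT. Qed.
Let ts : (s <= k - s)%N.
Proof. by rewrite leq_subRL// -mulnDr addnn -mul2n -lE. Qed.

Lemma r_ge0 : 0 <= r. Proof. by rewrite exprn_ge0// geom_rate_ge0. Qed.

Lemma mean_B_le_r : mean I mu (iter s U (\1_B)) <= r.
Proof.
apply: le_trans (mean_B_le _) _; apply: geom_pow_le => //.
  by apply: leq_trans l0L _; rewrite lE leq_pmull.
by rewrite leq_mul2l l0L orbT.
Qed.

Definition component_error m :=
  r * mean I mu (iter s U (\1_(Tm m))) + (coef m - mean I mu (iter s U (\1_(Tm m)))).

(** With beta the mass in B at time s, the sum is r (1 - beta) + beta, and beta is at most r. *)
Lemma component_error_sum (e : seq J) : uniq e -> (forall m, m \in e <-> M m) ->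
  \sum_(m <- e) component_error m <= 2 * r.
Proof.
move=> ue eM; rewrite /component_error component_bound_sum//.
have h0 : 0 <= mean I mu (iter s U (\1_B)).
  rewrite -(@mean_cst _ _ I I_closed mu 0)//; apply: mean_le => //.
  - exact: bounded_borel_cst.
  - exact: biter.
  - by move=> x _; exact: iter_indic_ge0.
have := mean_B_le_r; have := r_ge0; nra.
Qed.

Lemma component_error_bound m A : M m -> borel_set A -> low m A ->
  `|mean I mu (iter k U (\1_(A `&` Tm m))) - coef m * pr (mustar m) A| <= component_error m.
Proof.
move=> Mm mA lA; rewrite -{1}(subnKC sk); apply: component_bound => //.
apply: geom_pow_le; first exact: lm_gt0.
  by apply: leq_trans (lmL Mm) _; rewrite lE leq_pmull.
by apply: leq_trans ts; rewrite leq_mul2l lmL// orbT.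
Qed.

Lemma transient_error A : borel_set A ->
  0 <= mean I mu (iter k U (\1_(A `&` B))) <= r.
Proof.
move=> mA; have mAB : borel_set (A `&` B) by exact: measurableI.
apply/andP; split.
  rewrite -(@mean_cst _ _ I I_closed mu 0)//; apply: mean_le => //.
  - exact: bounded_borel_cst.
  - exact: biter.
  - by move=> x _; exact: iter_indic_ge0.
apply: (@le_trans _ _ (mean I mu (iter k U (\1_B)))).
  apply: mean_le => //; [exact: biter|exact: biter|].
  move=> x _; apply: (@iter_dual_le _ _ _ phi n_gt0 setT) => // y _.
  have [By|nBy] := pselect (B y); first by rewrite (indic_in R By) indic_le1.
  by rewrite !indic_out// => -[].
apply: le_trans (mean_B_le _) _; apply: geom_pow_le => //.
  by apply: leq_trans l0L _; rewrite lE leq_pmull.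
by apply: leq_trans sk; rewrite leq_mul2l l0L orbT.
Qed.

Lemma limit_measure_T m A : M m -> borel_set A ->
  limit_measure (A `&` Tm m) = (coef m * pr (mustar m) A)%:E.
Proof.
move=> Mm mA; have [e [ue eM _ hs _]] := finite_sum_seq R M_fin.
have mAT : borel_set (A `&` Tm m) by apply: measurableI => //; exact: mTm.
rewrite (limit_measureE ue eM hs mAT); congr EFin.
rewrite (@big_seq_single _ _ e _ m) ?pr_mustar_T//; first exact/eM.
by move=> m' /eM Mm' /eqP m'm; rewrite pr_mustar_other// mulr0.
Qed.

Lemma limit_measure_B A : borel_set A -> limit_measure (A `&` B) = 0%E.
Proof.
move=> mA; have [e [ue eM _ hs _]] := finite_sum_seq R M_fin.
have mAB : borel_set (A `&` B) by exact: measurableI.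
rewrite (limit_measureE ue eM hs mAB); congr EFin.
by rewrite big_seq big1// => m /eM Mm; rewrite pr_mustar_B// mulr0.
Qed.

(** The limit gives B no mass, so the transient part costs r; the components together cost 2r. *)
Lemma d_tilde_bound (alpha : J -> {ffun 'I_d -> bool}) :
  (forall m A, M m -> Afamily (alpha m) A -> borel_set (A `&` I) /\ low m (A `&` I)) ->
  (d_TV (meas_restrict (iter k P mu) B) (meas_restrict limit_measure B) +
   \sum_(m \in M) d_sign I (alpha m) (meas_restrict (iter k P mu) (Tm m))
       (meas_restrict limit_measure (Tm m)) <= (3 * r)%:E)%E.
Proof.
move=> hA; rewrite (_ : 3 * r = r + 2 * r); last by lra.
rewrite EFinD; apply: leeD.
  apply: ereal_sup_le => _ [A mA <-]; rewrite /meas_restrict limit_measure_B// sube0.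
  rewrite iterE; last exact: measurableI.
  rewrite abse_EFin lee_fin; have /andP[h1 h2] := transient_error mA.
  by rewrite ger0_norm.
have [e [ue eM _ hs _]] := finite_sum_seq R M_fin.
rewrite hs; apply: (@le_trans _ _ (\sum_(m <- e) (component_error m)%:E)%E).
  rewrite big_seq [leRHS]big_seq; apply: lee_sum => m /eM Mm.
  apply: ereal_sup_le => _ [A AA <-]; have [mA lA] := hA m A Mm AA.
  rewrite /meas_restrict limit_measure_T// iterE; last by apply: measurableI => //; exact: mTm.
  by rewrite -EFinB abse_EFin lee_fin component_error_bound.
by rewrite sumEFin lee_fin component_error_sum.
Qed.

(** Cutting A along B and the trapping sets meets the same budget. For d = 1 it is applied to the
    segments [a, x], which are lower sets in every T_m. *)
Lemma lower_bound_error A : borel_set A -> A `<=` I -> (forall m, M m -> low m A) ->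
  (`|iter k P mu A - limit_measure A| <= (3 * r)%:E)%E.
Proof.
move=> mA AI lA; have [e [ue eM _ hs _]] := finite_sum_seq R M_fin.
rewrite iterE// (limit_measureE ue eM hs mA) -EFinB abse_EFin lee_fin.
have -> : mean I mu (iter k U (\1_A)) = mean I mu (iter k U (\1_(A `&` B))) +
    \sum_(m <- e) mean I mu (iter k U (\1_(A `&` Tm m))).
  have bT m : m \in e -> bounded_borel I (iter k U (\1_(A `&` Tm m))).
    by move=> /eM Mm; apply: biter; apply: measurableI => //; exact: mTm.
  have bB : bounded_borel I (iter k U (\1_(A `&` B))) by apply: biter; exact: measurableI.
  rewrite -mean_sum_seq// -meanD//.
    apply: eq_mean => x Ix; rewrite -iter_dual_sum_seq// -iter_dualD.
    apply: (@eq_iter_dual _ _ _ phi n_gt0 I) => // y Iy.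
    have [Ay|nAy] := pselect (A y); last first.
      by rewrite !indic_out ?big1 ?addr0// => [m _|[]//]; rewrite indic_out// => -[].
    have -> : \1_(A `&` B) y = \1_B y :> R.
      have [By|nBy] := pselect (B y); first by rewrite !indic_in.
      by rewrite !indic_out// => -[].
    rewrite (eq_bigr (fun m => \1_(Tm m) y)).
      by rewrite (indic_B_sum Tm_disj ue eM Iy) addrC subrK indic_in.
    move=> m _; have [Ty|nTy] := pselect (Tm m y); first by rewrite !indic_in.
    by rewrite !indic_out// => -[].
  by have [] := bounded_mean_sum_seq mu bT.
rewrite -addrA -sumrB.
apply: (le_trans (ler_normD _ _)); rewrite (_ : 3 * r = r + 2 * r); last by lra.
have /andP[h1 h2] := transient_error mA.
apply: lerD; first by rewrite ger0_norm.
apply: (le_trans (ler_norm_sum _ _ _)); apply: le_trans (component_error_sum ue eM).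
rewrite big_seq [leRHS]big_seq; apply: ler_sum => m /eM Mm.
by apply: component_error_bound => //; exact: lA.
Qed.

End rates.
End one_measure.

(** g is constant on [Tm m'], and its deviation from that constant is dominated by the indicator of
    the complement, which is null. *)
Lemma coef_delta m m' : M m -> M m' -> coef (mustar m') m = (m == m')%:R.
Proof.
move=> Mm Mm'; have mT' := mTm Mm'.
have mI1 : mustar m' I = 1%E by apply: (pr_sub1 mT') => //; [exact: mustar1|exact: Tm_sub].
pose c : R := (m == m')%:R.
have gc x : Tm m' x -> g m x = c.
  move=> Tx; rewrite /c; case: eqP => [e|mm']; last first.
    by apply: (absorption_other n_gt0 Tm_inv Tm_disj Mm Mm') => // e; apply: mm'.
  by rewrite e in Tx * => *; exact: (absorption_in n_gt0 Tm_inv Mm').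
have bI : bounded_borel I (\1_(~` Tm m')) by apply: bounded_borel_indic => //; exact: measurableC.
have m0 : mean I (mustar m') (\1_(~` Tm m')) = 0.
  have := mean_indic I_closed mI1 (measurableC mT'); rewrite probability_setC// mustar1// subee//.
  by case.
apply/eqP; rewrite -/c -subr_eq0 -normr_le0 -m0.
have -> : coef (mustar m') m - c = mean I (mustar m') (fun x => g m x - c).
  by rewrite meanB ?mean_cst//; [exact: bg|exact: bounded_borel_cst].
apply: mean_norm_le => //.
  by apply: bounded_borelB => //; [exact: bg|exact: bounded_borel_cst].
move=> x Ix; have [Tx|nTx] := pselect (Tm m' x).
  by rewrite gc// subrr normr0 indic_ge0.
rewrite (indic_in R (_ : (~` Tm m') x))// ler_norml.
have := absorption_ge0 n_gt0 Tm_inv x Mm; have := absorption_le1 n_gt0 Tm_inv x Mm.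
by rewrite /c; case: eqP => _ /=; lra.
Qed.

(** * Invariant measures as mixtures *)

Lemma conditional_exists (nu : probRV R d) D : borel_set D -> 0 < pr nu D ->
  exists nu' : probRV R d, forall A, borel_set A ->
    pr nu' A = (pr nu D)^-1 * pr nu (A `&` D).
Proof.
move=> mD D0; pose mr : {measure set (borelRV R d) -> \bar R} :=
  mrestr nu (mD : measurable (D : set (borelRV R d))).
have mrT : mr setT = (pr nu D)%:E by rewrite -(prE nu mD) -[LHS]/(nu (setT `&` D)) setTI.
exists (mnormalize mr nu) => A mA.
transitivity (fine (mnormalize mr nu A)) => //.
rewrite (mnormalizeE nu A mrT D0) -[mr A]/(nu (A `&` D)).
have mAD : borel_set (A `&` D) by exact: measurableI.
by rewrite (prE nu mAD) /= mulrC.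
Qed.

Lemma pr_setI1 (nu : probRV R d) S A : closed S -> borel_set A -> nu S = 1%E ->
  pr nu (A `&` S) = pr nu A.
Proof. by move=> Sc mA S1; rewrite /pr prob1_setI. Qed.

(** Both D and its complement in T are preserved, so inside T the preimage of D by each map is D
    itself; hence conditioning on D commutes with the dynamics. *)
Lemma conditional_invariant (nu : probRV R d) D : invariant_measure phi nu ->
  nu T = 1%E -> borel_set D -> D `<=` T -> preserved phi D -> preserved phi (T `\` D) ->
  0 < pr nu D ->
  exists nu' : probRV R d, [/\ forall A, borel_set A -> pr nu' A = (pr nu D)^-1 * pr nu (A `&` D),
    nu' D = 1%E & invariant_measure phi nu'].
Proof.
move=> nu_inv nuT mD DT Dinv TDinv D0.
have [nu' nu'E] := conditional_exists mD D0.
exists nu'; split => //.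
  by rewrite (prE _ mD) nu'E// setIid mulVf// gt_eqF.
move=> A mA; rewrite /markov_op.
have mpre i : borel_set (phi i @^-1` A) by exact: borel_preimage.
rewrite (eq_bigr (fun i => (pr nu' (phi i @^-1` A))%:E)); last by move=> i _; exact: prE.
rewrite sumEFin -EFinM (prE _ mA); congr EFin.
rewrite (nu'E _ mA) (pr_invariant phic nu_inv (measurableI _ _ mA mD)).
rewrite mulrCA; congr (_ * _); rewrite mulr_sumr; apply: eq_bigr => i _.
rewrite nu'E//; congr (_ * _).
have mp2 : borel_set (phi i @^-1` (A `&` D)) by apply: borel_preimage => //; exact: measurableI.
rewrite -(pr_setI1 T_closed (measurableI _ _ (mpre i) mD) nuT) -(pr_setI1 T_closed mp2 nuT).
congr (pr nu _); apply/seteqP; split => x [].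
  move=> [Ax Dx] Tx; split => //; split => //; exact: Dinv.
move=> [Ax Dx] Tx; split => //; split => //; apply: contrapT => nDx.
by have [_] := TDinv i x (conj Tx nDx).
Qed.

(** By invariance the mass of B is the same at all times, while it decays geometrically. *)
Lemma invariant_T (nu : probRV R d) : nu I = 1%E -> invariant_measure phi nu -> nu T = 1%E.
Proof.
move=> nuI nu_inv; suff nuB : pr nu B = 0.
  have -> : T = I `&` ~` B.
    apply/seteqP; split => [x Tx|x [Ix nBx]]; first by split; [exact: T_sub|case].
    by apply: contrapT => nTx; apply: nBx.
  have mCB : borel_set (~` B) by exact: measurableC.
  by rewrite setIC (prob1_setI I_closed nuI mCB) probability_setC// (prE _ mB) nuB sube0.
apply/eqP; rewrite -normr_le0 ger0_norm ?pr_ge0//.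
apply/ler_addgt0Pl => e e0; rewrite addr0.
have [q hq] := expr_small (geom_rate_ge0 R n_gt0 l0) (geom_rate_lt1 R n_gt0 l0) e0.
apply: le_trans hq; have := mean_B_le nuI (q * l0); rewrite mulnK//; apply: le_trans.
rewrite -lee_fin -(@iter_markov_mean _ _ _ I)// iter_invariant//.
by rewrite (prE _ mB).
Qed.

Lemma setD_Tm_inv m : M m -> preserved phi (T `\` Tm m).
Proof.
move=> Mm i x [[m' Mm' T'x] nTx]; have T'p : Tm m' (phi i x) by exact: Tm_inv.
split; first by exists m'.
move=> Tp; apply: nTx; rewrite -(Tm_uniq Tm_disj Mm' Mm T'p Tp)//.
Qed.

(** If [Tm m] is charged, nu conditioned on it is invariant and carried by it, hence is [mustar m]
    by uniqueness. *)
Lemma invariant_component (nu : probRV R d) m A : nu I = 1%E -> invariant_measure phi nu ->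
  M m -> borel_set A -> pr nu (A `&` Tm m) = pr nu (Tm m) * pr (mustar m) A.
Proof.
move=> nuI nu_inv Mm mA; have mT' := mTm Mm.
have [/eqP T0|] := boolP (pr nu (Tm m) == 0).
  rewrite T0 mul0r; apply/eqP; rewrite eq_le pr_ge0 andbT -T0 -lee_fin -!prE//; last exact: measurableI.
  by apply: le_measure; rewrite ?inE//; exact: measurableI.
rewrite neq_lt ltNge pr_ge0 /= => T0.
have [|nu' [nu'E nu'1 nu'inv]] := conditional_invariant nu_inv (invariant_T nuI nu_inv) mT' _
  (Tm_inv Mm) (setD_Tm_inv Mm) T0.
  by move=> x Tx; exists m.
have e := mustar_uniq Mm nu'1 nu'inv mA.
have -> : pr (mustar m) A = pr nu' A by rewrite /pr e.
by rewrite nu'E// mulVKf// gt_eqF.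
Qed.

Lemma pr_T_sum (nu : probRV R d) (e : seq J) A : uniq e -> (forall m, m \in e <-> M m) ->
  nu T = 1%E -> borel_set A -> pr nu A = \sum_(m <- e) pr nu (A `&` Tm m).
Proof.
move=> ue eM nuT mA.
have nuI : nu I = 1%E by apply: (pr_sub1 mT) => //; exact: T_sub.
have prm A' : borel_set A' -> pr nu A' = mean I nu (\1_A').
  by move=> mA'; have := mean_indic I_closed nuI mA'; rewrite (prE _ mA') => -[].
rewrite -(pr_setI1 T_closed mA nuT) prm; last exact: measurableI.
rewrite big_seq (eq_bigr (fun m => mean I nu (\1_(A `&` Tm m)))); last first.
  by move=> m /eM Mm; apply: prm; apply: measurableI => //; exact: mTm.
rewrite -big_seq -mean_sum_seq; last first.
  by move=> m /eM Mm; apply: bounded_borel_indic => //; apply: measurableI => //; exact: mTm.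
apply: eq_mean => x Ix; have [Ax|nAx] := pselect (A x); last first.
  rewrite indic_out; last by case.
  by rewrite big1// => m _; rewrite indic_out// => -[].
rewrite (eq_bigr (fun m => \1_(Tm m) x)); last first.
  move=> m _; have [Ty|nTy] := pselect (Tm m x); first by rewrite !indic_in.
  by rewrite !indic_out// => -[].
rewrite (indic_B_sum Tm_disj ue eM Ix).
have [Tx|nTx] := pselect (T x).
  by rewrite indic_in// indic_out ?subr0// => -[].
by rewrite indic_out ?(indic_in R (_ : B x)) ?subrr// => -[].
Qed.

Lemma invariant_decomposition (nu : probRV R d) : nu I = 1%E -> invariant_measure phi nu ->
  (forall m, M m -> 0 <= pr nu (Tm m)) /\ \sum_(m \in M) pr nu (Tm m) = 1 /\
  same_measure nu (fun A => \sum_(m \in M) (pr nu (Tm m))%:E * mustar m A)%E.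
Proof.
move=> nuI nu_inv; have nuT := invariant_T nuI nu_inv.
have [e [ue eM hR hE _]] := finite_sum_seq R M_fin.
split; first by move=> m _; exact: pr_ge0.
split.
  have := pr_T_sum ue eM nuT measurableT; rewrite {1}/pr probability_setT /= => ->.
  by rewrite hR; apply: eq_bigr => m _; rewrite setTI.
move=> A mA; rewrite hE (prE _ mA) (pr_T_sum ue eM nuT mA) -sumEFin big_seq [RHS]big_seq.
apply: eq_bigr => m /eM Mm; rewrite (invariant_component nuI nu_inv Mm mA).
by rewrite (prE _ mA) EFinM.
Qed.

Lemma mustar_I m : M m -> mustar m I = 1%E.
Proof.
by move=> Mm; apply: (pr_sub1 (mTm Mm)) => //; [exact: mustar1|exact: Tm_sub].
Qed.

(** An invariant measure charging both [Tm m] and the rest D of T is a proper mixture of its two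
    conditionals, so extremality identifies it with the first. Conversely, full mass on [Tm m] is
    inherited by both members of a proper mixture, and uniqueness applies to each. *)
Lemma extremal_mustar (nu : probRV R d) : extremal_invariant phi I nu <->
  exists2 m, M m & same_measure nu (mustar m).
Proof.
have supp (mu : probRV R d) : meas_support mu `<=` I <-> mu I = 1%E by exact: support_prob1.
split=> [[/supp nuI nu_inv ext]|[m Mm e]].
  have [_ [sum1 _]] := invariant_decomposition nuI nu_inv.
  have nuT := invariant_T nuI nu_inv.
  have [m Mm T0] : exists2 m, M m & pr nu (Tm m) != 0.
    apply: contrapT => h; move: sum1; rewrite fsbig1 => [/eqP|m Mm].
      by rewrite eq_sym oner_eq0.
    by apply/eqP/negPn/negP => hm; apply: h; exists m.
  exists m => //; have mT' := mTm Mm.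
  have T0' : 0 < pr nu (Tm m) by rewrite lt_def T0 pr_ge0.
  have comp A : borel_set A -> pr nu (A `&` Tm m) = pr nu (Tm m) * pr (mustar m) A.
    by move=> mA; exact: invariant_component.
  pose D := T `\` Tm m.
  have mD : borel_set D by exact: measurableD.
  have split A : borel_set A -> pr nu A = pr nu (A `&` Tm m) + pr nu (A `&` D).
    move=> mA; have m1 := measurableI _ _ mA mT'; have m2 := measurableI _ _ mA mD.
    apply: EFin_inj; rewrite EFinD -!prE// -measureU//; last first.
      by apply/seteqP; split => // x [[_ Tx] [_ [_]]].
    rewrite -(prob1_setI T_closed nuT mA); congr (nu _).
    apply/seteqP; split => x.
      by move=> [Ax Tx]; have [h|h] := pselect (Tm m x); [left|right].
    by move=> [[Ax Tx]|[Ax [Tx _]]]; split => //; exists m.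
  have prD : pr nu D = 1 - pr nu (Tm m).
    have := split _ measurableT; rewrite !setTI {1}/pr probability_setT /=; lra.
  have [D0|D0] := leP (pr nu D) 0.
    move=> A mA; rewrite !(prE _ mA); congr EFin.
    have mAD := measurableI _ _ mA mD.
    have prT1 : pr nu (Tm m) = 1 by have := pr_ge0 nu D; have := pr_le1 nu mT'; lra.
    rewrite split// comp// prT1 mul1r.
    suff -> : pr nu (A `&` D) = 0 by rewrite addr0.
    apply/eqP; rewrite eq_le pr_ge0 andbT; apply: le_trans D0.
    by rewrite -lee_fin -!prE//; apply: le_measure; rewrite ?inE//.
  have TDD : T `\` D = Tm m.
    apply/seteqP; split => [x [Tx nDx]|x Tx]; last by split; [exists m|case].
    by apply: contrapT => nTx; apply: nDx.
  have [||nu' [nu'E nu'D nu'inv]] := conditional_invariant nu_inv nuT mD _ (setD_Tm_inv Mm) _ D0.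
  - by move=> x [].
  - by rewrite TDD; exact: Tm_inv.
  have s1 : meas_support (mustar m) `<=` I by apply/supp; exact: mustar_I.
  have s2 : meas_support nu' `<=` I.
    by apply/supp; apply: (pr_sub1 mD) => // x [Tx _]; exact: T_sub.
  have t01 : 0 < pr nu (Tm m) < 1 by rewrite T0'; move: D0; rewrite prD subr_gt0.
  have [] // := ext _ _ _ s1 s2 (mustar_inv Mm) nu'inv t01.
    move=> A mA; rewrite !(prE _ mA) -!EFinM -EFinD; congr EFin.
    by rewrite split// comp// nu'E// -prD mulVKf// gt_eqF.
  by move=> h _ A mA; rewrite h.
have nuTm : nu (Tm m) = 1%E by rewrite e ?mustar1//; exact: mTm.
have nu_inv : invariant_measure phi nu.
  move=> A mA; rewrite e// -(mustar_inv Mm mA) /markov_op; congr (_ * _)%E.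
  by apply: eq_bigr => i _; apply: e; exact: borel_preimage.
split => //.
  by apply/supp; apply: (pr_sub1 (mTm Mm)) => //; exact: Tm_sub.
move=> nu1 nu2 t /supp s1 /supp s2 i1 i2 /andP[t0 t1] nuE.
have mT' := mTm Mm; have := nuE _ mT'; rewrite nuTm !(prE _ mT') -!EFinM -EFinD => -[h].
have p1 := pr_le1 nu1 mT'; have p2 := pr_le1 nu2 mT'.
have e1 : pr nu1 (Tm m) = 1 by nra.
have e2 : pr nu2 (Tm m) = 1 by nra.
split => A mA; rewrite e//; apply: mustar_uniq => //; by rewrite (prE _ mT') ?e1 ?e2.
Qed.

Lemma iter_dirac k x A : iter k P (@dirac _ (borelRV R d) x R) A = (iter k U (\1_A) x)%:E.
Proof.
elim: k A => [|k IH] A; first by rewrite /= /dirac.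
rewrite iterS_dual_indic iterS {1}/markov_op (eq_bigr _ (fun i _ => IH _)).
by rewrite sumEFin -EFinM.
Qed.

(** Let W be the sum of u over a window of l0 consecutive times. Sliding the window by one step
    loses at least (1 - rho0) u, so (1 - rho0) times the total is at most the initial W, which is at
    most l0; and 1 - rho0 = n^(-l0). *)
Lemma occupation_bound N x : I x ->
  \sum_(0 <= k < N) iter k U (\1_B) x <= l0%:R * n%:R ^+ l0.
Proof.
move=> Ix; pose u k := iter k U (\1_B) x; pose W N := \sum_(i < l0) u (N + i)%N.
have uS k : u (k + l0)%N <= rho0 * u k.
  rewrite /u iterD -iter_dualZ; apply: (@iter_dual_le _ _ _ phi n_gt0 I) => // y Iy.
  exact: (iter_l0_B n_gt0 I_inv Tm_inv reach).
have WS m : W m.+1 = W m - u m + u (m + l0)%N.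
  have h1 : \sum_(i < l0.+1) u (m + i)%N = W m + u (m + l0)%N by rewrite big_ord_recr.
  have h2 : \sum_(i < l0.+1) u (m + i)%N = u m + W m.+1.
    rewrite big_ord_recl addn0; congr (_ + _); apply: eq_bigr => i _.
    by rewrite /= /bump /= addnA addn1.
  by move: h2; rewrite h1; lra.
have Wge0 m : 0 <= W m by apply: sumr_ge0 => i _; exact: iter_indic_ge0.
have W0 : W 0%N <= l0%:R.
  rewrite -[l0%:R]/(1 *+ l0) -[X in _ *+ X]card_ord -sumr_const; apply: ler_sum => i _.
  exact: iter_indic_le1.
have key : (1 - rho0) * \sum_(0 <= k < N) u k + W N <= W 0%N.
  elim: N => [|N IH]; first by rewrite big_geq// mulr0 add0r.
  rewrite big_nat_recr//= mulrDr WS; have := uS N; lra.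
have e : 1 - rho0 = (n%:R ^+ l0)^-1 by rewrite /geom_rate opprB addrC subrK.
have n0 : 0 < n%:R ^+ l0 :> R by rewrite exprn_gt0// ltr0n.
rewrite -ler_pdivrMr// mulrC -e; have := Wge0 N; lra.
Qed.

Lemma transient_B : uniformly_transient phi B.
Proof.
split => //; apply: (@le_lt_trans _ _ (l0%:R * n%:R ^+ l0)%:E); last exact: ltry.
apply: ereal_sup_le => _ [x [Ix _] <-].
apply: lime_le.
  apply: is_cvg_nneseries => k _ _.
  by rewrite iter_dirac lee_fin iter_indic_ge0.
apply: nearW => N; under eq_bigr do rewrite iter_dirac.
by rewrite sumEFin lee_fin occupation_bound.
Qed.

Lemma absorption_partition (s : seq J) x : uniq s -> (forall m, m \in s <-> M m) -> I x ->
  \sum_(m <- s) g m x = 1.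
Proof. by move=> us sM Ix; exact: (absorption_sum n_gt0 I_inv Tm_inv Tm_disj reach). Qed.

Lemma absorption_family_uniq (g' : J -> V -> R) :
  (forall m, M m -> forall x, I x -> U (g' m) x = g' m x) ->
  (forall m, M m -> forall x, I x -> 0 <= g' m x) ->
  (forall x, I x -> \sum_(m \in M) g' m x = 1) ->
  (forall m, M m -> (forall x, Tm m x -> g' m x = 1) /\
     (forall m', M m' -> m' <> m -> forall x, Tm m' x -> g' m x = 0)) ->
  forall m, M m -> forall x, I x -> g' m x = g m x.
Proof.
move=> hU h0 hsum hT m Mm x Ix; have [e [ue eM hR _ _]] := finite_sum_seq R M_fin.
apply: (harmonic_uniq n_gt0 I_inv Tm_inv reach l0_gt0 (hU m Mm)) => //.
  by move=> y _; exact: (absorption_harmonic n_gt0 Tm_inv).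
move=> y Iy; have [[m' Mm' Ty]|nTy] := pselect (T y).
  suff -> : g' m y = g m y by rewrite subrr normr0 indic_ge0.
  have [h1 h2] := hT m Mm; have [e'|m'm] := pselect (m' = m).
    by rewrite e' in Ty; rewrite h1// (absorption_in n_gt0 Tm_inv).
  by rewrite (h2 m')// (absorption_other n_gt0 Tm_inv Tm_disj Mm Mm').
rewrite (indic_in R (_ : B y))// ler_norml.
(* Nonnegativity and the partition of unity bound each function by 1, so two candidates differ by at
   most the indicator of B. *)
have g'1 : g' m y <= 1.
  rewrite -(hsum y Iy) hR (bigD1_seq m)//=; last exact/eM.
  rewrite lerDl big_seq_cond; apply: sumr_ge0 => m' /andP[/eM Mm' _]; exact: h0.
have := absorption_ge0 n_gt0 Tm_inv y Mm; have := absorption_le1 n_gt0 Tm_inv y Mm.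
have := h0 m Mm y Iy; lra.
Qed.

End global.

(** * Coordinatewise dynamics *)

Section product_dynamics.
Context (R : realType) (n d : nat).
Local Notation V := 'rV[R]_d.
Variables (D : 'I_n -> 'I_d -> R -> R) (eta : R) (a b : 'I_d -> R).
Variable phi : 'I_n -> V -> V.
Let s (j : 'I_d) : 'I_n -> R -> R := step (D^~ j) eta.
Hypothesis d_gt0 : (0 < d)%N.
Hypothesis phiE : forall i x j, phi i x 0 j = s j i (x 0 j).
Hypothesis D_cont : forall i j, continuous (D i j).
Hypothesis eta_gt0 : 0 < eta.
Hypothesis le_ab : forall j, a j <= b j.
Hypothesis D_neq0 : forall j x, exists i, D i j x != 0.
Hypothesis Da : forall j i, D i j (a j) <= 0.
Hypothesis Db : forall j i, 0 <= D i j (b j).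
Hypothesis step_incr : forall j i x y, a j <= x -> x < y -> y <= b j -> s j i x < s j i y.

Let I : set V := [set x | forall j, a j <= x 0 j <= b j].
Let M : set {ffun 'I_d -> R * R} := [set m | forall j, Tspec (D^~ j) (a j) (b j) (m j)].

Lemma card_gt0 : (0 < n)%N.
Proof. by have [i _] := D_neq0 (Ordinal d_gt0) 0; apply: leq_ltn_trans (ltn_ord i). Qed.

Let i0 : 'I_n := Ordinal card_gt0.

Lemma along_pathE w x j : along_path phi w x 0 j = run (s j) w (x 0 j).
Proof. by elim: w x => //= i w IH x; rewrite IH phiE. Qed.

Lemma s_cont j i : continuous (s j i).
Proof. by move=> x; apply: (step_cont (fun i => @D_cont i j)). Qed.

Lemma phi_cont i : continuous (phi i).
Proof.
apply: continuous_coordwise => j x.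
have -> : (fun y : V => phi i y 0 j) = (s j i \o (fun y : V => y 0 j)).
  by apply/funext => y; rewrite phiE.
by apply: (@continuous_comp _ _ _ (fun y : V => y 0 j) (s j i)); [exact: coord_continuous|exact: s_cont].
Qed.

Lemma I_preserved : preserved phi I.
Proof. by move=> i x Ix j; rewrite phiE; apply: (step_itv eta_gt0 (@step_incr j)). Qed.

Lemma box_closed (l r : 'I_d -> R) : closed [set x : V | forall j, l j <= x 0 j <= r j].
Proof.
rewrite (_ : [set x : V | _] = \bigcap_j (fun x : V => x 0 j) @^-1` `[l j, r j]).
  apply: closed_bigI => j _; apply: preimage_closed; last exact: itv_closed.
  by move=> x _; exact: coord_continuous.
by apply/seteqP; split => [x h j _|x h j]; have := h j; rewrite /= in_itv//; apply.
Qed.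

Lemma I_closed : closed I. Proof. exact: box_closed. Qed.

Lemma I_compact : compact I.
Proof.
have := @rV_compact R d (fun j => `[a j, b j]%classic) (fun j => @segment_compact R _ _).
congr compact; apply/seteqP; split => x h j; have := h j; rewrite /= in_itv//.
Qed.

Lemma TrectE m : Trect m = [set x : V | forall j, (m j).1 <= x 0 j <= (m j).2].
Proof.
by apply/seteqP; split => x h j; move: (h j); rewrite /Trect /mkset inE /= in_itv.
Qed.

Lemma Trect_closed m : closed (@Trect R d m).
Proof. rewrite TrectE; exact: box_closed. Qed.

Lemma Trect_sub m : M m -> @Trect R d m `<=` I.
Proof.
move=> Mm x; rewrite TrectE => h j; have [am _ mb _ _] := Mm j.
by have /andP[h1 h2] := h j; rewrite (le_trans am h1) (le_trans h2 mb).
Qed.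

Lemma Trect_preserved m : M m -> preserved phi (@Trect R d m).
Proof.
move=> Mm i x; rewrite TrectE => h j; have [am _ mb [m1 m2] _] := Mm j.
by rewrite phiE; apply: (step_itv eta_gt0 (@step_incr j)).
Qed.

Lemma Trect_trivIset : trivIset M (@Trect R d).
Proof.
move=> m m' Mm Mm' [x []]; rewrite !TrectE => h h'; apply/ffunP => j.
exact: (Tspec_inj (D_neq0 j) (Mm j) (Mm' j) (h j) (h' j)).
Qed.

Lemma s_le j i x y : a j <= x -> x <= y -> y <= b j -> s j i x <= s j i y.
Proof. exact: (step_le (@step_incr j)). Qed.

Lemma phi_monotone alpha i x y : I x -> I y -> le_sign alpha x y ->
  le_sign alpha (phi i x) (phi i y).
Proof.
move=> Ix Iy xy j; have := xy j; rewrite !phiE.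
have /andP[ax xb] := Ix j; have /andP[ay yb] := Iy j.
case: (alpha j); rewrite ?expr0 ?expr1 ?mul1r ?mulN1r ?oppr_ge0 ?subr_ge0 ?subr_le0 => h.
  exact: s_le.
exact: s_le.
Qed.

Lemma run_Tspec j w p x : Tspec (D^~ j) (a j) (b j) p -> p.1 <= x <= p.2 ->
  p.1 <= run (s j) w x <= p.2.
Proof. by move=> [ap _ pb [p1 p2] _]; exact: (run_itv eta_gt0 (@step_incr j)). Qed.

(** Letters chosen for a new coordinate also move the earlier ones, but these already sit in trapped
    intervals. The word depends on x, its length does not. *)
Lemma reach_all (js : seq 'I_d) : exists N, forall x, I x -> exists w, size w = N /\
  forall j, j \in js -> exists p, Tspec (D^~ j) (a j) (b j) p /\ p.1 <= run (s j) w (x 0 j) <= p.2.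
Proof.
elim: js => [|j js [N hN]]; first by exists 0%N => x _; exists [::].
have [N' hN'] := Tspec_uniform_reach (fun i => @D_cont i j) eta_gt0 (D_neq0 j) (Da j) (Db j) (@step_incr j).
exists (N + N')%N => x Ix; have [w [sw hw]] := hN x Ix.
have Iy : I (along_path phi w x) by exact: preserved_path I_preserved Ix.
have [w' [p [sw' Tp hp]]] := hN' _ (Iy j).
exists (w ++ w'); split; first by rewrite size_cat sw sw'.
move=> k; rewrite inE => /predU1P[->|kjs].
  by exists p; split => //; rewrite run_cat -along_pathE.
have [q [Tq hq]] := hw k kjs; exists q; split => //.
by rewrite run_cat; exact: run_Tspec.
Qed.

Lemma reach_T : exists l0, (0 < l0)%N /\ forall x, I x ->
  exists w, size w = l0 /\ (\bigcup_(m in M) @Trect R d m) (along_path phi w x).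
Proof.
(* One arbitrary letter in front makes the length positive, as needed for a decay rate per block of
   l0 steps. *)
have [N hN] := reach_all (enum 'I_d).
exists N.+1; split => // x Ix; have [w [sw hw]] := hN (phi i0 x) (@I_preserved i0 x Ix).
have /choice[p hp] : forall j, exists p, Tspec (D^~ j) (a j) (b j) p /\
   p.1 <= run (s j) w (phi i0 x 0 j) <= p.2 by move=> j; apply: hw; rewrite mem_enum.
exists (i0 :: w); split; first by rewrite /= sw.
exists [ffun j => p j]; first by move=> j; rewrite ffunE; have [] := hp j.
by rewrite TrectE => j; rewrite ffunE /= along_pathE; have [] := hp j.
Qed.

(** * Words with separated images in every coordinate *)

Section splitting_words.
Variable m : {ffun 'I_d -> R * R}.
Hypothesis Mm : M m.

(** By monotonicity the images of the two ends enclose the image of the T-interval; the alternatives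
    are the two orders in which disjoint images can lie. *)
Definition separated (p q : seq 'I_n) j :=
  run (s j) p (m j).2 < run (s j) q (m j).1 \/ run (s j) q (m j).2 < run (s j) p (m j).1.

Lemma run_m_mono j w x y : (m j).1 <= x -> x <= y -> y <= (m j).2 ->
  run (s j) w x <= run (s j) w y.
Proof.
have [am _ mb _ _] := Mm j; move=> mx + ym; rewrite le_eqVlt => /predU1P[->//|xy].
apply: ltW; apply: (run_incr eta_gt0 (Da j) (Db j) (@step_incr j)) => //.
  exact: le_trans mx.
exact: le_trans mb.
Qed.

Lemma run_m_itv j w x : (m j).1 <= x <= (m j).2 -> (m j).1 <= run (s j) w x <= (m j).2.
Proof. by apply: run_Tspec; exact: Mm. Qed.

Lemma m_le j : (m j).1 <= (m j).2. Proof. by have [_ /ltW] := Mm j. Qed.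

(** Prefixes act first and map the T-interval into itself, so the images only shrink. This allows
    both the treatment of coordinates in succession and padding to a common length. *)
Lemma separated_cat p q u v j : separated p q j -> separated (u ++ p) (v ++ q) j.
Proof.
have hu w : (m j).1 <= run (s j) w (m j).1 <= (m j).2 by apply: run_m_itv; rewrite lexx m_le.
have hv w : (m j).1 <= run (s j) w (m j).2 <= (m j).2 by apply: run_m_itv; rewrite lexx m_le.
case=> h; [left|right]; rewrite !run_cat.
  apply: le_lt_trans (lt_le_trans h _).
    by apply: run_m_mono => //; case/andP: (hv u).
  by apply: run_m_mono => //; case/andP: (hu v).
apply: le_lt_trans (lt_le_trans h _).
  by apply: run_m_mono => //; case/andP: (hv v).
by apply: run_m_mono => //; case/andP: (hu u).
Qed.

(** u squeezes the interval towards its left end and v towards its right end; by continuity p and q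
    then land on different sides of the midpoint c. *)
Lemma separate_one p q j : run (s j) p (m j).1 < run (s j) q (m j).2 ->
  exists u v, run (s j) (u ++ p) (m j).2 < run (s j) (v ++ q) (m j).1.
Proof.
set f := run (s j) p; set g := run (s j) q => fg.
pose c := (f (m j).1 + g (m j).2) / 2.
have hf : nbhs (f (m j).1) [set z | z < c].
  by apply: open_nbhs_nbhs; split; [exact: open_lt|rewrite /= /c; lra].
have hg : nbhs (g (m j).2) [set z | c < z].
  by apply: open_nbhs_nbhs; split; [exact: open_gt|rewrite /= /c; lra].
have rc w : continuous (run (s j) w) by apply: continuous_run => i; exact: s_cont.
have /nbhs_ballP[e /= e0 he] := rc p _ _ hf.
have /nbhs_ballP[e' /= e'0 he'] := rc q _ _ hg.
have [u hu] := Tspec_sink_l (fun i => @D_cont i j) eta_gt0 (D_neq0 j) (Mm j) e0.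
have [v hv] := Tspec_sink_r (fun i => @D_cont i j) eta_gt0 (D_neq0 j) (Mm j) e'0.
exists u, v; rewrite !run_cat; apply: (@lt_trans _ _ c).
  apply: he; rewrite /ball /= ltr_norml.
  have /andP[h1 h2] : (m j).1 <= run (s j) u (m j).2 <= (m j).2 by apply: run_m_itv; rewrite lexx m_le.
  move: hu; rewrite -/(s j); lra.
apply: he'; rewrite /ball /= ltr_norml.
have /andP[h1 h2] : (m j).1 <= run (s j) v (m j).1 <= (m j).2 by apply: run_m_itv; rewrite lexx m_le.
move: hv; rewrite -/(s j); lra.
Qed.

(** One of the two orders is always within reach: if q of the right end is at most p of the left
    end, strict monotonicity gives q(left) < p(right). Which one depends on the words built so
    far. *)
Lemma separate_all (js : seq 'I_d) : exists p q : seq 'I_n, forall j, j \in js -> separated p q j.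
Proof.
elim: js => [|j js [p [q hpq]]]; first by exists [::], [::].
suff [u [v huv]] : exists u v, separated (u ++ p) (v ++ q) j.
  exists (u ++ p), (v ++ q) => k; rewrite inE => /predU1P[->//|kjs].
  by apply: separated_cat; exact: hpq.
have [h|h] := ltP (run (s j) p (m j).1) (run (s j) q (m j).2).
  by have [u [v huv]] := separate_one h; exists u, v; left.
have h' : run (s j) q (m j).1 < run (s j) p (m j).2.
  have [am lr mb _ _] := Mm j.
  have hq := run_incr eta_gt0 (Da j) (Db j) (@step_incr j) q am lr mb.
  have hp := run_incr eta_gt0 (Da j) (Db j) (@step_incr j) p am lr mb.
  exact: lt_trans hq (le_lt_trans h hp).
by have [v [u hvu]] := separate_one h'; exists u, v; right.
Qed.

Lemma splitting_exists : exists (p q : seq 'I_n) (alpha : {ffun 'I_d -> bool}) (x0 : V),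
  [/\ size q = size p, (d <= size p)%N, (forall j : 'I_d, j = 0%N :> nat -> alpha j = false) &
  [/\ @Trect R d m x0, (forall x, @Trect R d m x -> le_sign alpha (along_path phi p x) x0) &
    (forall x, @Trect R d m x -> le_sign alpha x0 (along_path phi q x))]].
Proof.
pose j0 := Ordinal d_gt0.
have [p [q [sz dp sep h0]]] : exists p q : seq 'I_n, [/\ size q = size p, (d <= size p)%N,
    (forall j, separated p q j) & run (s j0) p (m j0).2 < run (s j0) q (m j0).1].
  have [p [q hpq]] := separate_all (enum 'I_d).
  (* A common length that exceeds both words and is at least d. *)
  pose N := (d + (size p + size q))%N.
  pose p' := nseq (N - size p) i0 ++ p; pose q' := nseq (N - size q) i0 ++ q.
  have sp' : size p' = N by rewrite size_cat size_nseq subnK// /N addnCA leq_addr.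
  have sq' : size q' = N by rewrite size_cat size_nseq subnK// /N addnA leq_addl.
  have sep' j : separated p' q' j by apply: separated_cat; apply: hpq; rewrite mem_enum.
  (* Exchanging the two words if necessary puts the image of p on the left in the first coordinate,
     which is the normalization alpha_1 = +1. *)
  have [h|h] := sep' j0.
    by exists p', q'; split => //; rewrite ?sp' ?sq'// /N leq_addr.
  exists q', p'; split => //; rewrite ?sp' ?sq'// /N ?leq_addr//.
  by move=> j; case: (sep' j) => ?; [right|left].
pose alpha := [ffun j => ~~ (run (s j) p (m j).2 < run (s j) q (m j).1)].
(* The corner of the image of p that is greatest for the order of alpha. *)
pose x0 : V := \row_j run (s j) p (if alpha j then (m j).1 else (m j).2).
exists p, q, alpha, x0; split => //.
  move=> j j0E; have -> : j = j0 by apply: val_inj.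
  by rewrite ffunE h0.
split.
- rewrite TrectE => j; rewrite mxE; apply: run_m_itv.
  by case: (alpha j); rewrite lexx m_le.
- move=> x; rewrite TrectE => hx j; rewrite mxE along_pathE.
  have /andP[h1 h2] := hx j.
  case: (alpha j); rewrite ?expr0 ?expr1 ?mul1r ?mulN1r ?opprB subr_ge0.
    by apply: run_m_mono.
  by apply: run_m_mono.
- move=> x; rewrite TrectE => hx j; rewrite mxE along_pathE.
  have /andP[h1 h2] := hx j; rewrite /alpha ffunE.
  case: ifPn => /= h; rewrite ?expr0 ?expr1 ?mul1r ?mulN1r ?opprB subr_ge0.
    have [h'|h'] := sep j; first by rewrite h' in h.
    by apply: le_trans (ltW h'); apply: run_m_mono.
  rewrite negbK in h; apply: (le_trans (ltW h)); exact: run_m_mono.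
Qed.

End splitting_words.

End product_dynamics.

(** * Stochastic gradient descent *)

(** The summands of the other coordinates cancel in the difference quotient, so both derivatives are
    limits of one and the same function. *)
Lemma separable_partial (R : realType) (n d : nat) (f : 'I_n -> 'rV[R]_d -> R)
    (fc : 'I_n -> 'I_d -> R -> R) (i : 'I_n) (j : 'I_d) (x : 'rV[R]_d) :
  separable_by f fc -> 'D_(delta_mx 0 j) (f i) x = derive1 (fc i j) (x 0 j).
Proof.
move=> hsep; rewrite /derive /derive1; set u := (X in X @ _); set v := (X in _ = lim (X @ _)).
suff -> : u = v by [].
apply/funext => h; rewrite /u /v /=; congr (_ *: _); rewrite !hsep (bigD1 j)//= (bigD1 j (P :=
  xpredT))//= !mxE !eqxx /= mulr1.
rewrite (eq_bigr (fun k => fc i k (x 0 k))); first by rewrite opprD addrACA subrr addr0.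
by move=> k kj; rewrite !mxE eqxx (negPf kj) /= mulr0 add0r.
Qed.

Lemma finite_set_choices (d : nat) (T : choiceType) (t0 : T) (A : 'I_d -> set T) :
  (forall j, finite_set (A j)) -> finite_set [set m : {ffun 'I_d -> T} | forall j, A j (m j)].
Proof.
move=> fA.
have /choice[s hs] : forall j, exists s : seq T, A j = [set` s] by move=> j; exact/finite_seqP.
pose N := (\max_j size (s j))%N.
pose mk (k : {ffun 'I_d -> 'I_N.+1}) := [ffun j => nth t0 (s j) (k j)].
apply: (@sub_finite_set _ _ (mk @` setT)); last exact/finite_image/finite_finset.
move=> m /= hm.
have ms j : m j \in s j by have := hm j; rewrite hs.
exists [ffun j => inord (index (m j) (s j))] => //.
apply/ffunP => j; rewrite !ffunE inordK ?nth_index//.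
rewrite ltnS (leq_trans (index_size _ _))//; exact: leq_bigmax.
Qed.

Lemma card_le_disjoint (J : Type) (U : pointedType) (M : set J) (S : J -> set U) (A : set U) :
  trivIset M S -> (forall m, M m -> (S m `&` A) !=set0) -> (M #<= A)%card.
Proof.
move=> tr ne.
have /choice[c hc] : forall m, exists x, M m -> (S m `&` A) x.
  move=> m; have [Mm|nMm] := pselect (M m); first by have [x hx] := ne m Mm; exists x.
  by exists point.
have c_inj : {in M &, injective c}.
  move=> m m'; rewrite !inE => Mm Mm' cE; apply: tr => //; exists (c m).
  by split; [have [] := hc m Mm|rewrite cE; have [] := hc m' Mm'].
have := inj_card_eq c_inj; rewrite card_eq_le => /andP[_ h].
apply: card_le_trans h _; apply: subset_card_le => _ [m Mm <-].
by have [] := hc m Mm.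
Qed.

Section sgd.
Context (R : realType) (n d : nat).
Local Notation V := 'rV[R]_d.
Variables (f : 'I_n -> V -> R) (fc : 'I_n -> 'I_d -> R -> R) (K eta : R).
Hypothesis hd : (0 < d)%N.
Hypothesis hsep : separable_by f fc.
Hypothesis hA1 : forall i j, nonzero_fun (fc i j) -> C1 (fc i j).
Hypothesis hA2 : forall i j, nonzero_fun (fc i j) -> finite_set (critical (fc i j)).
Hypothesis hA3 : forall i j, nonzero_fun (fc i j) -> coercive (fc i j).
Hypothesis hK : 0 < K.
Hypothesis hA4 : forall i j, K.-lipschitz_(Icoord fc j) (derive1 (fc i j)).
Hypothesis hA5 : forall j, \bigcap_i critical (fc i j) = set0.
Hypothesis heta : 0 < eta < K^-1.
Local Notation phi := (sgd_map eta f).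
Local Notation P := (markov_op phi).
Local Notation F := (mean_objective f).
Local Notation I := (state_space fc).
Local Notation M := (Mset fc).
Let D i j := derive1 (fc i j).
Let a := Imin fc.
Let b := Imax fc.

Lemma sgd_mapE i x j : phi i x 0 j = step (D^~ j) eta i (x 0 j).
Proof. by rewrite /sgd_map /gradient !mxE (separable_partial _ _ _ hsep). Qed.

Let D_cont i j : continuous (D i j).
Proof. exact: (D_continuous (fun i => @hA1 i j)). Qed.
Let D_nz j x : exists i, D i j x != 0.
Proof. exact: (D_neq0 (hA5 j)). Qed.
Let eta0 : 0 < eta. Proof. exact: (eta_gt0 heta). Qed.
Let Da j i : D i j (a j) <= 0.
Proof. exact: (D_a (fun i => @hA1 i j) (fun i => @hA2 i j) (fun i => @hA3 i j) (hA5 j)). Qed.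
Let Db j i : 0 <= D i j (b j).
Proof. exact: (D_b (fun i => @hA1 i j) (fun i => @hA2 i j) (fun i => @hA3 i j) (hA5 j)). Qed.
Let s_incr j i x y : a j <= x -> x < y -> y <= b j ->
  step (D^~ j) eta i x < step (D^~ j) eta i y.
Proof. exact: (step_incr heta hK (fun i => @hA4 i j)). Qed.
Let IE : I = [set x | forall j, a j <= x 0 j <= b j].
Proof. by apply/seteqP; split => x h j; move: (h j); rewrite /Icoord /= in_itv. Qed.
Let ME : M = [set m | forall j, Tspec (D^~ j) (a j) (b j) (m j)].
Proof.
apply/seteqP; split => m h j; have := h j;
  by move/(TintervalsP (fun i => @hA1 i j) (fun i => @hA2 i j) (fun i => @hA3 i j) (hA5 j)).
Qed.

Lemma sgd_n_gt0 : (0 < n)%N.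
Proof. exact: (card_gt0 hd D_nz). Qed.

Lemma sgd_map_continuous i : continuous (phi i).
Proof. exact: (phi_cont sgd_mapE D_cont). Qed.

Lemma state_space_preserved : preserved phi I.
Proof. rewrite IE; exact: (I_preserved sgd_mapE eta0 Da Db s_incr). Qed.

Lemma state_space_closed : closed I.
Proof. rewrite IE; exact: I_closed. Qed.

Lemma state_space_compact : compact I.
Proof. rewrite IE; exact: I_compact. Qed.

Lemma Trect_state_space m : M m -> Trect m `<=` I.
Proof. rewrite ME IE; exact: Trect_sub. Qed.

Lemma sgd_Trect_preserved m : M m -> preserved phi (Trect m).
Proof. rewrite ME; exact: (Trect_preserved sgd_mapE eta0 s_incr). Qed.

Lemma Mset_trivIset : trivIset M (@Trect R d).
Proof. rewrite ME; exact: (Trect_trivIset D_nz). Qed.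

Lemma sgd_monotone alpha i x y : I x -> I y -> le_sign alpha x y ->
  le_sign alpha (phi i x) (phi i y).
Proof. rewrite IE; exact: (phi_monotone sgd_mapE s_incr). Qed.

Lemma sgd_reach : exists l0, (0 < l0)%N /\ forall x, I x ->
  exists w, size w = l0 /\ (\bigcup_(m in M) @Trect R d m) (along_path phi w x).
Proof. rewrite ME IE; exact: (reach_T hd sgd_mapE D_cont eta0 D_nz Da Db s_incr). Qed.

Lemma sgd_splitting m : M m -> exists (p q : seq 'I_n) (alpha : {ffun 'I_d -> bool}) (x0 : V),
  [/\ size q = size p, (d <= size p)%N, (forall j : 'I_d, j = 0%N :> nat -> alpha j = false) &
  [/\ @Trect R d m x0, (forall x, @Trect R d m x -> le_sign alpha (along_path phi p x) x0) &
    (forall x, @Trect R d m x -> le_sign alpha x0 (along_path phi q x))]].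
Proof. rewrite ME; exact: (splitting_exists hd sgd_mapE D_cont eta0 D_nz Da Db s_incr). Qed.

Lemma Mset_le m j : M m -> (m j).1 < (m j).2.
Proof. by move=> /(_ j)[]. Qed.

Lemma sgd_stationary m : M m -> exists mu : probRV R d, mu (Trect m) = 1%E /\ invariant_measure phi mu.
Proof.
move=> Mm; rewrite TrectE.
apply: (@stationary_exists R n d (fun i j => step (D^~ j) eta i) (fun j => (m j).1) (fun j => (m j).2)).
- exact: sgd_n_gt0.
- by move=> j; apply: ltW; exact: Mset_le.
- by move=> i j x; apply: (step_cont (fun i => @D_cont i j)).
- move: Mm; rewrite ME => Mm i j x hx; have [am _ mb [m1 m2] _] := Mm j.
  exact: (step_itv eta0 (@s_incr j)).
- move: Mm; rewrite ME => Mm i j x y mx xy ym; have [am _ mb _ _] := Mm j.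
  by apply: (step_le (@s_incr j)) => //; [exact: le_trans mx|exact: le_trans mb].
- exact: sgd_map_continuous.
- exact: sgd_mapE.
Qed.

Lemma Mset_finite : finite_set M.
Proof.
apply: (@finite_set_choices d (R * R)%type (0, 0) (fun j => Tintervals (fc^~ j))) => j.
exact: (Tintervals_finite (fun i => @hA1 i j) (fun i => @hA2 i j)).
Qed.

Lemma Trect_nonempty m : M m -> @Trect R d m !=set0.
Proof.
move=> Mm; exists (\row_j (m j).1); rewrite TrectE => j.
by rewrite mxE lexx ltW// Mset_le.
Qed.

(** F is a sum over coordinates, so interior minimizers in the single T-intervals combine to a
    minimizer over a box that is a neighbourhood of it. *)
Lemma Trect_local_minimizer m : M m -> (Trect m `&` local_minimizers F) !=set0.
Proof.
move=> Mm.
have /choice[c hc] : forall j, exists c, (m j).1 < c < (m j).2 /\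
    forall y, (m j).1 <= y <= (m j).2 -> \sum_(i < n) fc i j c <= \sum_(i < n) fc i j y.
  move=> j; have [c h1 h2] := Tinterval_min (fun i => @hA1 i j) (fun i => @hA2 i j)
    (fun i => @hA3 i j) (hA5 j) (Mm j).
  by exists c.
have FE x : F x = n%:R^-1 * \sum_(j < d) \sum_(i < n) fc i j (x 0 j).
  by rewrite /mean_objective exchange_big; congr (_ * _); apply: eq_bigr => i _; rewrite hsep.
exists (\row_j c j); split.
  by rewrite TrectE => j; rewrite mxE; have [/andP[/ltW-> /ltW->]] := hc j.
have near_box : \forall y \near (\row_j c j : V), forall j, (m j).1 < (y : V) 0 j < (m j).2.
  apply: (@filter_forall _ _ (fun (j : 'I_d) (y : V) => is_true ((m j).1 < y 0 j < (m j).2)) (nbhs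
    (\row_j c j : V))) => j.
  have := @coord_continuous R 1 d 0 j (\row_k c k : V).
  rewrite /continuous_at => /(_ `](m j).1, (m j).2[%classic); rewrite /nbhs /=.
  move=> h; apply: (@filterS _ (nbhs (\row_k c k : V)) _ _ _ _ (h _)).
    by move=> y; rewrite /= in_itv.
  have : nbhs ((\row_k c k : V) 0 j : R) `](m j).1, (m j).2[%classic; last by [].
  apply: open_nbhs_nbhs; split; first exact: itv_open.
  by rewrite /= in_itv /= mxE; have [] := hc j.
apply: (@filterS _ (nbhs (\row_j c j : V)) _ _ _ _ near_box) => y hy /=.
rewrite !FE ler_wpM2l ?invr_ge0//; apply: ler_sum => j _; rewrite mxE.
by have [_] := hc j; apply; have /andP[/ltW-> /ltW->] := hy j.
Qed.

Section stationary_data.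
Variables (l0 : nat) (mustar : {ffun 'I_d -> R * R} -> probRV R d).
Variables (p q : {ffun 'I_d -> R * R} -> seq 'I_n).
Variables (alpha : {ffun 'I_d -> R * R} -> {ffun 'I_d -> bool}) (x0 : {ffun 'I_d -> R * R} -> V).
Local Notation T := (\bigcup_(m in M) @Trect R d m).
Local Notation B := (I `\` T).
Hypothesis l0_gt0 : (0 < l0)%N.
Hypothesis reach : forall x, I x -> exists w, size w = l0 /\ T (along_path phi w x).
Hypothesis mustar1 : forall m, M m -> mustar m (Trect m) = 1%E.
Hypothesis mustar_inv : forall m, M m -> invariant_measure phi (mustar m).
Hypothesis size_pq : forall m, M m -> size (q m) = size (p m).
Hypothesis size_p : forall m, M m -> (d <= size (p m))%N.
Hypothesis alpha0 : forall m, M m -> forall j : 'I_d, j = 0%N :> nat -> alpha m j = false.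
Hypothesis Tx0 : forall m, M m -> Trect m (x0 m).
Hypothesis p_below : forall m, M m -> forall x, Trect m x -> le_sign (alpha m) (along_path phi (p
  m) x) (x0 m).
Hypothesis q_above : forall m, M m -> forall x, Trect m x -> le_sign (alpha m) (x0 m) (along_path
  phi (q m) x).
Let lm m := size (p m).
Let low m := lower_set (@Trect R d m) (alpha m).
Let g := absorption_prob phi (@Trect R d).
Let n0 := sgd_n_gt0.
Let phic := sgd_map_continuous.
Let Ic := state_space_closed.
Let Iinv := state_space_preserved.
Let Mfin := Mset_finite.
Let Tc m (_ : M m) := @Trect_closed R d m.
Let Tsub := Trect_state_space.
Let Tinv := sgd_Trect_preserved.
Let Ttr := Mset_trivIset.

Let T_mono m : M m -> forall i x y, Trect m x -> Trect m y -> le_sign (alpha m) x y ->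
  le_sign (alpha m) (phi i x) (phi i y).
Proof. by move=> Mm i x y Tx Ty; apply: sgd_monotone; apply: (Tsub Mm). Qed.

Let lm_gt0 m : M m -> (0 < lm m)%N.
Proof. by move=> Mm; apply: leq_trans (size_p Mm). Qed.

Lemma mustar_unique m (nu : probRV R d) : M m -> nu (Trect m) = 1%E ->
  invariant_measure phi nu -> same_measure nu (mustar m).
Proof.
by move=> Mm; apply: (sink_unique n0 phic (Tc Mm) (Tinv Mm) (T_mono Mm) (size_pq Mm) (lm_gt0 Mm)
  (Tx0 Mm) (p_below Mm) (q_above Mm) (mustar1 Mm) (mustar_inv Mm)).
Qed.

Let mix m k A x : M m -> borel_set A -> low m A -> Trect m x ->
   `|iter k (markov_dual phi) (\1_A) x - pr (mustar m) A| <= geom_rate R n (lm m) ^+ (k %/ lm m).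
Proof.
by move=> Mm; apply: (sink_pointwise n0 phic (Tc Mm) (Tinv Mm) (T_mono Mm) (size_pq Mm)
  (Tx0 Mm) (p_below Mm) (q_above Mm) (mustar1 Mm) (mustar_inv Mm)).
Qed.

Lemma supported_T m (nu : probRV R d) : M m -> meas_support nu `<=` Trect m <-> nu (Trect m) = 1%E.
Proof. by move=> Mm; apply: support_prob1; exact: Tc. Qed.

Lemma supported_I (nu : probRV R d) : meas_support nu `<=` I <-> nu I = 1%E.
Proof. exact: support_prob1. Qed.

Lemma sgd_absorbing m : M m -> absorbing phi (Trect m).
Proof.
move=> Mm; split; [by apply: borel_closed; exact: Tc|exact: Trect_nonempty|move=> x Tx].
rewrite /transition (_ : #|_| = n) ?mulVf ?pnatr_eq0 -?lt0n//.
by rewrite -[RHS]card_ord; apply: eq_card => i; rewrite !inE; apply/mem_set; exact: Tinv.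
Qed.

Lemma positive_invariantP (S : set V) : S !=set0 -> preserved phi S -> positive_invariant phi S.
Proof. by move=> S0 hS; split => // i _ [x Sx <-]; exact: hS. Qed.

Lemma state_space_nonempty : I !=set0.
Proof.
exists (\row_j a j); rewrite IE => j; rewrite mxE lexx.
exact: (le_ab (fun i => @hA1 i j) (fun i => @hA2 i j) (fun i => @hA3 i j) (hA5 j)).
Qed.

Lemma T_nonempty : T !=set0.
Proof. by have [x Ix] := state_space_nonempty; have [w [_ Tw]] := reach Ix; eexists; exact: Tw. Qed.

Lemma reach_tuple x : I x -> exists w : l0.-tuple 'I_n, T (along_path phi w x).
Proof. by move=> /reach[w [sw Tw]]; exists (tcast sw (in_tuple w)); rewrite val_tcast. Qed.

Lemma mustar_contraction m (mu : probRV R d) : M m -> d = 1%N -> meas_support mu `<=` Trect m ->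
  (d_F I (iter (lm m) P mu) (mustar m) <= (geom_rate R n (lm m))%:E * d_F I mu (mustar m))%E.
Proof.
move=> Mm d1 /(supported_T _ Mm) mu1.
apply: (sink_d_F n0 d1 phic (Tc Mm) (Tsub Mm) (Tinv Mm) Iinv state_space_compact
   (alpha := alpha m) _ _ (size_pq Mm) (Tx0 Mm) (p_below Mm) (q_above Mm) (mustar1 Mm) (mustar_inv
     Mm)) => //.
(* For d = 1 the only index is 0, so the normalization makes the order of alpha the usual one. *)
- by move=> j; apply: (alpha0 Mm); move: (ltn_ord j); rewrite {2}d1 ltnS leqn0 => /eqP.
- by move=> i x y; exact: sgd_monotone.
Qed.

Lemma mustar_d_sign m (mu : probRV R d) k : M m -> meas_support mu `<=` Trect m ->
  (d_sign I (alpha m) (iter k P mu) (mustar m) <= (geom_rate R n (lm m) ^+ (k %/ lm m))%:E)%E.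
Proof.
move=> Mm /(supported_T _ Mm) mu1.
exact: (sink_d_sign n0 phic (Tc Mm) (Tsub Mm) (Tinv Mm) (T_mono Mm) (size_pq Mm)
  (Tx0 Mm) (p_below Mm) (q_above Mm) (mustar1 Mm) (mustar_inv Mm)).
Qed.

Lemma mustar_inj m m' : M m -> M m' -> same_measure (mustar m) (mustar m') -> m = m'.
Proof.
move=> Mm Mm' e; apply: contrapT => mm'.
have m'0 : mustar m' (Trect m) = 0%E.
  apply: (pr_out0 (borel_closed (Tc Mm')) (borel_closed (Tc Mm)) (mustar1 Mm')) => x T'x Tx.
  exact: mm' (Tm_uniq Ttr Mm Mm' Tx T'x).
have := mustar1 Mm; rewrite e ?m'0; last by apply: borel_closed; exact: Tc.
by move/eqP; rewrite eqe eq_sym oner_eq0.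
Qed.

Lemma sgd_absorption_family : absorption_family phi I M g.
Proof.
split.
- by move=> m Mm x _; exact: (absorption_harmonic n0 Tinv).
- move=> m Mm; split; first exact: (absorption_continuous n0 phic Iinv Mfin Tc Tinv Ttr reach l0_gt0).
  by move=> x _; exact: (absorption_ge0 n0 Tinv).
- move=> x Ix; have [s [us sM hs _ _]] := finite_sum_seq R Mfin.
  by rewrite hs; exact: (absorption_partition n0 Iinv Tinv Ttr reach l0_gt0).
- move=> m Mm; split; first by move=> x; exact: (absorption_in n0 Tinv).
  by move=> m' Mm' mm' x; exact: (absorption_other n0 Tinv Ttr).
Qed.

Lemma sgd_absorption_family_uniq g' : absorption_family phi I M g' ->
  forall m, M m -> forall x, I x -> g' m x = g m x.
Proof.
move=> [h1 h2 h3 h4] m Mm x Ix.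
apply: (absorption_family_uniq n0 Iinv Mfin Tinv Ttr reach l0_gt0 h1 _ h3 h4 Mm Ix).
by move=> m' /h2[].
Qed.

Lemma sgd_coef_delta m m' : M m -> M m' ->
  absorption_coef I (mustar m') (g m) = ((m == m')%:R)%:E.
Proof.
move=> Mm Mm'.
rewrite (absorption_coefE n0 phic Ic Iinv Mfin Tc Tinv Ttr reach l0_gt0)//.
by rewrite (coef_delta n0 phic Ic Iinv Mfin Tc Tsub Tinv Ttr reach l0_gt0 mustar1).
Qed.

Lemma sgd_rate_length : (d <= 2 * maxn l0 (\big[maxn/0%N]_(m \in M) lm m))%N.
Proof.
have [s [us sM _ _ hs]] := finite_sum_seq R Mfin; rewrite hs.
have [x [m Mm _]] := T_nonempty.
apply: leq_trans (size_p Mm) _; apply: (@leq_trans (\big[maxn/0%N]_(m <- s) lm m)).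
  by apply: leq_bigmax_seq => //; apply/sM.
by rewrite (leq_trans (leq_maxr l0 _))// leq_pmull.
Qed.

Let mulim (mu0 : probRV R d) (A : set V) :=
  (\sum_(m \in M) absorption_coef I mu0 (g m) * mustar m A)%E.
Let l := (2 * maxn l0 (\big[maxn/0%N]_(m \in M) lm m))%N.

Lemma sgd_d_tilde (mu0 : probRV R d) k : meas_support mu0 `<=` I ->
  (d_tilde I B M alpha (iter k P mu0) (mulim mu0)
         <= (3 * geom_rate R n l ^+ (k %/ l))%:E)%E.
Proof.
move=> /supported_I mu1.
apply: (d_tilde_bound n0 phic Ic Iinv Mfin Tc Tinv Ttr reach l0_gt0 (low := low) mustar1 lm_gt0 mix
  mu1) => //.
move=> m A Mm hA; split.
  by apply: measurableI; [by apply: borel_closed; exact: Afamily_closed hA|exact: borel_closed].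
by apply: lower_setI_super; [exact: Tsub|exact: Afamily_lower].
Qed.

Lemma sgd_d_F (mu0 : probRV R d) k : d = 1%N -> meas_support mu0 `<=` I ->
  (d_F I (iter k P mu0) (mulim mu0) <= (3 * geom_rate R n l ^+ (k %/ l))%:E)%E.
Proof.
move=> d1 /supported_I mu1; apply: ereal_sup_le => _ [x Ix <-].
apply: (lower_bound_error n0 phic Ic Iinv Mfin Tc Tinv Ttr reach l0_gt0 (low := low) lm_gt0 mix mu1) => //.
- by apply: borel_closed; apply: lower_box_closed; exact: state_space_compact.
- by move=> y [].
move=> m Mm; apply: lower_box_lower; first exact: Tsub.
by move=> j; apply: (alpha0 Mm); move: (ltn_ord j); rewrite {2}d1 ltnS leqn0 => /eqP.
Qed.

End stationary_data.

End sgd.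

Theorem theorem2p2 (R : realType) (n d : nat) (hd : (0 < d)%N)
  (f : 'I_n -> 'rV[R]_d -> R) (fc : 'I_n -> 'I_d -> R -> R) (K eta : R)
  (hf0 : forall i, nonzero_fun (f i))
  (hsep : separable_by f fc)
  (hA1 : forall i j, nonzero_fun (fc i j) -> C1 (fc i j))
  (hA2 : forall i j, nonzero_fun (fc i j) -> finite_set (critical (fc i j)))
  (hA3 : forall i j, nonzero_fun (fc i j) -> coercive (fc i j))
  (hK : 0 < K)
  (hA4 : forall i j, K.-lipschitz_(Icoord fc j) (fc i j)^`())
  (hA5 : forall j, \bigcap_i critical (fc i j) = set0)
  (heta : 0 < eta < K^-1) :
  let phi := sgd_map eta f in
  let P := markov_op phi in
  let F := mean_objective f in
  let I := state_space fc in
  let M := Mset fc in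
  let T := \bigcup_(m in M) Trect m in
  let B := I `\` T in
  finite_set M /\
  exists (l0 : nat)
         (mustar : {ffun 'I_d -> R * R} -> probRV R d)
         (lm : {ffun 'I_d -> R * R} -> nat)
         (alpha : {ffun 'I_d -> R * R} -> {ffun 'I_d -> bool})
         (g : {ffun 'I_d -> R * R} -> 'rV[R]_d -> R),
  let mulim (mu0 : probRV R d) (A : set 'rV[R]_d) :=
    (\sum_(m \in M) absorption_coef I mu0 (g m) * mustar m A)%E in
  let l := (2 * maxn l0 (\big[maxn/0%N]_(m \in M) lm m))%N in
  [/\ [/\ positive_invariant phi I,
          I = B `|` T,
          B `&` T = set0
        & trivIset M (@Trect R d)],
      [/\ forall m, M m ->
            [/\ positive_invariant phi (Trect m), absorbing phi (Trect m)
              & (Trect m `&` local_minimizers F) !=set0]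
        & ([set Trect m | m in M] #<= local_minimizers F)%card],
      (T !=set0 /\
       forall x, I x -> exists p : l0.-tuple 'I_n, T (along_path phi p x))
    & 
      (uniformly_transient phi B /\
       forall mu : probRV R d, meas_support mu `<=` I ->
         (iter l0 P mu B <= (geom_rate R n l0)%:E * mu B)%E)] /\
  [/\ forall m, M m ->
        [/\ meas_support (mustar m) `<=` Trect m,
            invariant_measure phi (mustar m)
          & forall nu : probRV R d, meas_support nu `<=` Trect m ->
              invariant_measure phi nu -> same_measure nu (mustar m)],
      forall m, M m ->
        [/\ (d <= lm m)%N,
            forall j : 'I_d, nat_of_ord j = 0%N -> alpha m j = false,
            forall mu : probRV R d, meas_support mu `<=` Trect m ->
              forall k, (0 < k)%N ->
              (d_sign I (alpha m) (iter k P mu) (mustar m)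
               <= (geom_rate R n (lm m) ^+ (k %/ lm m))%:E)%E
          & d = 1%N ->
            forall mu : probRV R d, meas_support mu `<=` Trect m ->
              (d_F I (iter (lm m) P mu) (mustar m)
               <= (geom_rate R n (lm m))%:E * d_F I mu (mustar m))%E],
      (* the mustar m are the only invariant measures supported in I, up to
         convex combinations *)
      (forall nu : probRV R d, meas_support nu `<=` I -> invariant_measure phi nu ->
         exists c : {ffun 'I_d -> R * R} -> R,
           [/\ forall m, M m -> 0 <= c m, \sum_(m \in M) c m = 1
             & same_measure nu
                 (fun A => \sum_(m \in M) (c m)%:E * mustar m A)%E]) /\
      (forall nu : probRV R d,
         extremal_invariant phi I nu <->
         exists2 m, M m & same_measure nu (mustar m)),
      forall m m', M m -> M m' -> same_measure (mustar m) (mustar m') -> m = m'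
    & (M #<= local_minimizers F)%card] /\
  [/\ absorption_family phi I M g /\
      (forall g', absorption_family phi I M g' ->
         forall m, M m -> forall x, I x -> g' m x = g m x),
      forall m m', M m -> M m' ->
        absorption_coef I (mustar m') (g m) = ((m == m')%:R)%:E,
      forall mu0 : probRV R d, meas_support mu0 `<=` I ->
        invariant_measure phi (mulim mu0),
      (d <= l)%N
    & forall mu0 : probRV R d, meas_support mu0 `<=` I ->
        forall k, (0 < k)%N ->
        (d_tilde I B M alpha (iter k P mu0) (mulim mu0)
         <= (3 * geom_rate R n l ^+ (k %/ l))%:E)%E /\
        (d = 1%N ->
         (d_F I (iter k P mu0) (mulim mu0)
          <= (3 * geom_rate R n l ^+ (k %/ l))%:E)%E)].
Proof.
move=> phi P F I M T B; split; first exact: Mset_finite.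
have [l0 [l0_gt0 reach]] := sgd_reach hd hsep hA1 hA2 hA3 hK hA4 hA5 heta.
have /choice[data hdata] : forall m : {ffun 'I_d -> R * R}, exists t :
    probRV R d * (seq 'I_n * seq 'I_n) * ({ffun 'I_d -> bool} * 'rV[R]_d), M m ->
    [/\ t.1.1 (Trect m) = 1%E, invariant_measure phi t.1.1 &
     [/\ size t.1.2.2 = size t.1.2.1, (d <= size t.1.2.1)%N,
      (forall j : 'I_d, j = 0%N :> nat -> t.2.1 j = false) &
     [/\ @Trect R d m t.2.2, (forall x, @Trect R d m x -> le_sign t.2.1 (along_path phi t.1.2.1 x) t.2.2) &
    (forall x, @Trect R d m x -> le_sign t.2.1 t.2.2 (along_path phi t.1.2.2 x))]]].
  move=> m; have [Mm|nMm] := pselect (M m); last first.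
    (* Arbitrary values outside M, so that the choice yields total functions. *)
    by exists (@dirac _ (borelRV R d) 0 R : probRV R d, ([::], [::]), ([ffun=> false], 0)).
  have [mu [mu1 mu_inv]] := sgd_stationary hd hsep hA1 hA2 hA3 hK hA4 hA5 heta Mm.
  have [p [q [alpha [x0 h]]]] := sgd_splitting hd hsep hA1 hA2 hA3 hK hA4 hA5 heta Mm.
  by exists (mu, (p, q), (alpha, x0)).
pose mustar m := (data m).1.1; pose p m := (data m).1.2.1; pose q m := (data m).1.2.2.
pose alpha m := (data m).2.1; pose x0 m := (data m).2.2.
have mustar1 m : M m -> mustar m (Trect m) = 1%E by case/hdata.
have mustar_inv m : M m -> invariant_measure phi (mustar m) by case/hdata.
have size_pq m : M m -> size (q m) = size (p m) by case/hdata => _ _ [].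
have size_p m : M m -> (d <= size (p m))%N by case/hdata => _ _ [].
have alpha0 m : M m -> forall j : 'I_d, j = 0%N :> nat -> alpha m j = false by case/hdata => _ _ [].
have Tx0 m : M m -> Trect m (x0 m) by case/hdata => _ _ [_ _ _ []].
have p_below m : M m -> forall x, Trect m x -> le_sign (alpha m) (along_path phi (p m) x) (x0 m).
  by case/hdata => _ _ [_ _ _ []].
have q_above m : M m -> forall x, Trect m x -> le_sign (alpha m) (x0 m) (along_path phi (q m) x).
  by case/hdata => _ _ [_ _ _ []].
have n0 : (0 < n)%N by exact: (sgd_n_gt0 hd hA5).
have phic i : continuous (phi i) by exact: (sgd_map_continuous hsep hA1).
have Ic : closed I := @state_space_closed R n d fc.
have Iinv : preserved phi I by exact: (state_space_preserved hsep hA1 hA2 hA3 hK hA4 hA5 heta).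
have Mfin : finite_set M by exact: Mset_finite.
have Tsub m : M m -> Trect m `<=` I by exact: (Trect_state_space hA1 hA2 hA3 hA5).
have Tinv m : M m -> preserved phi (Trect m).
  exact: (sgd_Trect_preserved hsep hA1 hA2 hA3 hK hA4 hA5 heta).
have Tc m (_ : M m) : closed (@Trect R d m) by exact: Trect_closed.
have Ttr : trivIset M (@Trect R d) by exact: (Mset_trivIset hA1 hA2 hA3 hA5).
have uniq_mustar m (nu : probRV R d) : M m -> nu (Trect m) = 1%E ->
    invariant_measure phi nu -> same_measure nu (mustar m).
  exact: (mustar_unique hd hsep hA1 hA2 hA3 hK hA4 hA5 heta mustar1 mustar_inv size_pq size_p Tx0
    p_below q_above).
have minF m : M m -> (Trect m `&` local_minimizers F) !=set0.
  exact: (Trect_local_minimizer hsep hA1 hA2 hA3 hA5).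
exists l0, mustar, (fun m => size (p m)), alpha, (absorption_prob phi (@Trect R d)) => mulim l.
split; [split|split; [split|split]].
- split.
  + apply: positive_invariantP => //; exact: (state_space_nonempty hA1 hA2 hA3 hA5).
  + apply/seteqP; split => x; last by case=> [[]|[m Mm]] //; exact: Tsub.
    by have [Tx|nTx] := pselect (T x); [right|left].
  + by apply/seteqP; split => x // -[[]].
  + exact: Ttr.
- split; last first.
    apply: card_le_trans (card_image_le _ _) _; exact: card_le_disjoint Ttr minF.
  move=> m Mm; split; last exact: minF.
    apply: positive_invariantP (Tinv _ Mm); exact: Trect_nonempty Mm.
  exact: (sgd_absorbing hd hsep hA1 hA2 hA3 hK hA4 hA5 heta Mm).
- split; first exact: (T_nonempty hA1 hA2 hA3 hA5 reach).
  by move=> x Ix; exact: (reach_tuple reach Ix).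
- split; first exact: (transient_B n0 Ic Iinv Mfin Tc Tinv reach).
  by move=> mu /supported_I mu1; exact: (transient_contraction n0 phic Ic Iinv Mfin Tc Tinv reach mu1).
- move=> m Mm; split; [by apply/(supported_T _ Mm); exact: mustar1|exact: mustar_inv|].
  by move=> nu /(supported_T _ Mm); exact: uniq_mustar.
- move=> m Mm; split; [exact: size_p|exact: alpha0| |].
    move=> mu mu1 k _.
    exact: (mustar_d_sign hd hsep hA1 hA2 hA3 hK hA4 hA5 heta mustar1 mustar_inv size_pq Tx0
      p_below q_above k Mm mu1).
  move=> d1 mu mu1.
  exact: (mustar_contraction hd hsep hA1 hA2 hA3 hK hA4 hA5 heta mustar1 mustar_inv size_pq alpha0
    Tx0 p_below q_above Mm d1 mu1).
- split.
    move=> nu /supported_I nu1 nu_inv; exists (fun m => pr nu (Trect m)).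
    by have [h1 [h2 h3]] := invariant_decomposition n0 phic Ic Iinv Mfin Tc Tsub Tinv Ttr reach l0_gt0
      uniq_mustar nu1 nu_inv.
  exact: (extremal_mustar n0 phic Ic Iinv Mfin Tc Tsub Tinv Ttr reach l0_gt0 mustar1 mustar_inv
    uniq_mustar).
- exact: (mustar_inj hA1 hA2 hA3 hA5 mustar1).
- exact: card_le_disjoint Ttr minF.
- split; first exact: (sgd_absorption_family hd hsep hA1 hA2 hA3 hK hA4 hA5 heta l0_gt0 reach).
  exact: (sgd_absorption_family_uniq hd hsep hA1 hA2 hA3 hK hA4 hA5 heta l0_gt0 reach).
- exact: (sgd_coef_delta hd hsep hA1 hA2 hA3 hK hA4 hA5 heta l0_gt0 reach mustar1).
- move=> mu0 _; exact: (limit_measure_invariant n0 phic Ic Iinv Mfin Tc Tinv Ttr reach l0_gt0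
  mustar_inv mu0).
- exact: (sgd_rate_length hA1 hA2 hA3 hA5 reach size_p).
- move=> mu0 mu1 k _; split.
    exact: (sgd_d_tilde hd hsep hA1 hA2 hA3 hK hA4 hA5 heta l0_gt0 reach mustar1 mustar_inv size_pq
      size_p Tx0 p_below q_above k mu1).
  move=> d1.
  exact: (sgd_d_F hd hsep hA1 hA2 hA3 hK hA4 hA5 heta l0_gt0 reach mustar1 mustar_inv size_pq
    size_p alpha0 Tx0 p_below q_above k d1 mu1).
Qed.
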